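(* Let $k$ be a field, let $\Lambda$ be a Frobenius $k$-algebra and let $V$ be a finitely generated $\Lambda$-module whose stable endomorphism ring $\underline{\mathrm{End}}_\Lambda(V)$ is isomorphic to $k$. Then the versal deformation ring $R(\Lambda,V)$ is universal. Moreover, $R(\Lambda,V)$ is isomorphic to $R(\Lambda,V\oplus P)$ for every finitely generated projective $\Lambda$-module $P$, and $R(\Lambda,V)$ is isomorphic to $R(\Lambda,\Omega(V))$, where $\Omega(V)$ is the first syzygy of $V$.
   Context: $k$ is a field of arbitrary characteristic. A Frobenius $k$-algebra is a finite dimensional $k$-algebra $\Lambda$ admitting a non-degenerate associative bilinear form $\Lambda\times\Lambda\to k$; equivalently, $\Lambda_\Lambda\cong \mathrm{Hom}_k({}_\Lambda\Lambda,k)$ as right $\Lambda$-modules. Modules are left modules unless stated otherwise. The stable endomorphism ring $\underline{\mathrm{End}}_\Lambda(V)$ is the quotient of $\mathrm{End}_\Lambda(V)$ by the ideal of endomorphisms that factor through a projective module. The first syzygy $\Omega(V)$ is the kernel of a projective cover $P_V\to V$. Deformations. Let $\hat{\mathcal{C}}$ be the category of all complete local commutative Noetherian $k$-algebras with residue field $k$, with morphisms the continuous $k$-algebra homomorphisms inducing the identity on $k$, and let $\mathcal{C}$ be the full subcategory of Artinian objects. Let $\Lambda$ be a finite dimensional $k$-algebra and $V$ a finitely generated $\Lambda$-module. A lift of $V$ over $R\in\hat{\mathcal{C}}$ is a pair $(M,\phi)$, where $M$ is a finitely generated $R\otimes_k\Lambda$-module which is free over $R$ and $\phi:k\otimes_R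 M\to V$ is a $\Lambda$-module isomorphism. Two lifts $(M,\phi)$, $(M',\phi')$ over $R$ are isomorphic if there is an $R\otimes_k\Lambda$-module isomorphism $f:M\to M'$ with $\phi'\circ(k\otimes_R f)=\phi$. The isomorphism class $[M,\phi]$ is called a deformation of $V$ over $R$. The deformation functor $\hat F_V:\hat{\mathcal{C}}\to\mathrm{Sets}$ sends $R$ to the set of deformations of $V$ over $R$, and sends a morphism $\alpha:R\to R'$ to the map $[M,\phi]\mapsto[R'\otimes_{R,\alpha}M,\phi_\alpha]$, where $\phi_\alpha$ is the composition $k\otimes_{R'}(R'\otimes_{R,\alpha}M)\cong k\otimes_R M\xrightarrow{\phi}V$. Let $F_V$ be its restriction to $\mathcal{C}$. The functor $F_V$ always has a pro-representable hull $R(\Lambda,V)\in\hat{\mathcal{C}}$ in the sense of Schlessinger (there is a deformation of $V$ over $R(\Lambda,V)$ such that the induced natural transformation $\mathrm{Hom}_{\hat{\mathcal{C}}}(R(\Lambda,V),-)\to F_V$ on $\mathcal{C}$ is smooth and is bijective on the ring of dual numbers $k[\epsilon]$, $\epsilon^2=0$; in particular $\mathrm{Hom}_{\hat{\mathcal{C}}}(R(\Lambda,V),R)\to\hat F_V(R)$ is surjective for all $R\in\hat{\mathcal C}$). $R(\Lambda,V)$ is called the versal deformation ring of $V$; it is unique up to isomorphism. It is called universal if $R(\Lambda,V)$ represents $\hat F_V$, i.e. $\hat F_V\cong\mathrm{Hom}_{\hat{\mathcal{C}}}(R(\Lambda,V),-)$. Isomorphisms of deformation rings are isomorphisms in $\hat{\mathcal{C}}$.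 *)

(* Defs.v *)
From HB Require Import structures.
From mathcomp Require Import all_boot all_order all_algebra all_field.
From mathcomp Require Import boolp.

Set Implicit Arguments.
Unset Strict Implicit.
Unset Printing Implicit Defensive.

Import GRing.Theory.

Local Open Scope ring_scope.
Local Open Scope quotient_scope.

Section Tensor.

Context (A B : comNzRingType) (alpha : {rmorphism A -> B}) (M : lmodType A).

(* A formal sum [:: (b1, m1); ...] stands for b1 (x) m1 + ... ; [teq] is the
   additive congruence generated by the defining relations of B (x)_A M. *)
Inductive teq : seq (B * M) -> seq (B * M) -> Prop :=
| teq_refl s : teq s s
| teq_sym s t : teq s t -> teq t s
| teq_trans t s u : teq s t -> teq t u -> teq s u
| teq_perm s t : perm_eq s t -> teq s t
| teq_cat s t u : teq s t -> teq (s ++ u) (t ++ u)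
| teq_0 m : teq [:: (0, m)] [::]
| teq_addl b b' m : teq [:: (b + b', m)] [:: (b, m); (b', m)]
| teq_addr b m m' : teq [:: (b, m + m')] [:: (b, m); (b, m')]
| teq_bal b a m : teq [:: (b * alpha a, m)] [:: (b, a *: m)].

Definition teqb (s t : seq (B * M)) : bool := `[< teq s t >].

Lemma teqb_equiv : equiv_class_of teqb.
Proof.
split=> [s|s t|t s u]; first exact/asboolP/teq_refl.
- by apply/idP/idP => /asboolP h; apply/asboolP/teq_sym.
- by move=> /asboolP h1 /asboolP h2; apply/asboolP; exact: teq_trans h1 h2.
Qed.

Canonical teqb_equiv_rel := EquivRelPack teqb_equiv.
Canonical teqb_encModRel := defaultEncModRel teqb.

Definition tens := {eq_quot teqb}.

HB.instance Definition _ : EqQuotient _ teqb tens := EqQuotient.on tens.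
HB.instance Definition _ := Choice.on tens.

Definition tclass (s : seq (B * M)) : tens := \pi_tens s.

Lemma tclassP s t : tclass s = tclass t <-> teq s t.
Proof.
split=> [/eqP|h]; rewrite /tclass.
  by rewrite piE => /asboolP.
by apply/eqP; rewrite piE; apply/asboolP.
Qed.

Lemma tclass_ind (P : tens -> Prop) : (forall s, P (tclass s)) -> forall x, P x.
Proof. by move=> h x; rewrite -[x]reprK; exact: h. Qed.

Lemma teq_repr s : teq (repr (tclass s)) s.
Proof. by apply/tclassP; rewrite /tclass reprK. Qed.

Lemma teq_catr s t u : teq s t -> teq (u ++ s) (u ++ t).
Proof.
move=> h; apply: (teq_trans (t := s ++ u)); first by apply/teq_perm; rewrite perm_catC.
by apply: (teq_trans (teq_cat u h)); apply/teq_perm; rewrite perm_catC.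
Qed.

Lemma teq_cat2 s t s' t' : teq s t -> teq s' t' -> teq (s ++ s') (t ++ t').
Proof. by move=> h h'; exact: teq_trans (teq_cat _ h) (teq_catr _ h'). Qed.

Definition tsum_scale (c : B) (s : seq (B * M)) := [seq (c * p.1, p.2) | p <- s].

Lemma teq_scale c s t : teq s t -> teq (tsum_scale c s) (tsum_scale c t).
Proof.
elim=> {s t} /=.
- by move=> s; exact: teq_refl.
- by move=> s t _; exact: teq_sym.
- by move=> t s u _ h _; exact: teq_trans h.
- by move=> s t h; apply/teq_perm/perm_map.
- by move=> s t u _ h; rewrite /tsum_scale !map_cat; exact: teq_cat.
- by move=> m; rewrite mulr0; exact: teq_0.
- by move=> b b' m; rewrite mulrDr; exact: teq_addl.
- by move=> b m m'; exact: teq_addr.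
- by move=> b a m; rewrite mulrA; exact: teq_bal.
Qed.

Definition tens_zero : tens := tclass [::].
Definition tens_add (x y : tens) : tens := tclass (repr x ++ repr y).
Definition tens_scale (c : B) (x : tens) : tens := tclass (tsum_scale c (repr x)).
Definition tens_opp (x : tens) : tens := tens_scale (-1) x.

Lemma tens_addE s t : tens_add (tclass s) (tclass t) = tclass (s ++ t).
Proof. by apply/tclassP; apply: teq_cat2; exact: teq_repr. Qed.

Lemma tens_scaleE c s : tens_scale c (tclass s) = tclass (tsum_scale c s).
Proof. by apply/tclassP; apply: teq_scale; exact: teq_repr. Qed.

Lemma tens_addA : associative tens_add.
Proof.
elim/tclass_ind=> s; elim/tclass_ind=> t; elim/tclass_ind=> u.
by rewrite !tens_addE catA.
Qed.

Lemma tens_addC : commutative tens_add.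
Proof.
elim/tclass_ind=> s; elim/tclass_ind=> t; rewrite !tens_addE.
by apply/tclassP/teq_perm; rewrite perm_catC.
Qed.

Lemma tens_add0 : left_id tens_zero tens_add.
Proof. by elim/tclass_ind=> s; rewrite tens_addE. Qed.

Lemma tens_scaleDl x c d :
  tens_scale (c + d) x = tens_add (tens_scale c x) (tens_scale d x).
Proof.
elim/tclass_ind: x => s; rewrite !tens_scaleE tens_addE; apply/tclassP.
elim: s => [|[b m] s IHs] /=; first exact: teq_refl.
apply: (teq_trans (t := [:: (c * b, m); (d * b, m)] ++
                          (tsum_scale c s ++ tsum_scale d s))).
  rewrite -cat1s; apply: teq_cat2 => //.
  by rewrite mulrDl; exact: teq_addl.
apply/teq_perm; rewrite /= perm_cons -cat1s -[X in perm_eq _ (_ ++ X)]cat1s.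
by rewrite perm_catCA.
Qed.

Lemma tens_scale1 : left_id 1 tens_scale.
Proof.
elim/tclass_ind=> s; rewrite tens_scaleE /tsum_scale.
by rewrite (eq_map (g := id)) ?map_id // => -[b m] /=; rewrite mul1r.
Qed.

Lemma tens_scale0 x : tens_scale 0 x = tens_zero.
Proof.
elim/tclass_ind: x => s; rewrite tens_scaleE; apply/tclassP.
elim: s => [|[b m] s IHs] /=; first exact: teq_refl.
rewrite mul0r -cat1s; apply: (teq_trans (teq_cat2 (teq_0 m) IHs)).
exact: teq_refl.
Qed.

Lemma tens_addN : left_inverse tens_zero tens_opp tens_add.
Proof.
by move=> x; rewrite -{2}[x]tens_scale1 -tens_scaleDl addNr tens_scale0.
Qed.

HB.instance Definition _ :=
  GRing.isZmodule.Build tens tens_addA tens_addC tens_add0 tens_addN.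

Lemma tens_scaleA c d x : tens_scale c (tens_scale d x) = tens_scale (c * d) x.
Proof.
elim/tclass_ind: x => s; rewrite !tens_scaleE /tsum_scale -map_comp.
by congr tclass; apply: eq_map => -[b m] /=; rewrite mulrA.
Qed.

Lemma tens_scaleDr : right_distributive tens_scale +%R.
Proof.
move=> c; elim/tclass_ind=> s; elim/tclass_ind=> t.
by rewrite /GRing.add /= !(tens_scaleE, tens_addE) /tsum_scale map_cat.
Qed.

HB.instance Definition _ := GRing.Zmodule_isLmodule.Build B tens
  tens_scaleA tens_scale1 tens_scaleDr (fun x c d => tens_scaleDl x c d).

Definition tensor (b : B) (m : M) : tens := tclass [:: (b, m)].

Lemma tensorDl b b' m : tensor (b + b') m = tensor b m + tensor b' m.
Proof. by rewrite /GRing.add /= tens_addE; apply/tclassP; exact: teq_addl. Qed.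

Lemma tensorDr b m m' : tensor b (m + m') = tensor b m + tensor b m'.
Proof. by rewrite /GRing.add /= tens_addE; apply/tclassP; exact: teq_addr. Qed.

Lemma tensor_bal b a m : tensor (b * alpha a) m = tensor b (a *: m).
Proof. by apply/tclassP; exact: teq_bal. Qed.

Lemma tensorZ c b m : c *: tensor b m = tensor (c * b) m.
Proof. exact: tens_scaleE. Qed.

Lemma tensor0 b : tensor b (0 : M) = 0.
Proof.
rewrite -[0 in LHS](scale0r (0 : M)) -tensor_bal rmorph0 mulr0.
by apply/tclassP; exact: teq_0.
Qed.

Lemma tensorE b m : tensor b m = b *: tensor 1 m.
Proof. by rewrite tensorZ mulr1. Qed.

Lemma tens_sumE (x : tens) : x = \sum_(p <- repr x) tensor p.1 p.2.
Proof.
rewrite -{1}[x]reprK -/(tclass _); elim: (repr x) => [|[b m] s IHs].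
  by rewrite big_nil.
by rewrite big_cons -IHs /GRing.add /= tens_addE.
Qed.

Lemma tens_ind (P : tens -> Prop) :
    (forall b m, P (tensor b m)) -> P 0 ->
    (forall x y, P x -> P y -> P (x + y)) -> forall x, P x.
Proof.
move=> Pt P0 PD x; rewrite [x]tens_sumE.
by apply: (big_ind P) => // p _; exact: Pt.
Qed.

(* [tens_rec F] is the additive map with b (x) m |-> F b m; it is only
   meaningful for F balanced and biadditive, see [tens_recE]. *)
Definition tens_rec (N : zmodType) (F : B -> M -> N) (x : tens) : N :=
  \sum_(p <- repr x) F p.1 p.2.

Definition balanced (N : zmodType) (F : B -> M -> N) : Prop :=
  [/\ forall b b' m, F (b + b') m = F b m + F b' m,
      forall b m m', F b (m + m') = F b m + F b m'
    & forall b a m, F (b * alpha a) m = F b (a *: m)].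

Section Rec.
Context (N : zmodType) (F : B -> M -> N) (F_bal : balanced F).

Lemma balanced0 m : F 0 m = 0.
Proof.
case: F_bal => Dl _ _; have := Dl 0 0 m; rewrite addr0 => /eqP.
by rewrite -subr_eq0 opprD addrA subrr sub0r oppr_eq0 => /eqP.
Qed.

Lemma tens_rec_class s : tens_rec F (tclass s) = \sum_(p <- s) F p.1 p.2.
Proof.
rewrite /tens_rec; have := teq_repr s; move: (repr _) => r.
case: (F_bal) => Dl Dr Bal.
elim=> {s r} //=.
- by move=> s t u _ -> _ ->.
- by move=> s t h; exact: perm_big.
- by move=> s t u _ h; rewrite !big_cat /= h.
- by move=> m; rewrite big_cons !big_nil addr0 balanced0.
- by move=> b b' m; rewrite !big_cons !big_nil !addr0 Dl.
- by move=> b m m'; rewrite !big_cons !big_nil !addr0 Dr.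
- by move=> b a m; rewrite !big_cons !big_nil !addr0 Bal.
Qed.

Lemma tens_recE b m : tens_rec F (tensor b m) = F b m.
Proof. by rewrite tens_rec_class big_cons big_nil addr0. Qed.

Lemma tens_recD : {morph tens_rec F : x y / x + y}.
Proof.
elim/tclass_ind=> s; elim/tclass_ind=> t.
by rewrite [tclass s + _]tens_addE !tens_rec_class big_cat.
Qed.

Lemma tens_rec0 : tens_rec F 0 = 0.
Proof. by rewrite -[0]/(tclass [::]) tens_rec_class big_nil. Qed.
End Rec.

Lemma tens_ext (N : zmodType) (f g : tens -> N) :
  {morph f : x y / x + y} -> {morph g : x y / x + y} ->
  (forall b m, f (tensor b m) = g (tensor b m)) -> f =1 g.
Proof.
move=> fD gD fg; elim/tens_ind=> //; last by move=> x y hx hy; rewrite fD gD hx hy.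
have z0 (h : tens -> N) : {morph h : x y / x + y} -> h 0 = 0.
  move=> hD; have := hD 0 0; rewrite addr0 => /eqP.
  by rewrite -subr_eq0 opprD addrA subrr sub0r oppr_eq0 => /eqP.
by rewrite !z0.
Qed.

End Tensor.

Arguments tensor {A B} alpha {M} b m.
Arguments tens_rec {A B alpha M N} F x.

Section Modules.

Context (R : nzRingType).

Definition fin_gen (M : lmodType R) : Prop :=
  exists s : seq M, forall m,
    exists c : 'I_(size s) -> R, m = \sum_(i < size s) c i *: s`_i.

Definition is_free (M : lmodType R) : Prop :=
  exists (I : eqType) (e : I -> M),
    (forall m, exists t : seq (R * I), m = \sum_(p <- t) p.1 *: e p.2) /\
    (forall (s : seq I) (c : I -> R),
       uniq s -> \sum_(i <- s) c i *: e i = 0 -> {in s, forall i, c i = 0}).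

Definition surjective (X Y : Type) (f : X -> Y) : Prop := forall y, exists x, f x = y.

Definition projective (P : lmodType R) : Prop :=
  forall (X Y : lmodType R) (g : {linear X -> Y}) (f : {linear P -> Y}),
    surjective g -> exists h : {linear P -> X}, forall p, g (h p) = f p.

Lemma projective_prod (P Q : lmodType R) :
  projective P -> projective Q -> projective (P * Q)%type.
Proof.
move=> hP hQ X Y g f /[dup] /hP{}hP /hQ{}hQ.
pose fP (p : P) := f (p, 0); pose fQ (q : Q) := f (0, q).
have linP : linear fP.
  move=> c x y; rewrite /fP -linearP; congr (f _).
  by rewrite [RHS]surjective_pairing /= scaler0 addr0.
have linQ : linear fQ.
  move=> c x y; rewrite /fQ -linearP; congr (f _).
  by rewrite [RHS]surjective_pairing /= scaler0 addr0.
pose mP := GRing.isLinear.Build _ _ _ _ fP linP.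
pose mQ := GRing.isLinear.Build _ _ _ _ fQ linQ.
pose lP : {linear P -> Y} := HB.pack fP mP.
pose lQ : {linear Q -> Y} := HB.pack fQ mQ.
have [h1 E1] := hP lP; have [h2 E2] := hQ lQ.
pose h (x : P * Q) := h1 x.1 + h2 x.2.
have linh : linear h.
  by move=> c x y; rewrite /h /= !linearP scalerDr addrACA.
pose mh := GRing.isLinear.Build _ _ _ _ h linh.
pose lh : {linear (P * Q)%type -> X} := HB.pack h mh.
exists lh => -[p q] /=.
rewrite /h /= linearD E1 E2 /= /fP /fQ -linearD; congr (f _).
by rewrite [LHS]surjective_pairing /= addr0 add0r.
Qed.

Lemma projective_row0 : projective 'rV[R]_0.
Proof.
move=> X Y g f _; exists \0 => p /=.
by rewrite linear0 [p](_ : _ = 0) ?linear0 //; apply/rowP => -[].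
Qed.

(* A surjection from a projective module whose kernel is superfluous. *)
Definition projective_cover (P V : lmodType R) (pi : {linear P -> V}) : Prop :=
  [/\ projective P, surjective pi
    & forall N : P -> Prop,
        N 0 -> (forall c x y, N x -> N y -> N (c *: x + y)) ->
        (forall x, exists y z, [/\ N y, pi z = 0 & x = y + z]) ->
        forall x, N x].

(* W is (isomorphic to) the kernel Omega(V) of a projective cover of V. *)
Definition first_syzygy (W V : lmodType R) : Prop :=
  exists (P : lmodType R) (pi : {linear P -> V}) (i : {linear W -> P}),
    [/\ projective_cover pi, injective i
      & forall x, pi x = 0 <-> exists w, i w = x].

Definition endo (V : lmodType R) := {linear V -> V}.

End Modules.

Section StableEnd.

Context (R : nzRingType) (V : lmodType R).

Lemma linear_ext (f g : {linear V -> V}) : f =1 g -> f = g.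
Proof.
case: f g => [f [[fa] [fs]]] [g [[ga] [gs]]] /= /funext e.
by case: _ / e ga gs => ga gs; rewrite (Prop_irrelevance fa ga) (Prop_irrelevance fs gs).
Qed.

HB.instance Definition _ := gen_eqMixin (endo V).
HB.instance Definition _ := gen_choiceMixin (endo V).

Definition endo_fun (f : endo V) : {linear V -> V} := f.

Definition endo_zero : endo V := \0 : {linear V -> V}.
Definition endo_one : endo V := idfun : {linear V -> V}.
Definition endo_opp (f : endo V) : endo V := \- endo_fun f : {linear V -> V}.
Definition endo_add (f g : endo V) : endo V :=
  endo_fun f \+ endo_fun g : {linear V -> V}.
Definition endo_mul (f g : endo V) : endo V :=
  endo_fun f \o endo_fun g : {linear V -> V}.

Lemma endo_addA : associative endo_add.
Proof. by move=> f g h; apply: linear_ext => x /=; rewrite addrA. Qed.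
Lemma endo_addC : commutative endo_add.
Proof. by move=> f g; apply: linear_ext => x /=; rewrite addrC. Qed.
Lemma endo_add0 : left_id endo_zero endo_add.
Proof. by move=> f; apply: linear_ext => x /=; rewrite add0r. Qed.
Lemma endo_addN : left_inverse endo_zero endo_opp endo_add.
Proof. by move=> f; apply: linear_ext => x /=; rewrite addNr. Qed.

HB.instance Definition _ :=
  GRing.isZmodule.Build (endo V) endo_addA endo_addC endo_add0 endo_addN.

Lemma endo_mulA : associative endo_mul.
Proof. by move=> f g h; apply: linear_ext. Qed.
Lemma endo_mul1 : left_id endo_one endo_mul.
Proof. by move=> f; apply: linear_ext. Qed.
Lemma endo_mulr1 : right_id endo_one endo_mul.
Proof. by move=> f; apply: linear_ext. Qed.
Lemma endo_mulDl : left_distributive endo_mul endo_add.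
Proof. by move=> f g h; apply: linear_ext. Qed.
Lemma endo_mulDr : right_distributive endo_mul endo_add.
Proof. by move=> f g h; apply: linear_ext => x /=; rewrite linearD. Qed.

HB.instance Definition _ := GRing.Zmodule_isPzRing.Build (endo V)
  endo_mulA endo_mul1 endo_mulr1 endo_mulDl endo_mulDr.

Definition factors_proj (f : endo V) : Prop :=
  exists (P : lmodType R) (g : {linear V -> P}) (h : {linear P -> V}),
    projective P /\ forall v, endo_fun f v = h (g v).

Definition stable_ideal : pred (endo V) := fun f => `[< factors_proj f >].

Lemma stable_ideal_zmod : zmod_closed stable_ideal.
Proof.
split=> [|f g /asboolP[P [a [b [hP E]]]] /asboolP[Q [c [d [hQ F]]]]].
  apply/asboolP; exists 'rV[R]_0, \0, \0; split=> //.
  exact: projective_row0.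
apply/asboolP; exists (P * Q)%type.
pose u v := (a v, c v); pose w (x : P * Q) := b x.1 - d x.2.
have linu : linear u by move=> s x y; rewrite /u !linearP.
have linw : linear w.
  by move=> s x y; rewrite /w /= (linearP b) (linearP d) scalerBr opprD addrACA.
pose mu := GRing.isLinear.Build _ _ _ _ u linu.
pose mw := GRing.isLinear.Build _ _ _ _ w linw.
pose lu : {linear V -> (P * Q)%type} := HB.pack u mu.
pose lw : {linear (P * Q)%type -> V} := HB.pack w mw.
exists lu, lw; split; first exact: projective_prod.
by move=> v /=; rewrite /w /u /= -E -F.
Qed.

HB.instance Definition _ :=
  GRing.isZmodClosed.Build (endo V) stable_ideal stable_ideal_zmod.

Lemma stable_idealMl f g : g \in stable_ideal -> f * g \in stable_ideal.
Proof.
move=> /asboolP[P [a [b [hP E]]]]; apply/asboolP.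
exists P, a, (endo_fun f \o b); split=> // v /=.
by rewrite -E.
Qed.

Lemma stable_idealMr f g : f \in stable_ideal -> f * g \in stable_ideal.
Proof.
move=> /asboolP[P [a [b [hP E]]]]; apply/asboolP.
exists P, (a \o endo_fun g), b; split=> // v /=.
by rewrite -E.
Qed.

Definition stable_end :=
  {ideal_quot (GRing.ZmodClosed.clone (endo V) stable_ideal _)}.

HB.instance Definition _ := GRing.Zmodule.on stable_end.

Definition stable_class (f : endo V) : stable_end := \pi_stable_end f.

Definition stable_one : stable_end := stable_class 1.
Definition stable_mul (x y : stable_end) : stable_end :=
  stable_class (repr x * repr y).

Lemma stable_classP f g : stable_class f = stable_class g <-> f - g \in stable_ideal.
Proof.
rewrite /stable_class; split=> [/eqP|h].
  by rewrite -Quotient.idealrBE.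
by apply/eqP; rewrite -Quotient.idealrBE.
Qed.

Lemma stable_class_ind (Q : stable_end -> Prop) :
  (forall f, Q (stable_class f)) -> forall x, Q x.
Proof. by move=> h x; rewrite -[x]reprK; exact: h. Qed.

Lemma stable_classD : {morph stable_class : f g / f + g}.
Proof. exact: Quotient.pi_add. Qed.

Lemma stable_classM f g :
  stable_class (f * g) = stable_mul (stable_class f) (stable_class g).
Proof.
apply/stable_classP; set f' := repr _; set g' := repr _.
have hf : f - f' \in stable_ideal by apply/stable_classP; rewrite /f' /stable_class reprK.
have hg : g - g' \in stable_ideal by apply/stable_classP; rewrite /g' /stable_class reprK.
have -> : f * g - f' * g' = (f - f') * g + f' * (g - g').
  by rewrite mulrBl mulrBr addrA subrK.
by apply: rpredD; [exact: stable_idealMr | exact: stable_idealMl].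
Qed.

Lemma stable_mulA : associative stable_mul.
Proof.
elim/stable_class_ind=> f; elim/stable_class_ind=> g; elim/stable_class_ind=> h.
by rewrite -!stable_classM mulrA.
Qed.
Lemma stable_mul1 : left_id stable_one stable_mul.
Proof. by elim/stable_class_ind=> f; rewrite -stable_classM mul1r. Qed.
Lemma stable_mulr1 : right_id stable_one stable_mul.
Proof. by elim/stable_class_ind=> f; rewrite -stable_classM mulr1. Qed.
Lemma stable_mulDl : left_distributive stable_mul +%R.
Proof.
elim/stable_class_ind=> f; elim/stable_class_ind=> g; elim/stable_class_ind=> h.
by rewrite -stable_classD -!stable_classM -stable_classD mulrDl.
Qed.
Lemma stable_mulDr : right_distributive stable_mul +%R.
Proof.
elim/stable_class_ind=> f; elim/stable_class_ind=> g; elim/stable_class_ind=> h.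
by rewrite -stable_classD -!stable_classM -stable_classD mulrDr.
Qed.

HB.instance Definition _ := GRing.Zmodule_isPzRing.Build stable_end
  stable_mulA stable_mul1 stable_mulr1 stable_mulDl stable_mulDr.

End StableEnd.

Section OverAlgebra.

Context (k : fieldType) (L : falgType k).

Definition homothety_fun (V : lmodType L) (c : k) (v : V) : V := (c%:A : L) *: v.

Lemma homothety_linear V c : linear (@homothety_fun V c).
Proof.
move=> l x y; rewrite /homothety_fun scalerDr !scalerA.
by rewrite mulr_algl mulr_algr.
Qed.

HB.instance Definition _ V c :=
  GRing.isLinear.Build L V V _ (@homothety_fun V c) (@homothety_linear V c).

Definition homothety (V : lmodType L) (c : k) : endo V :=
  @homothety_fun V c : {linear V -> V}.

(* Isomorphism of k-algebras: the last clause is k-linearity. *)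
Definition stable_end_is_k (V : lmodType L) : Prop :=
  exists f : {rmorphism stable_end V -> k},
    bijective f /\ forall c, f (stable_class (homothety V c)) = c.

Definition frobenius : Prop :=
  exists b : L -> L -> k,
    [/\ forall x, scalar (b x), forall y, scalar (b^~ y),
        forall x y z, b (x * y) z = b x (y * z),
        forall x, (forall y, b x y = 0) -> x = 0
      & forall y, (forall x, b x y = 0) -> y = 0].

End OverAlgebra.

Section Ideals.

Context (A : comNzRingType).

Definition ideal (I : A -> Prop) : Prop :=
  [/\ I 0, forall x y, I x -> I y -> I (x + y) & forall a x, I x -> I (a * x)].

Definition maximal_ideal (I : A -> Prop) : Prop :=
  [/\ ideal I, ~ I 1
    & forall J : A -> Prop, ideal J -> ~ J 1 -> (forall x, I x -> J x) ->
        forall x, J x -> I x].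

Definition ideal_pow (I : A -> Prop) (n : nat) (x : A) : Prop :=
  exists s : seq (A * n.-tuple A),
    (forall p, p \in s -> forall i : 'I_n, I (tnth p.2 i)) /\
    x = \sum_(p <- s) p.1 * \prod_(i < n) tnth p.2 i.

Definition noetherian : Prop :=
  forall I : A -> Prop, ideal I -> exists s : seq A, forall x,
    I x <-> exists c : 'I_(size s) -> A, x = \sum_(i < size s) c i * s`_i.

Definition artinian : Prop :=
  forall I : nat -> A -> Prop, (forall n, ideal (I n)) ->
    (forall n x, I n.+1 x -> I n x) ->
    exists n, forall m, (n <= m)%N -> forall x, I n x -> I m x.

(* Bijectivity of A -> lim_n A / I^n. *)
Definition adic_complete (I : A -> Prop) : Prop :=
  (forall x, (forall n, ideal_pow I n x) -> x = 0) /\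
  (forall u : nat -> A, (forall n, ideal_pow I n (u n.+1 - u n)) ->
     exists x, forall n, ideal_pow I n (x - u n)).

Lemma ideal_pow0 (I : A -> Prop) n : ideal_pow I n 0.
Proof. by exists [::]; rewrite big_nil. Qed.

Lemma ideal_powD (I : A -> Prop) n x y :
  ideal_pow I n x -> ideal_pow I n y -> ideal_pow I n (x + y).
Proof.
move=> [s [hs ->]] [t [ht ->]]; exists (s ++ t); rewrite big_cat; split=> // p.
by rewrite mem_cat => /orP[/hs|/ht].
Qed.

Lemma ideal_powMl (I : A -> Prop) n a x :
  ideal_pow I n x -> ideal_pow I n (a * x).
Proof.
move=> [s [hs ->]]; exists [seq (a * p.1, p.2) | p <- s]; split.
  by move=> p /mapP[q /hs hq ->].
by rewrite big_map mulr_sumr; apply: eq_bigr => p _ /=; rewrite mulrA.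
Qed.

Lemma ideal_powS (I : A -> Prop) n x :
  ideal_pow I n.+1 x -> ideal_pow I n x.
Proof.
move=> [s [hs ->]].
elim: s hs => [|p s IHs] hs; first by rewrite big_nil; exact: ideal_pow0.
rewrite big_cons; apply: ideal_powD; last first.
  by apply: IHs => q qs; apply: hs; rewrite inE qs orbT.
rewrite big_ord_recl mulrA.
exists [:: (p.1 * tnth p.2 ord0, [tuple tnth p.2 (lift ord0 i) | i < n])].
split=> [q|].
  rewrite inE => /eqP -> i /=; rewrite tnth_mktuple.
  by apply: hs; rewrite inE eqxx.
rewrite big_cons big_nil addr0 /=; congr (_ * _).
by apply: eq_bigr => i _; rewrite tnth_mktuple.
Qed.

End Ideals.

Section Category.

Context (k : fieldType).

(* The augmentation [cres : A -> A/m = k] is part of the data; it is the only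
   k-algebra map A -> k. *)
Record cobj := CObj {
  cobj_alg :> comAlgType k;
  cres : {lrmorphism cobj_alg -> k^o};
  cobj_local : forall I : cobj_alg -> Prop,
    maximal_ideal I <-> forall x, I x <-> cres x = 0;
  cobj_noetherian : noetherian cobj_alg;
  cobj_complete : adic_complete (fun x => cres x = 0)
}.

Definition max_ideal (A : cobj) (x : A) : Prop := cres A x = 0.

Record chom (A B : cobj) := CHom {
  chom_fun :> {lrmorphism A -> B};
  chom_continuous : forall n, exists m, forall x,
    ideal_pow (@max_ideal A) m x -> ideal_pow (@max_ideal B) n (chom_fun x);
  chom_res : forall x, cres B (chom_fun x) = cres A x
}.

Definition cobj_iso (A B : cobj) : Prop :=
  exists (f : chom A B) (g : chom B A), cancel f g /\ cancel g f.

(* The dual numbers k[e]; [Dual a b] stands for a + b e. *)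

Record dual := Dual { dual_re : k; dual_im : k }.

Definition dual_pair (x : dual) : k * k := (dual_re x, dual_im x).
Definition pair_dual (p : k * k) : dual := Dual p.1 p.2.
Lemma dual_pairK : cancel dual_pair pair_dual. Proof. by case. Qed.

HB.instance Definition _ := Choice.copy dual (can_type dual_pairK).

Definition dual_zero : dual := Dual 0 0.
Definition dual_opp (x : dual) : dual := Dual (- dual_re x) (- dual_im x).
Definition dual_add (x y : dual) : dual :=
  Dual (dual_re x + dual_re y) (dual_im x + dual_im y).
Definition dual_one : dual := Dual 1 0.
Definition dual_mul (x y : dual) : dual :=
  Dual (dual_re x * dual_re y) (dual_re x * dual_im y + dual_im x * dual_re y).
Definition dual_scale (c : k) (x : dual) : dual :=
  Dual (c * dual_re x) (c * dual_im x).

Lemma dual_addA : associative dual_add.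
Proof. by move=> x y z; congr Dual; rewrite /= addrA. Qed.
Lemma dual_addC : commutative dual_add.
Proof. by move=> x y; congr Dual; rewrite /= addrC. Qed.
Lemma dual_add0 : left_id dual_zero dual_add.
Proof. by move=> [a b]; congr Dual; rewrite /= add0r. Qed.
Lemma dual_addN : left_inverse dual_zero dual_opp dual_add.
Proof. by move=> x; congr Dual; rewrite /= addNr. Qed.

HB.instance Definition _ :=
  GRing.isZmodule.Build dual dual_addA dual_addC dual_add0 dual_addN.

Lemma dual_mulA : associative dual_mul.
Proof.
move=> x y z; congr Dual; rewrite /= ?mulrA //.
by rewrite mulrDr mulrDl !mulrA addrA.
Qed.
Lemma dual_mulC : commutative dual_mul.
Proof.
move=> x y; congr Dual; first by rewrite mulrC.
by rewrite addrC mulrC [dual_re x * _]mulrC.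
Qed.
Lemma dual_mul1 : left_id dual_one dual_mul.
Proof. by move=> [a b]; congr Dual; rewrite /= !mul1r ?mul0r ?addr0. Qed.
Lemma dual_mulDl : left_distributive dual_mul dual_add.
Proof. by move=> x y z; congr Dual; rewrite /= !mulrDl // addrACA. Qed.
Lemma dual_nz : dual_one != dual_zero.
Proof. by apply/eqP => -[] /eqP; rewrite oner_eq0. Qed.

HB.instance Definition _ := GRing.Zmodule_isComNzRing.Build dual
  dual_mulA dual_mulC dual_mul1 dual_mulDl dual_nz.

Lemma dual_scaleA c d x : dual_scale c (dual_scale d x) = dual_scale (c * d) x.
Proof. by congr Dual; rewrite /= mulrA. Qed.
Lemma dual_scale1 : left_id 1 dual_scale.
Proof. by move=> [a b]; congr Dual; rewrite /= mul1r. Qed.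
Lemma dual_scaleDr : right_distributive dual_scale +%R.
Proof. by move=> c x y; congr Dual; rewrite /= mulrDr. Qed.
Lemma dual_scaleDl x : {morph dual_scale^~ x : c d / c + d}.
Proof. by move=> c d; congr Dual; rewrite /= mulrDl. Qed.

HB.instance Definition _ := GRing.Zmodule_isLmodule.Build k dual
  dual_scaleA dual_scale1 dual_scaleDr dual_scaleDl.

Lemma dual_scaleAl (c : k) (x y : dual) : c *: (x * y) = (c *: x) * y.
Proof. by congr Dual; rewrite /= ?mulrDr !mulrA. Qed.

HB.instance Definition _ := GRing.Lmodule_isLalgebra.Build k dual dual_scaleAl.

Lemma dual_scaleAr (c : k) (x y : dual) : c *: (x * y) = x * (c *: y).
Proof. by rewrite mulrC dual_scaleAl mulrC. Qed.

HB.instance Definition _ := GRing.Lalgebra_isAlgebra.Build k dual dual_scaleAr.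

Lemma dual_ext (x y : dual) :
  dual_re x = dual_re y -> dual_im x = dual_im y -> x = y.
Proof. by case: x y => [a b] [c d] /= -> ->. Qed.

Definition dual_res (x : dual) : k^o := dual_re x.

Lemma dual_res_linear : linear dual_res. Proof. by []. Qed.
Lemma dual_res_monoid : monoid_morphism dual_res. Proof. by []. Qed.

HB.instance Definition _ :=
  GRing.isLinear.Build k dual k^o _ dual_res dual_res_linear.
HB.instance Definition _ :=
  GRing.isMonoidMorphism.Build dual k^o dual_res dual_res_monoid.

Lemma dualE (x : dual) : dual_re x != 0 ->
  x * Dual (dual_re x)^-1 (- (dual_re x)^-1 * dual_im x / dual_re x) = 1 :> dual.
Proof.
move=> nz; apply: dual_ext => /=; first by rewrite divff.
by rewrite !mulNr mulrN !mulrA divff // mul1r addNr.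
Qed.

Lemma dual_ideal1 (I : dual -> Prop) x : ideal I -> I x -> dual_re x != 0 -> I 1.
Proof.
move=> [_ _ IM] Ix nz; rewrite -(dualE nz) mulrC; exact: IM.
Qed.

Lemma dual_ker_ideal : ideal (fun x : dual => dual_res x = 0).
Proof.
split=> [//|x y hx hy|a x hx]; rewrite /dual_res /=.
  by rewrite [dual_re x]hx [dual_re y]hy addr0.
by rewrite [dual_re x]hx mulr0.
Qed.

Lemma dual_local (I : dual -> Prop) :
  maximal_ideal I <-> forall x, I x <-> dual_res x = 0.
Proof.
have sub (J : dual -> Prop) : ideal J -> ~ J 1 -> forall x, J x -> dual_res x = 0.
  move=> iJ J1 x Jx; apply/eqP/negPn/negP => nz; apply: J1.
  exact: dual_ideal1 iJ Jx nz.
have res1 : dual_res 1 <> 0 by apply/eqP; rewrite oner_eq0.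
split=> [[iI I1 Imax] x|IE].
  split; first exact: sub.
  exact: (Imax _ dual_ker_ideal res1 (sub _ iI I1)).
have {}IE : I = fun x => dual_res x = 0 by apply/funext => x; apply/propext.
rewrite IE; split=> [||J iJ J1 _]; [exact: dual_ker_ideal | exact: res1 | exact: sub].
Qed.

Lemma dual_noetherian : noetherian dual.
Proof.
move=> I iI; have [I0 ID IM] := iI.
have [[x [Ix nz]]|allz] := pselect (exists x, I x /\ dual_re x != 0).
  exists [:: 1] => y; split=> [_|_].
    by exists (fun=> y); rewrite big_ord_recl big_ord0 /= mulr1 addr0.
  by rewrite -[y]mulr1; apply/IM/(dual_ideal1 iI Ix nz).
have z x : I x -> dual_re x = 0.
  by move=> Ix; apply/eqP/negPn/negP => nz; apply: allz; exists x.
have [[x [Ix nz]]|all0] := pselect (exists x, I x /\ dual_im x != 0); last first.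
  exists [::] => y; split=> [Iy|[c ->]]; last by rewrite big_ord0.
  exists (fun=> 0); rewrite big_ord0; apply: dual_ext; first exact: z.
  by apply/eqP/negPn/negP => nz; apply: all0; exists y.
exists [:: x] => y; split=> [Iy|[c ->]]; last first.
  by rewrite big_ord_recl big_ord0 /= addr0; exact: IM.
exists (fun=> Dual (dual_im y / dual_im x) 0); rewrite big_ord_recl big_ord0 /= addr0.
by apply: dual_ext; rewrite /= (z x Ix) ?(z y Iy) ?mulr0 // addr0 divfK.
Qed.

Lemma dual_pow2 x : ideal_pow (fun x : dual => dual_res x = 0) 2 x -> x = 0.
Proof.
move=> [s [hs ->]]; rewrite big_seq big1 // => p /hs h.
rewrite !big_ord_recl big_ord0 mulr1.
have h0 := h ord0; have h1 := h (lift ord0 ord0).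
have -> : tnth p.2 ord0 * tnth p.2 (lift ord0 ord0) = 0 :> dual; last by rewrite mulr0.
apply: dual_ext => /=; first by rewrite [X in X * _]h0 mul0r.
by rewrite [X in X * _]h0 mul0r [X in _ * X]h1 mulr0 addr0.
Qed.

Lemma dual_complete : adic_complete (fun x : dual => dual_res x = 0).
Proof.
split=> [x h|u hu]; first exact: dual_pow2 (h 2).
set I := fun x => _ in hu *.
have powN n x : ideal_pow I n x -> ideal_pow I n (- x).
  by rewrite -mulN1r; exact: ideal_powMl.
have pow2 n x : ideal_pow I n.+2 x -> x = 0.
  by elim: n => [|n IHn] h; [exact: dual_pow2 | apply/IHn/ideal_powS].
have stab n : u n.+2 = u 2.
  elim: n => // n <-; apply/eqP; rewrite -subr_eq0; apply/eqP.
  exact: pow2 (hu _).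
exists (u 2) => -[|[|n]]; last by rewrite stab subrr; exact: ideal_pow0.
  rewrite -(subrK (u 1) (u 2)) -addrA; apply: ideal_powD; last exact: hu.
  exact/ideal_powS/hu.
exact: hu.
Qed.

Definition dual_numbers : cobj :=
  @CObj dual dual_res dual_local dual_noetherian dual_complete.

End Category.

Section TensorModules.

Context (k : fieldType) (L : falgType k).

(* An A (x)_k L-module: an A-module with an A-linear action of L inducing the
   same k-action. The action of a (x) l is m |-> a *: tact l m. *)
Record tmod (A : comAlgType k) := TMod {
  tmod_mod :> lmodType A;
  tact : L -> tmod_mod -> tmod_mod;
  tact_linear : forall l, linear (tact l);
  tactDl : forall l l' m, tact (l + l') m = tact l m + tact l' m;
  tact1 : forall m, tact 1 m = m;
  tactM : forall l l' m, tact (l * l') m = tact l (tact l' m);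
  tact_scalar : forall (c : k) m, tact c%:A m = (c%:A : A) *: m
}.

Definition tmod_fin_gen (A : comAlgType k) (M : tmod A) : Prop :=
  exists s : seq M, forall m, exists t : seq (A * L * M),
    (forall p, p \in t -> p.2 \in s) /\
    m = \sum_(p <- t) p.1.1 *: tact p.1.2 p.2.

Definition tmod_iso (A : comAlgType k) (M N : tmod A) (f : {linear M -> N}) : Prop :=
  bijective f /\ forall l m, f (tact l m) = tact l (f m).

Lemma tactD (A : comAlgType k) (M : tmod A) l (x y : M) :
  tact l (x + y) = tact l x + tact l y.
Proof. by have := tact_linear l 1 x y; rewrite !scale1r. Qed.

Lemma tact0 (A : comAlgType k) (M : tmod A) l : tact l (0 : M) = 0.
Proof.
have := tactD l (0 : M) 0; rewrite addr0 => /eqP.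
by rewrite -subr_eq0 opprD addrA subrr sub0r oppr_eq0 => /eqP.
Qed.

Lemma tactZ (A : comAlgType k) (M : tmod A) l a (x : M) :
  tact l (a *: x) = a *: tact l x.
Proof. by have := tact_linear l a x 0; rewrite tact0 !addr0. Qed.

Section BaseChange.

Context (A B : comAlgType k) (alpha : {lrmorphism A -> B}).

Section Object.

Context (M : tmod A).

Definition bc_act (l : L) : tens alpha M -> tens alpha M :=
  tens_rec (fun b m => tensor alpha b (tact l m)).

Lemma bc_act_bal l : balanced alpha (fun b (m : M) => tensor alpha b (tact l m)).
Proof.
split=> [b b' m|b m m'|b a m]; first exact: tensorDl.
  by rewrite tactD tensorDr.
by rewrite tactZ tensor_bal.
Qed.

Lemma bc_actE l b m : bc_act l (tensor alpha b m) = tensor alpha b (tact l m).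
Proof. exact: (tens_recE (bc_act_bal l)). Qed.

Lemma bc_actD l : {morph bc_act l : x y / x + y}.
Proof. exact: (tens_recD (bc_act_bal l)). Qed.

Lemma bc_act0 l : bc_act l 0 = 0.
Proof. exact: (tens_rec0 (bc_act_bal l)). Qed.

Lemma bc_act_linear l : linear (bc_act l).
Proof.
move=> c x y; rewrite bc_actD; congr (_ + _).
elim/tens_ind: x => [b m||x x' hx hx']; first by rewrite tensorZ !bc_actE tensorZ.
  by rewrite scaler0 bc_act0 scaler0.
by rewrite scalerDr !bc_actD hx hx' scalerDr.
Qed.

Lemma bc_actDl l l' x : bc_act (l + l') x = bc_act l x + bc_act l' x.
Proof.
elim/tens_ind: x => [b m||x x' hx hx'].
- by rewrite !bc_actE tactDl tensorDr.
- by rewrite !bc_act0 addr0.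
- by rewrite !bc_actD hx hx' addrACA.
Qed.

Lemma bc_act1 x : bc_act 1 x = x.
Proof.
elim/tens_ind: x => [b m||x x' hx hx']; first by rewrite bc_actE tact1.
  by rewrite bc_act0.
by rewrite bc_actD hx hx'.
Qed.

Lemma bc_actM l l' x : bc_act (l * l') x = bc_act l (bc_act l' x).
Proof.
elim/tens_ind: x => [b m||x x' hx hx']; first by rewrite !bc_actE tactM.
  by rewrite !bc_act0.
by rewrite !bc_actD hx hx'.
Qed.

Lemma bc_act_scalar (c : k) x : bc_act c%:A x = (c%:A : B) *: x.
Proof.
elim/tens_ind: x => [b m||x x' hx hx'].
- have E : alpha (c%:A : A) = (c%:A : B) by rewrite linearZ /= rmorph1.
  by rewrite bc_actE tact_scalar -tensor_bal /= E tensorZ mulrC.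
- by rewrite bc_act0 scaler0.
- by rewrite bc_actD hx hx' scalerDr.
Qed.

Definition bc : tmod B :=
  @TMod B (tens alpha M) bc_act bc_act_linear bc_actDl bc_act1 bc_actM bc_act_scalar.

Lemma bc_fin_gen : tmod_fin_gen M -> tmod_fin_gen bc.
Proof.
move=> [s hs]; exists [seq tensor alpha 1 m | m <- s] => x.
elim/tens_ind: x => [b m||x x' [t [ht ->]] [t' [ht' ->]]].
- have [t [ht ->]] := hs m.
  exists [seq (b * alpha p.1.1, p.1.2, tensor alpha 1 p.2) | p <- t]; split.
    by move=> p /mapP[q /ht hq ->]; exact: map_f.
  rewrite big_map /=.
  transitivity (\sum_(p <- t) tensor alpha b (p.1.1 *: tact p.1.2 p.2)).
    elim: t {ht} => [|p t IHt]; last by rewrite !big_cons -IHt tensorDr.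
    by rewrite !big_nil tensor0.
  apply: eq_bigr => p _; rewrite /tact /= bc_actE tensorZ mulr1.
  by rewrite -tensor_bal.
- by exists [::]; rewrite big_nil.
- exists (t ++ t'); rewrite big_cat; split=> // p.
  by rewrite mem_cat => /orP[/ht|/ht'].
Qed.

End Object.

Definition bc_map (M N : tmod A) (f : M -> N) : bc M -> bc N :=
  tens_rec (fun b m => tensor alpha b (f m)).

Section Map.
Context (M N : tmod A) (f : {linear M -> N}).

Lemma bc_map_bal : balanced alpha (fun b (m : M) => tensor alpha b (f m)).
Proof.
split=> [b b' m|b m m'|b a m]; first exact: tensorDl.
  by rewrite linearD tensorDr.
by rewrite linearZ tensor_bal.
Qed.

Lemma bc_mapE b m : bc_map f (tensor alpha b m) = tensor alpha b (f m).
Proof. exact: (tens_recE bc_map_bal). Qed.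

Lemma bc_mapD : {morph bc_map f : x y / x + y}.
Proof. exact: (tens_recD bc_map_bal). Qed.

Lemma bc_map0 : bc_map f 0 = 0.
Proof. exact: (tens_rec0 bc_map_bal). Qed.

Lemma bc_map_linear : linear (bc_map f).
Proof.
move=> c x y; rewrite bc_mapD; congr (_ + _).
elim/tens_ind: x => [b m||x x' hx hx'].
- by rewrite tensorZ !bc_mapE tensorZ.
- by rewrite scaler0 bc_map0 scaler0.
- by rewrite scalerDr !bc_mapD hx hx' scalerDr.
Qed.

HB.instance Definition _ := GRing.isLinear.Build B (bc M) (bc N) _ (bc_map f) bc_map_linear.

Lemma bc_map_act : (forall l m, f (tact l m) = tact l (f m)) ->
  forall l x, bc_map f (tact l x) = tact l (bc_map f x).
Proof.
move=> fl l x; rewrite /tact /=; elim/tens_ind: x => [b m||x x' hx hx'].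
- by rewrite bc_actE !bc_mapE bc_actE fl.
- by rewrite bc_act0 bc_map0 bc_act0.
- by rewrite bc_actD !bc_mapD bc_actD hx hx'.
Qed.
End Map.

Lemma bc_map_cancel (M N : tmod A) (f : {linear M -> N}) (g : {linear N -> M}) :
  cancel f g -> cancel (bc_map f) (bc_map g).
Proof.
move=> fK x; elim/tens_ind: x => [b m||x x' hx hx'].
- by rewrite !bc_mapE fK.
- by rewrite !bc_map0.
- by rewrite !bc_mapD hx hx'.
Qed.

End BaseChange.

Lemma tmod_iso_inv (A : comAlgType k) (M N : tmod A) (f : {linear M -> N}) :
  tmod_iso f -> exists g : {linear N -> M}, [/\ tmod_iso g, cancel f g & cancel g f].
Proof.
move=> [[g fK gK] fl].
have ling : linear g.
  by move=> a x y; apply: (can_inj fK); rewrite linearP !gK.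
pose mg := GRing.isLinear.Build _ _ _ _ g ling.
pose lg : {linear N -> M} := HB.pack g mg.
exists lg; split=> //; split; first by exists f.
by move=> l m; apply: (can_inj fK); rewrite fl /= !gK.
Qed.

Section FreeCoordinates.

Context (A : comAlgType k) (M : lmodType A) (I : eqType) (e : I -> M).
Hypothesis span : forall m, exists t : seq (A * I), m = \sum_(p <- t) p.1 *: e p.2.
Hypothesis indep : forall (s : seq I) (c : I -> A),
  uniq s -> \sum_(i <- s) c i *: e i = 0 -> {in s, forall i, c i = 0}.

Lemma collect (t : seq (A * I)) :
  \sum_(p <- t) p.1 *: e p.2 =
  \sum_(i <- undup (map snd t)) (\sum_(p <- t | p.2 == i) p.1) *: e i.
Proof.
transitivity (\sum_(i <- undup (map snd t)) \sum_(p <- t | p.2 == i) p.1 *: e p.2).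
  under [RHS]eq_bigr do rewrite big_mkcond.
  rewrite exchange_big big_seq [RHS]big_seq; apply: eq_bigr => p pt /=.
  rewrite (bigD1_seq p.2) ?undup_uniq ?mem_undup ?map_f //= eqxx.
  by rewrite big1 ?addr0 // => i; rewrite eq_sym => /negPf ->.
by apply: eq_bigr => i _; rewrite scaler_suml; apply: eq_bigr => p /eqP ->.
Qed.

Lemma coord_null (t : seq (A * I)) :
  \sum_(p <- t) p.1 *: e p.2 = 0 -> forall i, \sum_(p <- t | p.2 == i) p.1 = 0.
Proof.
rewrite collect => /(indep (undup_uniq _)) h i.
have [/h //|ni] := boolP (i \in undup (map snd t)).
rewrite big_seq_cond big1 // => p /andP[pt /eqP pi]; case/negP: ni.
by rewrite mem_undup -pi; exact: map_f.
Qed.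

Definition coord (i : I) (m : M) : A := \sum_(p <- projT1 (cid (span m)) | p.2 == i) p.1.

Lemma coordE i (t : seq (A * I)) :
  coord i (\sum_(p <- t) p.1 *: e p.2) = \sum_(p <- t | p.2 == i) p.1.
Proof.
rewrite /coord; case: (cid _) => t' /= E; apply/eqP; rewrite -subr_eq0; apply/eqP.
have /coord_null/(_ i) :
    \sum_(p <- t' ++ [seq (- p.1, p.2) | p <- t]) p.1 *: e p.2 = 0.
  rewrite big_cat big_map /= -E -big_split big1 //= => p _.
  by rewrite scaleNr subrr.
by rewrite big_cat big_map /= sumrN.
Qed.

Lemma coord_linear i (a : A) (x y : M) : coord i (a *: x + y) = a * coord i x + coord i y.
Proof.
have [tx ->] := span x; have [ty ->] := span y.
have -> : a *: (\sum_(p <- tx) p.1 *: e p.2) + \sum_(p <- ty) p.1 *: e p.2 =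
    \sum_(p <- [seq (a * p.1, p.2) | p <- tx] ++ ty) p.1 *: e p.2.
  rewrite big_cat big_map /= scaler_sumr; congr (_ + _).
  by apply: eq_bigr => p _; rewrite scalerA.
by rewrite !coordE big_cat big_map /= mulr_sumr.
Qed.

Lemma coord_basis i j : coord i (e j) = (j == i)%:R.
Proof.
have -> : e j = \sum_(p <- [:: (1 : A, j)]) p.1 *: e p.2.
  by rewrite big_cons big_nil addr0 scale1r.
by rewrite coordE big_cons big_nil /=; case: eqP; rewrite ?addr0.
Qed.

End FreeCoordinates.

Lemma bc_free (A B : comAlgType k) (alpha : {lrmorphism A -> B}) (M : tmod A) :
  is_free M -> is_free (bc alpha M).
Proof.
move=> [I [e [span indep]]]; exists I, (fun i => tensor alpha 1 (e i)).
pose cf i m := coord span i m.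
have cfP i a x y : cf i (a *: x + y) = a * cf i x + cf i y by exact: coord_linear.
have cfD i x y : cf i (x + y) = cf i x + cf i y.
  by rewrite -[x in LHS]scale1r cfP mul1r.
have cf0 i : cf i 0 = 0.
  have /eqP := cfD i 0 0.
  by rewrite addr0 -subr_eq0 opprD addrA subrr sub0r oppr_eq0 => /eqP.
have cfZ i a x : cf i (a *: x) = a * cf i x by rewrite -[_ *: x]addr0 cfP cf0 addr0.
split=> [x|s c us].
  elim/tens_ind: x => [b m||x x' [t ->] [t' ->]].
  - have [t ->] := span m; exists [seq (b * alpha p.1, p.2) | p <- t].
    rewrite big_map /=; elim: t => [|p t IHt].
      by rewrite !big_nil tensor0.
    rewrite !big_cons -IHt tensorDr; congr (_ + _).
    by rewrite tensorZ mulr1 tensor_bal.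
  - by exists [::]; rewrite big_nil.
  - by exists (t ++ t'); rewrite big_cat.
move=> E i si.
pose F b m := b * alpha (cf i m).
have Fbal : balanced alpha F.
  rewrite /F; split=> [b b' m|b m m'|b a m]; first by rewrite mulrDl.
    by rewrite cfD rmorphD mulrDr.
  by rewrite cfZ rmorphM mulrA.
have := tens_rec0 Fbal; rewrite -E.
have -> : tens_rec F (\sum_(j <- s) c j *: tensor alpha 1 (e j)) =
          \sum_(j <- s) c j * (j == i)%:R.
  elim: (s) => [|j r IHr]; first by rewrite !big_nil (tens_rec0 Fbal).
  rewrite !big_cons (tens_recD Fbal) IHr tensorZ mulr1 (tens_recE Fbal); congr (_ + _).
  by rewrite /F /cf (coord_basis span indep) rmorph_nat.
rewrite (bigD1_seq i) //= eqxx mulr1 big1 ?addr0 // => j /negPf ->.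
by rewrite mulr0.
Qed.

End TensorModules.

Section Deformations.

Context (k : fieldType) (L : falgType k) (V : lmodType L).

Record lift (A : cobj k) := Lift {
  lift_mod :> tmod L A;
  lift_fin_gen : tmod_fin_gen lift_mod;
  lift_free : is_free lift_mod;
  lift_phi : bc (cres A) lift_mod -> V;
  lift_phiD : {morph lift_phi : x y / x + y};
  lift_phi_act : forall l x, lift_phi (tact l x) = l *: lift_phi x;
  lift_phi_bij : bijective lift_phi
}.

Definition lift_iso (A : cobj k) (M N : lift A) : Prop :=
  exists f : {linear M -> N},
    tmod_iso f /\ forall x, lift_phi (bc_map f x) = lift_phi x.

Lemma lift_iso_refl (A : cobj k) (M : lift A) : lift_iso M M.
Proof.
exists (idfun : {linear M -> M}); split; first by split=> //; exists id.
move=> x; congr lift_phi; elim/tens_ind: x => [b m||x y hx hy].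
- by rewrite bc_mapE.
- by rewrite bc_map0.
- by rewrite bc_mapD hx hy.
Qed.

Lemma lift_iso_sym (A : cobj k) (M N : lift A) : lift_iso M N -> lift_iso N M.
Proof.
move=> [f [fi fphi]]; have [g [gi fK gK]] := tmod_iso_inv fi.
exists g; split=> // x; rewrite -{2}[x](bc_map_cancel gK) fphi.
by [].
Qed.

Lemma lift_iso_trans (A : cobj k) (M N P : lift A) :
  lift_iso M N -> lift_iso N P -> lift_iso M P.
Proof.
move=> [f [[fb fl] fphi]] [g [[gb gl] gphi]].
exists (g \o f); split.
  by split=> [|l m /=]; [exact: bij_comp | rewrite fl gl].
move=> x; rewrite -fphi -gphi; congr lift_phi.
elim/tens_ind: x => [b m||x y hx hy].
- by rewrite !bc_mapE.
- by rewrite !bc_map0.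
- by rewrite !bc_mapD hx hy.
Qed.

Section LiftBaseChange.

Context (A B : cobj k) (alpha : chom A B) (M : lift A).

(* The canonical isomorphism k (x)_B (B (x)_A M) ~ k (x)_A M and its inverse. *)
Definition bc_collapse : bc (cres B) (bc alpha M) -> bc (cres A) M :=
  tens_rec (fun c y =>
    tens_rec (fun b m => tensor (cres A) (c * cres B b : k^o) m) y).

Definition bc_expand : bc (cres A) M -> bc (cres B) (bc alpha M) :=
  tens_rec (fun c m => tensor (cres B) c (tensor alpha 1 m)).

Lemma collapse_bal_in (c : k^o) :
  balanced alpha (fun b (m : M) => tensor (cres A) (c * cres B b : k^o) m).
Proof.
split=> [b b' m|b m m'|b a m].
- by rewrite rmorphD mulrDr tensorDl.
- by rewrite tensorDr.
- by rewrite rmorphM /= chom_res mulrA tensor_bal.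
Qed.

Lemma collapse_bal : balanced (cres B) (fun c (y : bc alpha M) =>
  tens_rec (fun b m => tensor (cres A) (c * cres B b : k^o) m) y).
Proof.
split=> [c c' y|c y y'|c b y].
- elim/tens_ind: y => [b m||x y hx hy].
  + by rewrite !(tens_recE (collapse_bal_in _)) mulrDl tensorDl.
  + by rewrite !(tens_rec0 (collapse_bal_in _)) addr0.
  + by rewrite !(tens_recD (collapse_bal_in _)) hx hy addrACA.
- by rewrite (tens_recD (collapse_bal_in _)).
- elim/tens_ind: y => [b' m||x y hx hy].
  + by rewrite tensorZ !(tens_recE (collapse_bal_in _)) rmorphM mulrA.
  + by rewrite scaler0 !(tens_rec0 (collapse_bal_in _)).
  + by rewrite scalerDr !(tens_recD (collapse_bal_in _)) hx hy.
Qed.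

Lemma expand_bal :
  balanced (cres A) (fun c (m : M) => tensor (cres B) c (tensor alpha 1 m : bc alpha M)).
Proof.
split=> [c c' m|c m m'|c a m]; first by rewrite tensorDl.
  by rewrite tensorDr tensorDr.
have <- := tensor_bal alpha 1 a m.
by rewrite mul1r [tensor alpha (alpha a) m]tensorE -tensor_bal /= chom_res.
Qed.

Lemma bc_collapseE c b m :
  bc_collapse (tensor (cres B) c (tensor alpha b m)) = tensor (cres A) (c * cres B b : k^o) m.
Proof. by rewrite /bc_collapse (tens_recE collapse_bal) (tens_recE (collapse_bal_in _)). Qed.

Lemma bc_collapseD : {morph bc_collapse : x y / x + y}.
Proof. exact: (tens_recD collapse_bal). Qed.

Lemma bc_collapse0 : bc_collapse 0 = 0.
Proof. exact: (tens_rec0 collapse_bal). Qed.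

Lemma bc_expandE c m :
  bc_expand (tensor (cres A) c m) = tensor (cres B) c (tensor alpha 1 m).
Proof. exact: (tens_recE expand_bal). Qed.

Lemma bc_expandD : {morph bc_expand : x y / x + y}.
Proof. exact: (tens_recD expand_bal). Qed.

Lemma bc_expand0 : bc_expand 0 = 0.
Proof. exact: (tens_rec0 expand_bal). Qed.

Lemma bc_bc_ind (P : bc (cres B) (bc alpha M) -> Prop) :
    (forall c b m, P (tensor (cres B) c (tensor alpha b m))) -> P 0 ->
    (forall x y, P x -> P y -> P (x + y)) -> forall x, P x.
Proof.
move=> Pt P0 PD x; elim/tens_ind: x => // c y.
elim/tens_ind: y => [b m||x y hx hy] //; first by rewrite tensor0.
by rewrite tensorDr; exact: PD.
Qed.

Lemma bc_collapse_act l x : bc_collapse (tact l x) = tact l (bc_collapse x).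
Proof.
rewrite /tact /=; elim/bc_bc_ind: x => [c b m||x y hx hy].
- by rewrite bc_actE /tact /= bc_actE !bc_collapseE bc_actE.
- by rewrite bc_act0 bc_collapse0 bc_act0.
- by rewrite bc_actD !bc_collapseD bc_actD hx hy.
Qed.

Lemma bc_collapse_bij : bijective bc_collapse.
Proof.
exists bc_expand => x.
  elim/bc_bc_ind: x => [c b m||x y hx hy].
  - by rewrite bc_collapseE bc_expandE tensor_bal tensorZ mulr1.
  - by rewrite bc_collapse0 bc_expand0.
  - by rewrite bc_collapseD bc_expandD hx hy.
elim/tens_ind: x => [c m||x y hx hy].
- by rewrite bc_expandE bc_collapseE rmorph1 mulr1.
- by rewrite bc_expand0 bc_collapse0.
- by rewrite bc_expandD bc_collapseD hx hy.
Qed.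

Definition bc_phi (x : bc (cres B) (bc alpha M)) : V := lift_phi (bc_collapse x).

Lemma bc_phiD : {morph bc_phi : x y / x + y}.
Proof. by move=> x y; rewrite /bc_phi bc_collapseD lift_phiD. Qed.

Lemma bc_phi_act l x : bc_phi (tact l x) = l *: bc_phi x.
Proof. by rewrite /bc_phi bc_collapse_act lift_phi_act. Qed.

Lemma bc_phi_bij : bijective bc_phi.
Proof. exact: bij_comp (lift_phi_bij M) bc_collapse_bij. Qed.

Definition bc_lift : lift B :=
  @Lift B (bc alpha M) (bc_fin_gen alpha (lift_fin_gen M))
    (bc_free alpha (lift_free M)) bc_phi bc_phiD bc_phi_act bc_phi_bij.

End LiftBaseChange.

Lemma bc_lift_iso (A B : cobj k) (alpha : chom A B) (M N : lift A) :
  lift_iso M N -> lift_iso (bc_lift alpha M) (bc_lift alpha N).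
Proof.
move=> [f [fi fphi]]; have [g [_ fK gK]] := tmod_iso_inv fi.
case: fi => _ fl.
exists (bc_map f : {linear bc alpha M -> bc alpha N}); split.
  split; last exact: bc_map_act.
  by exists (bc_map g); exact: bc_map_cancel.
move=> x /=; rewrite /bc_phi -fphi; congr lift_phi.
elim/bc_bc_ind: x => [c b m||x y hx hy].
- by rewrite bc_mapE /= bc_mapE !bc_collapseE bc_mapE.
- by rewrite bc_map0 !bc_collapse0 bc_map0.
- by rewrite bc_mapD !bc_collapseD bc_mapD hx hy.
Qed.

(* An isomorphism class of lifts, as a predicate on lifts. *)

Definition deformation (A : cobj k) : Type :=
  {D : lift A -> Prop | exists M, D = lift_iso M}.

Definition deform (A : cobj k) (M : lift A) : deformation A :=
  exist _ (lift_iso M) (ex_intro _ M erefl).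

Lemma deformP (A : cobj k) (M N : lift A) : deform M = deform N <-> lift_iso M N.
Proof.
split=> [E|MN].
  have: sval (deform N) N by exact: lift_iso_refl.
  by rewrite -E.
apply: eq_exist; apply/funext => P; apply/propext; split.
  exact/lift_iso_trans/lift_iso_sym.
exact: lift_iso_trans.
Qed.

Definition def_map_class (A B : cobj k) (alpha : chom A B) (D : deformation A)
  (N : lift B) : Prop := exists M, sval D M /\ lift_iso (bc_lift alpha M) N.

Lemma def_map_classP (A B : cobj k) (alpha : chom A B) (D : deformation A) :
  exists N, def_map_class alpha D = lift_iso N.
Proof.
have [M DE] := svalP D; exists (bc_lift alpha M).
rewrite /def_map_class DE; apply/funext => N; apply/propext; split=> [[M' [MM' h]]|h].
  exact: lift_iso_trans (bc_lift_iso alpha MM') h.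
by exists M; split=> //; exact: lift_iso_refl.
Qed.

Definition def_map (A B : cobj k) (alpha : chom A B) (D : deformation A) :
  deformation B := exist _ (def_map_class alpha D) (def_map_classP alpha D).

Lemma def_mapE (A B : cobj k) (alpha : chom A B) (M : lift A) :
  def_map alpha (deform M) = deform (bc_lift alpha M).
Proof.
apply: eq_exist; apply/funext => N; apply/propext; split=> [[M' [/= MM' h]]|h].
  exact: lift_iso_trans (bc_lift_iso alpha MM') h.
by exists M; split=> //; exact: lift_iso_refl.
Qed.

(* The transformation f |-> def_map f U from Hom(R, -) to F_V on Artinian
   objects is smooth. *)
Definition smooth_deformation (R : cobj k) (U : deformation R) : Prop :=
  forall (A B : cobj k) (pi : chom A B) (f : chom R B) (D : deformation A),
    artinian A -> artinian B -> surjective pi -> def_map pi D = def_map f U ->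
    exists g : chom R A, (forall r, pi (g r) = f r) /\ def_map g U = D.

(* Smoothness, and bijectivity of Hom(R, k[e]) -> F_V(k[e]). *)
Definition versal_deformation (R : cobj k) (U : deformation R) : Prop :=
  smooth_deformation U /\
  forall D : deformation (dual_numbers k),
    (exists f : chom R (dual_numbers k), def_map f U = D) /\
    (forall f g : chom R (dual_numbers k),
       def_map f U = D -> def_map g U = D -> f =1 g).

(* R(L, V) is only defined up to isomorphism: R is one of its models. *)
Definition versal_deformation_ring (R : cobj k) : Prop :=
  exists U : deformation R, versal_deformation U.

(* A natural isomorphism from the deformation functor to Hom(R, -). *)
Definition represents_deformations (R : cobj k) : Prop :=
  exists eta : forall A : cobj k, deformation A -> chom R A,
    [/\ forall (A B : cobj k) (alpha : chom A B) (D : deformation A) (r : R),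
          eta B (def_map alpha D) r = alpha (eta A D r),
        forall (A : cobj k) (D D' : deformation A), eta A D =1 eta A D' -> D = D'
      & forall (A : cobj k) (f : chom R A), exists D, eta A D =1 f].

End Deformations.

(* Main.v *)
Require Import Defs.
From HB Require Import structures.
From mathcomp Require Import all_boot all_order all_algebra all_field.
From mathcomp Require Import boolp.

Set Implicit Arguments.
Unset Strict Implicit.
Unset Printing Implicit Defensive.

Import GRing.Theory.
Local Open Scope ring_scope.

(* After a choice of k-bases, lifts of V over A are representations of L by
   matrices over A reducing to a fixed one modulo the maximal ideal m, up to
   conjugation by matrices congruent to 1.  Let x_i, y_i be dual bases for the
   form of L.  For any matrix h, the Higman trace sum_i sigma(x_i) h rho(y_i)
   intertwines rho and sigma, and the endomorphisms of V that factor through a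
   projective module are exactly the traces.  The hypothesis on V thus says that
   every endomorphism of V is a scalar plus a trace; scalars and traces lift, so
   by induction along the powers of m, endomorphisms of the reduction of a lift
   modulo m^s lift too.  This makes automorphisms lift along A -> A/m^s, whence
   the uniqueness of the map R -> A inducing a given deformation (by induction on
   s, using the bijectivity on dual numbers) and the convergence of the
   conjugations found over the quotients A/m^s.

   For an exact sequence 0 -> W -> Q -> V -> 0 with Q projective, averaging a
   lift of Q -> V or W -> Q by the trace shows that every lift of V (or of W) over
   A sits in an extension lifting Q, and that the lifts of W and of V determine
   each other up to isomorphism.  So V and W have the same deformations, which
   gives the claim on syzygies; applied to L^r -> V and L^r + P -> V + P, which
   have the same kernel, it gives the claim on V + P. *)

(** The dual bases live over k, so the trace is defined and natural over every A: averaging a matrix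
    takes the place of lifting maps out of or into projective modules over A (x) L. Two obstacles
    shape the proof. Smoothness speaks only of Artinian rings, so for a complete A the map R -> A is
    built on the quotients A/m^(s+1); the conjugations obtained there for different s are unrelated,
    and the lifting of automorphisms is what corrects them into a Cauchy sequence. Moreover, the
    syzygy and V + P are never shown to have stable endomorphism ring k. Versality of their ring R'
    is carried back to V along the bijection of deformations, so that R and R' both become universal
    for the same [rho0]. This bijection is kept as a relation, [linked], because the extension
    attached to a lift depends on choices and no matrix in it is canonical. *)

(** * Powers of an ideal *)

Section PowerIdeals.

Context (A : comNzRingType) (I : A -> Prop).
Hypothesis idI : ideal I.

Lemma ideal_pow_0 x : ideal_pow I 0 x.
Proof.
exists [:: (x, [tuple])]; split=> [p _ []//|].
by rewrite big_cons big_nil big_ord0 mulr1 addr0.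
Qed.

Lemma ideal_pow1 x : ideal_pow I 1 x <-> I x.
Proof.
have [I0 ID IM] := idI; split=> [[s [hs ->]]|Ix].
  rewrite big_seq; apply: (big_ind I) => // p /hs hp.
  by rewrite big_ord1; apply/IM/hp.
exists [:: (1, [tuple x])]; split=> [p|].
  by rewrite inE => /eqP -> i; rewrite ord1.
by rewrite big_cons big_nil big_ord1 mul1r addr0.
Qed.

Lemma ideal_pow_ideal n : ideal (ideal_pow I n).
Proof.
by split; [exact: ideal_pow0|move=> x y; exact: ideal_powD|move=> a x; exact: ideal_powMl].
Qed.

Lemma ideal_powMS n a x : I a -> ideal_pow I n x -> ideal_pow I n.+1 (a * x).
Proof.
move=> Ia [s [hs ->]]; rewrite mulr_sumr big_seq.
apply: (big_ind (ideal_pow I n.+1)); first exact: ideal_pow0.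
  by move=> u v; exact: ideal_powD.
move=> p /hs hp; exists [:: (p.1, [tuple of a :: p.2])]; split=> [q|].
  rewrite inE => /eqP -> /= i; case: (unliftP ord0 i) => [j|] -> //.
  by rewrite tnthS; exact: hp.
rewrite big_cons big_nil addr0 big_ord_recl tnth0 /= mulrCA; congr (_ * (_ * _)).
by apply: eq_bigr => i _; rewrite tnthS.
Qed.

Lemma ideal_powN n x : ideal_pow I n x -> ideal_pow I n (- x).
Proof. by rewrite -mulN1r; exact: ideal_powMl. Qed.

Lemma ideal_powB n x y : ideal_pow I n x -> ideal_pow I n y -> ideal_pow I n (x - y).
Proof. by move=> hx hy; apply/ideal_powD/ideal_powN. Qed.

Lemma ideal_pow_sum n (J : Type) (r : seq J) (P : pred J) (F : J -> A) :
  (forall j, P j -> ideal_pow I n (F j)) -> ideal_pow I n (\sum_(j <- r | P j) F j).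
Proof.
move=> h; apply: (big_ind (ideal_pow I n)) => //; first exact: ideal_pow0.
by move=> x y; exact: ideal_powD.
Qed.

Lemma ideal_pow_le m n x : (m <= n)%N -> ideal_pow I n x -> ideal_pow I m x.
Proof.
move=> /subnK <-; elim: (n - m)%N => // d IHd h; apply: IHd; exact: ideal_powS.
Qed.

Lemma ideal_pow_exp n x : I x -> ideal_pow I n (x ^+ n).
Proof.
move=> Ix; elim: n => [|n IHn]; first exact: ideal_pow_0.
by rewrite exprS; exact: ideal_powMS.
Qed.

End PowerIdeals.

Lemma ideal_pow_morph (A B : comNzRingType) (f : {rmorphism A -> B}) I J n x :
  (forall x, I x -> J (f x)) -> ideal_pow I n x -> ideal_pow J n (f x).
Proof.
move=> fI [s [hs ->]].
exists [seq (f p.1, [tuple f (tnth p.2 i) | i < n]) | p <- s]; split.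
  by move=> p /mapP[q /hs hq ->] i /=; rewrite tnth_mktuple; exact: fI.
rewrite big_map rmorph_sum; apply: eq_bigr => p _; rewrite rmorphM rmorph_prod.
by congr (_ * _); apply: eq_bigr => i _; rewrite tnth_mktuple.
Qed.

Notation mpow A n := (@ideal_pow A (@max_ideal _ A) n).

(** * Complete local algebras: units, morphisms and the graded pieces m^n / m^(n+1) *)

Section CompleteLocal.

Context (k : fieldType).
Implicit Types A B : cobj k.

Definition res A (a : A) : k := cres A a.

Lemma res_zmod A : zmod_morphism (@res A).
Proof. by move=> x y; rewrite /res rmorphB. Qed.
Lemma res_monoid A : monoid_morphism (@res A).
Proof. by split=> [|x y]; rewrite /res ?rmorph1 // rmorphM. Qed.

HB.instance Definition _ A := GRing.isZmodMorphism.Build A k (@res A) (@res_zmod A).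
HB.instance Definition _ A := GRing.isMonoidMorphism.Build A k (@res A) (@res_monoid A).

Lemma resD A (x y : A) : res (x + y) = res x + res y. Proof. exact: rmorphD. Qed.
Lemma resB A (x y : A) : res (x - y) = res x - res y. Proof. exact: rmorphB. Qed.
Lemma resM A (x y : A) : res (x * y) = res x * res y. Proof. exact: rmorphM. Qed.
Lemma res1 A : res (1 : A) = 1. Proof. exact: rmorph1. Qed.

Lemma resZ A c (a : A) : res (c *: a) = c * res a.
Proof. by rewrite /res linearZ. Qed.

Lemma res_alg A (c : k) : res (c%:A : A) = c.
Proof. by rewrite resZ res1 mulr1. Qed.

Lemma res_chom A B (f : chom A B) a : res (f a) = res a.
Proof. exact: chom_res. Qed.

Lemma chomZ A B (f : chom A B) c a : f (c *: a) = c *: f a.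
Proof. exact: linearZ. Qed.

Lemma max_idealE A (x : A) : max_ideal x = (res x = 0).
Proof. by []. Qed.

Lemma max_idealP A : ideal (@max_ideal k A).
Proof.
split=> [|x y|a x]; rewrite !max_idealE ?rmorph0 // ?resD ?resM.
  by move=> -> ->; rewrite addr0.
by move=> ->; rewrite mulr0.
Qed.

Lemma mpow1 A x : mpow A 1 x <-> res x = 0.
Proof. exact: ideal_pow1 (max_idealP A) x. Qed.

Lemma mpow_sep A x : (forall n, mpow A n x) -> x = 0.
Proof. by case: (cobj_complete A) => h _; exact: h. Qed.

Lemma mpow_lim A u : (forall n, mpow A n (u n.+1 - u n)) ->
  exists x, forall n, mpow A n (x - u n).
Proof. by case: (cobj_complete A) => _ h; exact: h. Qed.

(** Up to the scalar [res a], the element is 1 - x with x in the maximal ideal; by completeness the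
    geometric series in x converges to an inverse of 1 - x. *)
Lemma res_inv A (a : A) : res a != 0 -> exists b, a * b = 1.
Proof.
move=> nz; pose x := 1 - (res a)^-1 *: a.
have mx : max_ideal x.
  by rewrite max_idealE resB res1 resZ mulVf // subrr.
pose u n := \sum_(i < n) x ^+ i.
have [n|y hy] := @mpow_lim A u.
  by rewrite /u big_ord_recr addrAC subrr add0r; exact: ideal_pow_exp.
exists ((res a)^-1 *: y).
have xE : (1 - x) * y = a * ((res a)^-1 *: y) by rewrite /x opprB addrC subrK -scalerAl -scalerAr.
rewrite -xE; apply/eqP; rewrite -subr_eq0; apply/eqP/mpow_sep => n.
have -> : (1 - x) * y - 1 = (1 - x) * (y - u n) - x ^+ n.
  rewrite mulrBr -addrA; congr (_ + _).
  have -> : (1 - x) * u n = 1 - x ^+ n.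
    elim: n => [|n IHn]; first by rewrite /u big_ord0 mulr0 expr0 subrr.
    by rewrite /u big_ord_recr mulrDr IHn exprS mulrBl mul1r addrA subrK.
  by rewrite opprB addrAC subrr add0r.
by apply: ideal_powB; [exact: ideal_powMl (hy n)|exact: ideal_pow_exp].
Qed.

Lemma res_mx_inv A n (X : 'M[A]_n) : \det (map_mx (@res A) X) != 0 ->
  exists Y, X *m Y = 1%:M /\ Y *m X = 1%:M.
Proof.
rewrite det_map_mx => /res_inv[b bE]; exists (b *: \adj X).
rewrite -scalemxAr -scalemxAl mul_mx_adj mul_adj_mx scale_scalar_mx mulrC bE.
by [].
Qed.

Lemma res1_mx_inv A n (X : 'M[A]_n) : map_mx (@res A) X = 1%:M ->
  exists Y, [/\ X *m Y = 1%:M, Y *m X = 1%:M & map_mx (@res A) Y = 1%:M].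
Proof.
move=> X1; have [|Y [XY YX]] := @res_mx_inv A n X; first by rewrite X1 det1 oner_eq0.
exists Y; split=> //.
have := congr1 (map_mx (@res A)) XY; rewrite map_mxM X1 mul1mx => ->.
by rewrite map_mx1.
Qed.

(* Continuity is automatic for local homomorphisms. *)
Lemma chom_of_res A B (f : {lrmorphism A -> B}) :
  (forall x, res (f x) = res x) -> exists g : chom A B, g =1 f.
Proof.
move=> fr; have fc n : exists m, forall x, mpow A m x -> mpow B n (f x).
  by exists n => x; apply: ideal_pow_morph => y; rewrite !max_idealE fr.
by exists (CHom fc fr).
Qed.

Lemma chom_of_fun A B (f : A -> B) :
  (forall x y, f (x + y) = f x + f y) -> (forall x y, f (x * y) = f x * f y) ->
  (forall c x, f (c *: x) = c *: f x) -> f 1 = 1 ->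
  (forall x, res (f x) = res x) -> exists g : chom A B, g =1 f.
Proof.
move=> fD fM fZ f1 fr.
have fl : linear f by move=> c x y; rewrite fD fZ.
have fm : monoid_morphism f by [].
pose ml := GRing.isLinear.Build _ _ _ _ f fl.
pose mm := GRing.isMonoidMorphism.Build _ _ f fm.
pose F : {lrmorphism A -> B} := HB.pack f ml mm.
by have [g gE] := @chom_of_res A B F fr; exists g.
Qed.

Section Graded.

Context (A : cobj k) (n : nat).

(** Generators of m^n over A exist by noetherianity; modulo m^(n+1) each coefficient may be replaced
    by its residue, so they span over k. *)
Lemma mpow_span : exists r (t : 'I_r -> A), (forall j, mpow A n (t j)) /\
  forall x, mpow A n x -> exists c : 'I_r -> k, mpow A n.+1 (x - \sum_j c j *: t j).
Proof.
have [s hs] := cobj_noetherian (ideal_pow_ideal (@max_ideal k A) n).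
exists (size s), (fun j => s`_j); split=> [j|x /hs[a ->]].
  apply/hs; exists (fun i => (i == j)%:R).
  rewrite (bigD1 j) //= eqxx mul1r big1 ?addr0 // => i /negPf ->.
  by rewrite mul0r.
exists (fun i => res (a i)); rewrite -sumrB; apply: ideal_pow_sum => i _.
rewrite -[_ *: _]mulr_algl -mulrBl; apply: ideal_powMS.
  by rewrite max_idealE resB res_alg subrr.
apply/hs; exists (fun j => (j == i)%:R).
rewrite (bigD1 i) //= eqxx mul1r big1 ?addr0 // => j /negPf ->.
by rewrite mul0r.
Qed.

(** A spanning family of least size is independent modulo m^(n+1): a nontrivial relation would allow
    one member to be eliminated. *)
Lemma mpow_basis : exists r (t : 'I_r -> A), [/\ forall j, mpow A n (t j),
  forall x, mpow A n x -> exists c : 'I_r -> k, mpow A n.+1 (x - \sum_j c j *: t j)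
  & forall c : 'I_r -> k, mpow A n.+1 (\sum_j c j *: t j) -> forall j, c j = 0].
Proof.
pose Q r := `[< exists t : 'I_r -> A, (forall j, mpow A n (t j)) /\
  forall x, mpow A n x -> exists c : 'I_r -> k, mpow A n.+1 (x - \sum_j c j *: t j) >].
have exQ : exists r, Q r.
  by have [r [t h]] := mpow_span; exists r; apply/asboolP; exists t.
case: (ex_minnP exQ) => r /asboolP[t [tm tsp]] rmin; exists r, t; split=> // c hc j.
apply/eqP/negPn/negP => cj.
case: r => [|r] in t tm tsp rmin c hc j cj *; first by case: j {cj}.
suff /rmin : Q r by rewrite ltnn.
apply/asboolP; exists (fun i => t (lift j i)); split=> // x /tsp[d hd].
exists (fun i => d (lift j i) - d j / c j * c (lift j i)).
have -> : x - \sum_i (d (lift j i) - d j / c j * c (lift j i)) *: t (lift j i) =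
    x - \sum_i d i *: t i + (d j / c j) *: \sum_i c i *: t i.
  rewrite -addrA; congr (_ + _).
  rewrite !(bigD1_ord j) //= scalerDr scalerA divfK // opprD addrACA addNr add0r.
  rewrite scaler_sumr -sumrN -sumrN -big_split /=; apply: eq_bigr => i _.
  by rewrite scalerA scalerBl opprB addrC.
apply: ideal_powD => //; rewrite -mulr_algl; exact: ideal_powMl.
Qed.

End Graded.

End CompleteLocal.

(** * Matrices with entries in m^n and their coefficients modulo m^(n+1) *)

Section PowerMatrices.

Context (k : fieldType) (A : cobj k).

Lemma map_res_alg p q (X : 'M[k]_(p, q)) : map_mx (@res k A) (map_mx (in_alg A) X) = X.
Proof. by rewrite -map_mx_comp map_mx_id // => a; rewrite /= res_alg. Qed.

Definition mxpow n p q (X : 'M[A]_(p, q)) : Prop := forall i j, mpow A n (X i j).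

Lemma mxpow0 n p q : mxpow n (0 : 'M[A]_(p, q)).
Proof. by move=> i j; rewrite mxE; exact: ideal_pow0. Qed.

Lemma mxpowD n p q (X Y : 'M[A]_(p, q)) : mxpow n X -> mxpow n Y -> mxpow n (X + Y).
Proof. by move=> hX hY i j; rewrite mxE; apply: ideal_powD; [exact: hX | exact: hY]. Qed.

Lemma mxpowN n p q (X : 'M[A]_(p, q)) : mxpow n X -> mxpow n (- X).
Proof. by move=> hX i j; rewrite mxE; apply: ideal_powN; exact: hX. Qed.

Lemma mxpowB n p q (X Y : 'M[A]_(p, q)) : mxpow n X -> mxpow n Y -> mxpow n (X - Y).
Proof. by move=> hX hY; apply: mxpowD => //; exact: mxpowN. Qed.

Lemma mxpowMl n p q r (X : 'M[A]_(p, q)) (Y : 'M[A]_(q, r)) :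
  mxpow n X -> mxpow n (X *m Y).
Proof.
by move=> hX i j; rewrite mxE; apply: ideal_pow_sum => s _; rewrite mulrC; apply/ideal_powMl/hX.
Qed.

Lemma mxpowMr n p q r (X : 'M[A]_(p, q)) (Y : 'M[A]_(q, r)) :
  mxpow n Y -> mxpow n (X *m Y).
Proof.
by move=> hY i j; rewrite mxE; apply: ideal_pow_sum => s _; apply/ideal_powMl/hY.
Qed.

Lemma mxpow1 p q (X : 'M[A]_(p, q)) : mxpow 1 X <-> map_mx (@res k A) X = 0.
Proof.
split=> [h|h i j]; first by apply/matrixP => i j; rewrite !mxE; apply/mpow1/h.
by apply/mpow1; move/matrixP/(_ i j): h; rewrite !mxE.
Qed.

Lemma mxpow_res n p q (X Y : 'M[A]_(p, q)) : (0 < n)%N -> mxpow n (X - Y) ->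
  map_mx (@res k A) X = map_mx (@res k A) Y.
Proof.
move=> n0 h; apply/eqP; rewrite -subr_eq0 -map_mxB; apply/eqP/mxpow1 => i j.
exact: ideal_pow_le n0 (h i j).
Qed.

Lemma mxpow_sep p q (X Y : 'M[A]_(p, q)) : (forall n, mxpow n (X - Y)) -> X = Y.
Proof.
move=> h; apply/matrixP => i j; apply/eqP; rewrite -subr_eq0; apply/eqP.
by apply: mpow_sep => n; have := h n i j; rewrite !mxE.
Qed.

Lemma mxpow_lim p q (u : nat -> 'M[A]_(p, q)) : (forall n, mxpow n (u n.+1 - u n)) ->
  exists X, forall n, mxpow n (X - u n).
Proof.
move=> h; have lim (ij : 'I_p * 'I_q) :
    exists x, forall n, mpow A n (x - u n ij.1 ij.2).
  by apply: mpow_lim => n; have := h n ij.1 ij.2; rewrite !mxE.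
have [F hF] := choice lim; exists (\matrix_(i, j) F (i, j)) => n i j.
by rewrite !mxE; exact: hF (i, j) n.
Qed.

(* The coefficients of elements of m^n on a basis of m^n / m^(n+1); they are
   junk outside of m^n. *)
Lemma mpow_coef n : exists r (t : 'I_r -> A) (c : 'I_r -> A -> k),
  [/\ forall j, mpow A n (t j),
      forall x, mpow A n x -> mpow A n.+1 (x - \sum_j c j x *: t j),
      forall j x y, mpow A n x -> mpow A n y -> c j (x + y) = c j x + c j y,
      forall j a x, mpow A n x -> c j (a * x) = res a * c j x
    & forall j x, mpow A n.+1 x -> c j x = 0].
Proof.
have [r [t [tm tsp tfree]]] := mpow_basis A n.
have ex (x : A) : exists d : 'I_r -> k,
    mpow A n x -> mpow A n.+1 (x - \sum_j d j *: t j).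
  by have [/tsp[d hd]|nx] := pselect (mpow A n x); [exists d | exists (fun=> 0)].
have [c hc] := choice ex.
(* Coefficients on a basis of m^n / m^(n+1) are unique, so each rule below only requires exhibiting
   one expansion with the claimed coefficients. *)
have uniq x d j : mpow A n x -> mpow A n.+1 (x - \sum_j d j *: t j) -> c x j = d j.
  move=> hx hd; apply/eqP; rewrite -subr_eq0; apply/eqP.
  apply: (tfree (fun j => c x j - d j)).
  have -> : \sum_j (c x j - d j) *: t j =
      (x - \sum_j d j *: t j) - (x - \sum_j c x j *: t j).
    rewrite opprB [RHS]addrC subrKA -sumrB.
    by apply: eq_bigr => i _; rewrite scalerBl.
  by apply: ideal_powB => //; exact: hc.
exists r, t, (fun j x => c x j); split=> //.
- move=> j x y hx hy; apply: (uniq _ (fun j => c x j + c y j)); first exact: ideal_powD.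
  have -> : x + y - \sum_j (c x j + c y j) *: t j =
      (x - \sum_j c x j *: t j) + (y - \sum_j c y j *: t j).
    rewrite addrACA -opprD -big_split; congr (_ - _).
    by apply: eq_bigr => i _; rewrite scalerDl.
  by apply: ideal_powD; exact: hc.
- move=> j a x hx; apply: (uniq _ (fun j => res a * c x j)); first exact: ideal_powMl.
  have -> : a * x - \sum_j (res a * c x j) *: t j =
      (a - (res a)%:A) * x + (res a)%:A * (x - \sum_j c x j *: t j).
    rewrite mulrBl mulrBr addrA subrK; congr (_ - _).
    rewrite mulr_algl scaler_sumr; apply: eq_bigr => i _.
    by rewrite scalerA.
  apply: ideal_powD; last by apply: ideal_powMl; exact: hc.
  by apply: ideal_powMS => //; rewrite max_idealE resB res_alg subrr.
- move=> j x hx; apply: (uniq _ (fun=> 0)); first exact: ideal_powS.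
  by rewrite big1 ?subr0 // => i _; rewrite scale0r.
Qed.

Section Coefficients.

Context (n r : nat) (t : 'I_r -> A) (c : 'I_r -> A -> k).
Hypothesis tm : forall j, mpow A n (t j).
Hypothesis cE : forall x, mpow A n x -> mpow A n.+1 (x - \sum_j c j x *: t j).
Hypothesis cD : forall j x y, mpow A n x -> mpow A n y -> c j (x + y) = c j x + c j y.
Hypothesis cM : forall j a x, mpow A n x -> c j (a * x) = res a * c j x.
Hypothesis c0 : forall j x, mpow A n.+1 x -> c j x = 0.

Lemma coefB j x y : mpow A n x -> mpow A n y -> c j (x - y) = c j x - c j y.
Proof.
move=> hx hy; rewrite cD //; last exact: ideal_powN.
by rewrite -mulN1r cM // -[-1]scaleN1r res_alg mulN1r.
Qed.

Lemma coef_sum j s (F : 'I_s -> A) : (forall i, mpow A n (F i)) ->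
  c j (\sum_i F i) = \sum_i c j (F i).
Proof.
move=> hF; pose P x y := mpow A n x /\ c j x = y.
suff [] : P (\sum_i F i) (\sum_i c j (F i)) by [].
apply: (big_ind2 P) => [|x x' y y' [hx <-] [hy <-]|//].
  by split; [exact: ideal_pow0 | apply: c0; exact: ideal_pow0].
by split; [exact: ideal_powD | exact: cD].
Qed.

Lemma coef_mxB j p q (X Y : 'M[A]_(p, q)) : mxpow n X -> mxpow n Y ->
  map_mx (c j) (X - Y) = map_mx (c j) X - map_mx (c j) Y.
Proof. by move=> hX hY; apply/matrixP => a b; rewrite !mxE coefB. Qed.

Lemma coef_mxMr j p q s (X : 'M[A]_(p, q)) (Y : 'M[A]_(q, s)) : mxpow n Y ->
  map_mx (c j) (X *m Y) = map_mx (@res k A) X *m map_mx (c j) Y.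
Proof.
move=> hY; apply/matrixP => a b; rewrite !mxE coef_sum.
  by apply: eq_bigr => i _; rewrite !mxE cM.
by move=> i; apply: ideal_powMl; exact: hY.
Qed.

Lemma coef_mxMl j p q s (X : 'M[A]_(p, q)) (Y : 'M[A]_(q, s)) : mxpow n X ->
  map_mx (c j) (X *m Y) = map_mx (c j) X *m map_mx (@res k A) Y.
Proof.
move=> hX; apply/matrixP => a b; rewrite !mxE coef_sum.
  by apply: eq_bigr => i _; rewrite !mxE mulrC cM // mulrC.
by move=> i; rewrite mulrC; apply: ideal_powMl; exact: hX.
Qed.

Lemma coef_mx0 j p q (X : 'M[A]_(p, q)) : mxpow n.+1 X -> map_mx (c j) X = 0.
Proof. by move=> hX; apply/matrixP => a b; rewrite !mxE c0. Qed.

(** Since t_j m lies in m^(n+1), any lifts to A of the coefficient matrices serve in the expansion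
    of X. This freedom allows lifts that commute with a representation. *)
Lemma coef_mxE p q (X : 'M[A]_(p, q)) (Y : 'I_r -> 'M[A]_(p, q)) : mxpow n X ->
  (forall j, map_mx (@res k A) (Y j) = map_mx (c j) X) ->
  mxpow n.+1 (X - \sum_j t j *: Y j).
Proof.
move=> hX hY a b; rewrite mxE [in X in _ + X]mxE summxE.
rewrite -[X in mpow _ _ X](subrKA (\sum_j c j (X a b) *: t j)).
apply: ideal_powD; first exact: cE.
rewrite -sumrB; apply: ideal_pow_sum => j _; rewrite mxE -mulr_algl [t j * _]mulrC -mulrBl.
apply: ideal_powMS => //; rewrite max_idealE resB res_alg.
by move/matrixP/(_ a b): (hY j); rewrite !mxE => ->; rewrite subrr.
Qed.

End Coefficients.

End PowerMatrices.

(** * Matrix representations, the Higman trace and the lifting of automorphisms *)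

Section MatrixRepresentations.

Context (k : fieldType) (L : falgType k).

(** Duality b(y_i, x_j) = delta_ij enters only through these two expansions, which move an element
    of L across the sum of the x_i (x) y_i. *)
Definition dual_bases d (x y : 'I_d -> L) (b : L -> L -> k) : Prop :=
  [/\ forall l l' l'', b (l * l') l'' = b l (l' * l''),
      forall l, l = \sum_i b (y i) l *: x i
    & forall l, l = \sum_i b l (x i) *: y i].

(** The structure map is a parameter so that one notion covers k itself, with [idfun], and
    k-algebras, with [in_alg]. *)
Definition is_rep (A : comNzRingType) (iota : k -> A) n (rho : L -> 'M[A]_n) : Prop :=
  [/\ forall c l l', rho (c *: l + l') = iota c *: rho l + rho l',
      rho 1 = 1%:M
    & forall l l', rho (l * l') = rho l *m rho l'].

Section Trace.

Context (d : nat) (x y : 'I_d -> L) (b : L -> L -> k).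
Hypothesis xyb : dual_bases x y b.
Context (A : comNzRingType) (iota : {rmorphism k -> A}).

(* The Higman trace. *)
Definition htr m n (sigma : L -> 'M[A]_m) (rho : L -> 'M[A]_n) (h : 'M[A]_(m, n)) :
    'M[A]_(m, n) := \sum_i sigma (x i) *m h *m rho (y i).

Lemma rep_sum n (rho : L -> 'M[A]_n) s (c : 'I_s -> k) (l : 'I_s -> L) :
  is_rep iota rho -> rho (\sum_i c i *: l i) = \sum_i iota (c i) *: rho (l i).
Proof.
move=> [rl _ _]; have r0 : rho 0 = 0.
  have /eqP := rl 1 0 0; rewrite scale1r addr0 rmorph1 scale1r.
  by rewrite -subr_eq0 opprD addNKr oppr_eq0 => /eqP.
by apply: (big_ind2 (fun u v => rho u = v)) => // [u _ v _ <- <-|i _];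
  [have := rl 1 u v; rewrite scale1r rmorph1 scale1r
  |have := rl (c i) (l i) 0; rewrite addr0 r0 addr0].
Qed.

(** The sum of the x_i (x) y_i is a Casimir element: l x_i has coefficients b(y_j, l x_i) on the
    x_j, y_j l has coefficients b(y_j l, x_i) on the y_i, and these agree by associativity of the
    form. *)
Lemma htr_intertwine m n (sigma : L -> 'M[A]_m) (rho : L -> 'M[A]_n) h l :
  is_rep iota sigma -> is_rep iota rho ->
  sigma l *m htr sigma rho h = htr sigma rho h *m rho l.
Proof.
case: xyb => bA bx by_ rs rr; rewrite /htr mulmx_sumr mulmx_suml.
transitivity (\sum_i \sum_j iota (b (y j) (l * x i)) *: (sigma (x j) *m h *m rho (y i))).
  apply: eq_bigr => i _; case: (rs) => _ _ sM.
  rewrite !mulmxA -sM {1}[l * x i]bx (rep_sum _ _ rs) !mulmx_suml.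
  by apply: eq_bigr => j _; rewrite -!scalemxAl.
rewrite exchange_big; apply: eq_bigr => j _ /=; case: (rr) => _ _ rM.
rewrite -mulmxA -rM {1}[y j * l]by_ (rep_sum _ _ rr) mulmx_sumr.
by apply: eq_bigr => i _; rewrite -scalemxAr bA.
Qed.

Lemma htr_mull m m' n (sigma : L -> 'M[A]_m) (sigma' : L -> 'M[A]_m')
    (rho : L -> 'M[A]_n) (U : 'M[A]_(m', m)) h :
  (forall l, U *m sigma l = sigma' l *m U) ->
  U *m htr sigma rho h = htr sigma' rho (U *m h).
Proof.
move=> hU; rewrite /htr mulmx_sumr; apply: eq_bigr => i _.
by rewrite !mulmxA hU.
Qed.

Lemma htr_mulr m n n' (sigma : L -> 'M[A]_m) (rho : L -> 'M[A]_n)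
    (rho' : L -> 'M[A]_n') (U : 'M[A]_(n, n')) h :
  (forall l, rho l *m U = U *m rho' l) ->
  htr sigma rho h *m U = htr sigma rho' (h *m U).
Proof.
move=> hU; rewrite /htr mulmx_suml; apply: eq_bigr => i _.
by rewrite -!mulmxA hU.
Qed.

End Trace.

Lemma map_htr d (x y : 'I_d -> L) (A B : comNzRingType) (f : {rmorphism A -> B}) m n
    (sigma : L -> 'M[A]_m) (rho : L -> 'M[A]_n) h :
  map_mx f (htr x y sigma rho h) =
  htr x y (fun l => map_mx f (sigma l)) (fun l => map_mx f (rho l)) (map_mx f h).
Proof.
rewrite /htr raddf_sum /=; apply: eq_bigr => i _.
by rewrite !map_mxM.
Qed.

Lemma eq_htr d (x y : 'I_d -> L) (A : comNzRingType) m n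
    (sigma sigma' : L -> 'M[A]_m) (rho rho' : L -> 'M[A]_n) h :
  sigma =1 sigma' -> rho =1 rho' -> htr x y sigma rho h = htr x y sigma' rho' h.
Proof. by move=> es er; apply: eq_bigr => i _; rewrite es er. Qed.

Definition mlift n (rho0 : L -> 'M[k]_n) (A : cobj k) (rho : L -> 'M[A]_n) : Prop :=
  is_rep (in_alg A) rho /\ forall l, map_mx (@res k A) (rho l) = rho0 l.

(** Such an X is invertible by [res1_mx_inv], so this is conjugacy under the kernel of GL_n(A) ->
    GL_n(k). *)
Definition strict_eq (A : cobj k) n (rho rho' : L -> 'M[A]_n) : Prop :=
  exists X, map_mx (@res k A) X = 1%:M /\ forall l, X *m rho l = rho' l *m X.

Lemma strict_eq_refl (A : cobj k) n (rho : L -> 'M[A]_n) : strict_eq rho rho.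
Proof. by exists 1%:M; rewrite map_mx1; split=> // l; rewrite mul1mx mulmx1. Qed.

Lemma strict_eq_sym (A : cobj k) n (rho rho' : L -> 'M[A]_n) :
  strict_eq rho rho' -> strict_eq rho' rho.
Proof.
move=> [X [X1 hX]]; have [Y [XY YX Y1]] := res1_mx_inv X1; exists Y; split=> // l.
by rewrite -[LHS]mulmx1 -XY !mulmxA -[Y *m _ *m X]mulmxA -hX !mulmxA YX mul1mx.
Qed.

Lemma strict_eq_trans (A : cobj k) n (rho rho' rho'' : L -> 'M[A]_n) :
  strict_eq rho rho' -> strict_eq rho' rho'' -> strict_eq rho rho''.
Proof.
move=> [X [X1 hX]] [Y [Y1 hY]]; exists (Y *m X); rewrite map_mxM X1 Y1 mulmx1.
by split=> // l; rewrite -mulmxA hX !mulmxA hY.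
Qed.

Lemma mlift_chom n (rho0 : L -> 'M[k]_n) (A B : cobj k) (f : chom A B) rho :
  mlift rho0 rho -> mlift rho0 (fun l => map_mx f (rho l)).
Proof.
move=> [[rl r1 rM] r0]; split; first split.
- by move=> c l l'; rewrite rl map_mxD map_mxZ /= rmorph_alg.
- by rewrite r1 map_mx1.
- by move=> l l'; rewrite rM map_mxM.
by move=> l; rewrite -map_mx_comp -r0; apply/matrixP => i j; rewrite !mxE /= res_chom.
Qed.

Lemma strict_eq_chom (A B : cobj k) (f : chom A B) n (rho rho' : L -> 'M[A]_n) :
  strict_eq rho rho' ->
  strict_eq (fun l => map_mx f (rho l)) (fun l => map_mx f (rho' l)).
Proof.
move=> [X [X1 hX]]; exists (map_mx f X); split=> [|l]; last by rewrite -!map_mxM hX.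
by rewrite -X1 -map_mx_comp; apply/matrixP => i j; rewrite !mxE /= res_chom.
Qed.

Section Rigidity.

Context (d : nat) (x y : 'I_d -> L) (b : L -> L -> k).
Hypothesis xyb : dual_bases x y b.

Definition stably_scalar n (rho0 : L -> 'M[k]_n) : Prop :=
  forall X, (forall l, rho0 l *m X = X *m rho0 l) ->
    exists c g, X = c%:M + htr x y rho0 rho0 g.

Context (n : nat) (rho0 : L -> 'M[k]_n).
Hypothesis rho0_scalar : stably_scalar rho0.

(* Endomorphisms lift along A -> A/m^s, as both scalars and Higman traces do. *)
Lemma commutant_lift (A : cobj k) (rho : L -> 'M[A]_n) s X : mlift rho0 rho ->
  (forall l, mxpow s (rho l *m X - X *m rho l)) ->
  exists Y, (forall l, rho l *m Y = Y *m rho l) /\ mxpow s (X - Y).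
Proof.
move=> [rr r0]; elim: s => [_|s IHs hX].
  by exists 0; split=> [l|i j]; [rewrite mulmx0 mul0mx | exact: ideal_pow_0].
have [Y [cY hY]] : exists Y, (forall l, rho l *m Y = Y *m rho l) /\ mxpow s (X - Y).
  by apply: IHs => l i j; apply/ideal_powS/hX.
have [r [t [c [tm cE cD cM c0]]]] := mpow_coef A s.
(* As Y commutes with [rho], the commutator of X - Y with [rho] is that of X and lies in m^(s+1);
   hence the coefficients of X - Y on m^s / m^(s+1) commute with [rho0]. *)
have ex j : exists cg : k * 'M_n,
    map_mx (c j) (X - Y) = cg.1%:M + htr x y rho0 rho0 cg.2.
  have [|e [g E]] := @rho0_scalar (map_mx (c j) (X - Y)); last by exists (e, g).
  move=> l; apply/eqP; rewrite -subr_eq0 -r0.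
  rewrite -(coef_mxMr cD cM c0) // -(coef_mxMl cD cM c0) //.
  rewrite -(coef_mxB cD cM); [|exact: mxpowMr|exact: mxpowMl].
  apply/eqP/(coef_mx0 c0); rewrite mulmxBr mulmxBl cY opprB addrA subrK.
  exact: hX.
have [cg hcg] := choice ex.
(* The same scalar and the trace of the same matrix, now formed over A with [rho]: this lifts the
   coefficient matrix and commutes with [rho] exactly. *)
pose Z j : 'M[A]_n := ((cg j).1%:A)%:M + htr x y rho rho (map_mx (in_alg A) (cg j).2).
have cZ j l : rho l *m Z j = Z j *m rho l.
  by rewrite mulmxDr mulmxDl scalar_mxC (htr_intertwine xyb _ _ rr rr).
exists (Y + \sum_j t j *: Z j); split=> [l|].
  rewrite mulmxDr mulmxDl cY mulmx_sumr mulmx_suml; congr (_ + _).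
  by apply: eq_bigr => j _; rewrite -scalemxAr -scalemxAl cZ.
rewrite opprD addrA; apply: (coef_mxE tm cE) => // j.
rewrite hcg map_mxD map_scalar_mx /= res_alg map_htr; congr (_ + _).
by rewrite map_res_alg (eq_htr _ _ _ r0 r0).
Qed.

(** The better conjugation Z need not be close to X, but Z^-1 X commutes with [rho] modulo m^(s+1),
    hence is congruent to a true endomorphism Y of [rho]. Then Z Y is as good as Z and close to
    X. *)
Lemma strict_eq_approx_step (A : cobj k) (rho rho' : L -> 'M[A]_n) s X :
  mlift rho0 rho -> map_mx (@res k A) X = 1%:M ->
  (forall l, mxpow s.+1 (X *m rho l - rho' l *m X)) ->
  (exists Z, map_mx (@res k A) Z = 1%:M /\
     forall l, mxpow s.+2 (Z *m rho l - rho' l *m Z)) ->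
  exists X', [/\ map_mx (@res k A) X' = 1%:M,
    forall l, mxpow s.+2 (X' *m rho l - rho' l *m X') & mxpow s.+1 (X' - X)].
Proof.
move=> hr X1 hX [Z [Z1 hZ]]; have [W [ZW WZ W1]] := res1_mx_inv Z1.
have [l|Y [cY hY]] := @commutant_lift A rho s.+1 (W *m X) hr.
  have -> : rho l *m (W *m X) - W *m X *m rho l =
     W *m ((Z *m rho l - rho' l *m Z) *m (W *m X)) - W *m (X *m rho l - rho' l *m X).
    rewrite !(mulmxBl, mulmxBr) !mulmxA WZ mul1mx opprB addrA; congr (_ - _).
    by rewrite -[W *m rho' l *m Z *m W]mulmxA ZW mulmx1 subrK.
  apply: mxpowB; last exact: mxpowMr.
  by apply/mxpowMr/mxpowMl => i j; apply/ideal_powS/hZ.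
have hZY : mxpow s.+1 (Z *m Y - X).
  have -> : Z *m Y - X = - (Z *m (W *m X - Y)).
    by rewrite mulmxBr mulmxA ZW mul1mx opprB.
  exact/mxpowN/mxpowMr.
exists (Z *m Y); split=> //; first by rewrite (mxpow_res _ hZY).
move=> l; rewrite -mulmxA -cY !mulmxA -mulmxBl; exact: mxpowMl.
Qed.

(** The given matrices Z for the various s are mutually unrelated; corrected one after the other
    they converge, and the limit conjugates exactly because A is separated. *)
Lemma strict_eq_complete (A : cobj k) (rho rho' : L -> 'M[A]_n) : mlift rho0 rho ->
  (forall s, exists Z, map_mx (@res k A) Z = 1%:M /\
     forall l, mxpow s.+1 (Z *m rho l - rho' l *m Z)) ->
  strict_eq rho rho'.
Proof.
move=> hr hZ.
pose good s X := map_mx (@res k A) X = 1%:M /\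
  forall l, mxpow s.+1 (X *m rho l - rho' l *m X).
(* The implication sits under the existential so that choice yields a total function to iterate; its
   value outside of [good] is junk. *)
have step (sX : nat * 'M[A]_n) : exists X', good sX.1 sX.2 ->
    good sX.1.+1 X' /\ mxpow sX.1.+1 (X' - sX.2).
  case: sX => s X /=; have [[X1 hX]|nX] := pselect (good s X); last by exists 0.
  by have [X' []] := strict_eq_approx_step hr X1 hX (hZ s.+1); exists X'.
have [F hF] := choice step; have [Z0 gZ0] := hZ 0.
pose u := fix u s := if s is s'.+1 then F (s', u s') else Z0.
have gu s : good s (u s) by elim: s => // s IHs; case: (hF (s, u s) IHs).
have du s : mxpow s.+1 (u s.+1 - u s) by case: (hF (s, u s) (gu s)).
have [|X hX] := @mxpow_lim k A _ _ u; first by move=> s i j; apply/ideal_powS/du.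
exists X; split; first by rewrite (mxpow_res _ (hX 1)) //; case: (gu 1).
move=> l; apply: mxpow_sep => s.
have -> : X *m rho l - rho' l *m X =
    (X - u s) *m rho l - rho' l *m (X - u s) + (u s *m rho l - rho' l *m u s).
  by rewrite mulmxBl mulmxBr opprB addrAC !subrKA.
apply: mxpowD; first by apply: mxpowB; [exact: mxpowMl | exact: mxpowMr].
by case: (gu s) => _ h i j; apply/ideal_powS/h.
Qed.

End Rigidity.

End MatrixRepresentations.

(** * Matrices over the dual numbers *)

Section DualNumbers.

Context (k : fieldType).
Local Notation D := (dual_numbers k).

Definition dual_mx m n (X Y : 'M[k]_(m, n)) : 'M[D]_(m, n) :=
  \matrix_(i, j) (Dual (X i j) (Y i j) : D).

Lemma dual_sum n (f g : 'I_n -> k) :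
  \sum_i (Dual (f i) (g i) : D) = Dual (\sum_i f i) (\sum_i g i).
Proof.
elim: n f g => [|n IHn] f g; first by rewrite !big_ord0.
by rewrite !big_ord_recl IHn.
Qed.

Lemma dual_mxM m n p (X Y : 'M[k]_(m, n)) (X' Y' : 'M[k]_(n, p)) :
  dual_mx X Y *m dual_mx X' Y' = dual_mx (X *m X') (X *m Y' + Y *m X').
Proof.
apply/matrixP => i j; rewrite !mxE -big_split -dual_sum; apply: eq_bigr => s _.
by rewrite !mxE.
Qed.

Lemma dual_mx_res m n (X Y : 'M[k]_(m, n)) : map_mx (@res k D) (dual_mx X Y) = X.
Proof. by apply/matrixP => i j; rewrite !mxE. Qed.

End DualNumbers.

(** * Uniqueness of the morphism inducing a deformation *)

Section Injectivity.

Context (k : fieldType) (L : falgType k).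
Context (d : nat) (x y : 'I_d -> L) (b : L -> L -> k).
Hypothesis xyb : dual_bases x y b.
Context (n : nat) (rho0 : L -> 'M[k]_n).
Hypothesis rho0_scalar : stably_scalar x y rho0.
Context (R : cobj k) (rho : L -> 'M[R]_n).
Hypothesis hrho : mlift rho0 rho.
Hypothesis tangent_inj : forall f g : chom R (dual_numbers k),
  strict_eq (fun l => map_mx f (rho l)) (fun l => map_mx g (rho l)) -> f =1 g.

(* If f and g agree modulo m^s, then each coefficient of g - f on a basis of
   m^s / m^(s+1) is a derivation of R, that is, a morphism to k[e]; the
   conjugation of f rho to g rho, corrected by an automorphism of f rho, makes
   the corresponding infinitesimal deformation trivial. *)
Lemma versal_inj (A : cobj k) (f g : chom R A) :
  strict_eq (fun l => map_mx f (rho l)) (fun l => map_mx g (rho l)) -> f =1 g.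
Proof.
move=> [X [X1 hX]] r; apply/eqP; rewrite eq_sym -subr_eq0; apply/eqP/mpow_sep => s.
elim: s => [|s IHs] in r *; first exact: ideal_pow_0.
case: s => [|s] in IHs *; first by apply/mpow1; rewrite resB !res_chom subrr.
have hf := mlift_chom f hrho; have hg := mlift_chom g hrho.
(* X intertwines f [rho] with g [rho], which agree modulo m^(s+1); so X commutes with f [rho] to
   that order and is congruent to an endomorphism Y of f [rho]. *)
have [l|Y [cY hXY]] := commutant_lift xyb rho0_scalar (s := s.+1) (X := X) hf.
  rewrite hX -mulmxBl; apply: mxpowMl => i j; rewrite !mxE -opprB; apply: ideal_powN.
  exact: IHs.
have [q [t [c [tm cE cD cM c0]]]] := mpow_coef A s.+1.
pose e j u := c j (g u - f u).
have eD j u v : e j (u + v) = e j u + e j v.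
  by rewrite /e !rmorphD opprD addrACA cD //; exact: IHs.
have eM j u v : e j (u * v) = res u * e j v + e j u * res v.
  rewrite /e !rmorphM.
  have -> : g u * g v - f u * f v = g u * (g v - f v) + f v * (g u - f u).
    by rewrite !mulrBr addrA [f v * g u]mulrC subrK [f v * _]mulrC.
  rewrite cD; [|exact/ideal_powMl/IHs|exact/ideal_powMl/IHs].
  by rewrite !cM; [rewrite !res_chom [e j u * _]mulrC|exact: IHs|exact: IHs].
have eZ j a u : e j (a *: u) = a * e j u.
  by rewrite /e !chomZ -scalerBr -mulr_algl cM ?res_alg //; exact: IHs.
have e1 j : e j 1 = 0 by rewrite /e !rmorph1 subrr c0 //; exact: ideal_pow0.
(* The flag [eps] selects the map given by the derivation [e j] or the constant one, whose
   comparison shows that [e j] vanishes. *)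
have hom j (eps : bool) : exists h : chom R (dual_numbers k),
    h =1 fun u => Dual (res u) (if eps then e j u else 0).
  apply: chom_of_fun => [u v|u v|a u||u]; last by [].
  - by apply: dual_ext; rewrite /= ?resD //; case: eps; rewrite ?addr0 ?eD.
  - by apply: dual_ext; rewrite /= ?resM //; case: eps; rewrite ?mulr0 ?mul0r ?addr0 ?eM.
  - by apply: dual_ext; rewrite /= ?resZ //; case: eps; rewrite ?mulr0 ?eZ.
  - by apply: dual_ext; rewrite /= ?res1 //; case: eps; rewrite ?e1.
suff e0 j u : e j u = 0.
  have := cE _ (IHs r); rewrite big1 ?subr0 // => j _.
  by rewrite -/(e j r) e0 scale0r.
have [h hE] := hom j true; have [h0 h0E] := hom j false.
suff /tangent_inj/(_ u) : strict_eq (fun l => map_mx h0 (rho l)) (fun l => map_mx h (rho l)).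
  by rewrite hE h0E => -[].
(* Since Y commutes with f [rho], (g [rho] - f [rho]) X is the commutator of X - Y with f [rho]; its
   coefficients say that 1 + Z e conjugates the constant deformation into the one induced by [h]. *)
pose Z := map_mx (c j) (X - Y).
exists (dual_mx 1%:M Z); rewrite dual_mx_res; split=> // l.
have -> : map_mx h0 (rho l) = dual_mx (rho0 l) 0.
  by case: hrho => _ <-; apply/matrixP => i i'; rewrite !mxE h0E.
pose E := map_mx (c j) (map_mx g (rho l) - map_mx f (rho l)).
have -> : map_mx h (rho l) = dual_mx (rho0 l) E.
  by case: hrho => _ <-; apply/matrixP => i i'; rewrite !mxE hE.
rewrite !dual_mxM mul1mx !mulmx1 mulmx0 add0r; congr dual_mx.
case: hf => _ hf; case: hg => _ hg.
have hE' : mxpow s.+1 (map_mx g (rho l) - map_mx f (rho l)).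
  by move=> i i'; rewrite !mxE; exact: IHs.
have := coef_mxMl cD cM c0 j X hE'; rewrite X1 mulmx1 -/E => <-.
have -> : (map_mx g (rho l) - map_mx f (rho l)) *m X =
    (X - Y) *m map_mx f (rho l) - map_mx f (rho l) *m (X - Y).
  by rewrite mulmxBl -hX mulmxBl mulmxBr cY opprB addrA subrK.
rewrite (coef_mxB cD cM); [|exact: mxpowMl|exact: mxpowMr].
by rewrite (coef_mxMl cD cM c0) // (coef_mxMr cD cM c0) // hf addrCA subrr addr0.
Qed.

End Injectivity.

(** * Natural bijections between the lifts of two representations *)

Section Linked.

Context (k : fieldType) (L : falgType k).

(* A natural bijection between the strict equivalence classes of lifts of rho0
   and of sigma0, given as a relation between lifts. *)
Definition linked m n (rho0 : L -> 'M[k]_m) (sigma0 : L -> 'M[k]_n) : Prop :=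
  exists E : forall A : cobj k, (L -> 'M[A]_m) -> (L -> 'M[A]_n) -> Prop,
  [/\ forall A rho sigma, E A rho sigma -> mlift rho0 rho /\ mlift sigma0 sigma,
      forall A rho, mlift rho0 rho -> exists sigma, E A rho sigma,
      forall A sigma, mlift sigma0 sigma -> exists rho, E A rho sigma,
      forall A rho sigma rho' sigma', E A rho sigma -> E A rho' sigma' ->
        (strict_eq rho rho' <-> strict_eq sigma sigma')
    & forall A B (f : chom A B) rho sigma, E A rho sigma ->
        E B (fun l => map_mx f (rho l)) (fun l => map_mx f (sigma l))].

Lemma linked_sym m n (rho0 : L -> 'M[k]_m) (sigma0 : L -> 'M[k]_n) :
  linked rho0 sigma0 -> linked sigma0 rho0.
Proof.
move=> [E [E1 E2 E3 E4 E5]]; exists (fun A s r => E A r s); split=> //.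
- by move=> A s r /E1[].
- by move=> A s r s' r' h h'; split=> /(E4 _ _ _ _ _ h h').
- by move=> A B f s r; exact: E5.
Qed.

Lemma linked_trans m n p (rho0 : L -> 'M[k]_m) (sigma0 : L -> 'M[k]_n)
    (tau0 : L -> 'M[k]_p) :
  linked rho0 sigma0 -> linked sigma0 tau0 -> linked rho0 tau0.
Proof.
move=> [E [E1 E2 E3 E4 E5]] [F [F1 F2 F3 F4 F5]].
exists (fun A r t => exists s, E A r s /\ F A s t); split.
- by move=> A r t [s [/E1[hr _] /F1[_ ht]]].
- by move=> A r /E2[s Es]; have [_ /F2[t Ft]] := E1 _ _ _ Es; exists t, s.
- by move=> A t /F3[s Fs]; have [/E3[r Er] _] := F1 _ _ _ Fs; exists r, s.
- move=> A r t r' t' [s [Ers Fst]] [s' [Ers' Fst']].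
  exact: iff_trans (E4 _ _ _ _ _ Ers Ers') (F4 _ _ _ _ _ Fst Fst').
- move=> A B f r t [s [Ers Fst]]; exists (fun l => map_mx f (s l)).
  by split; [exact: E5 | exact: F5].
Qed.

(** * Extensions whose middle term is projective *)

Section Exact.

Context (d : nat) (x y : 'I_d -> L) (b : L -> L -> k).
Hypothesis xyb : dual_bases x y b.

(* By Higman's criterion, this is projectivity of the module given by tau0. *)
Definition trace_projective n (tau0 : L -> 'M[k]_n) : Prop :=
  exists g, htr x y tau0 tau0 g = 1%:M.

Context (w v : nat) (sigma0 : L -> 'M[k]_w) (beta0 : L -> 'M[k]_(w, v)).
Context (rho0 : L -> 'M[k]_v).

(** Matrices act on columns, so [sigma] is the subrepresentation, [rho] the quotient and [beta] the
    cocycle of the extension. *)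
Definition ext_rep (A : cobj k) (sigma : L -> 'M[A]_w) (beta : L -> 'M[A]_(w, v))
    (rho : L -> 'M[A]_v) (l : L) : 'M[A]_(w + v) :=
  block_mx (sigma l) (beta l) 0 (rho l).

Definition ext_rep0 (l : L) : 'M[k]_(w + v) := block_mx (sigma0 l) (beta0 l) 0 (rho0 l).

Hypothesis ext_is_rep : is_rep idfun ext_rep0.
Hypothesis ext_proj : trace_projective ext_rep0.

Lemma block_inj (A : comNzRingType) (X X' : 'M[A]_w) (Y Y' : 'M[A]_(w, v)) Z Z' (T T' : 'M[A]_v) :
  block_mx X Y Z T = block_mx X' Y' Z' T' -> [/\ X = X', Y = Y', Z = Z' & T = T'].
Proof.
by move=> E; split; [have := congr1 ulsubmx E | have := congr1 ursubmx E
  | have := congr1 dlsubmx E | have := congr1 drsubmx E];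
  rewrite ?block_mxKul ?block_mxKur ?block_mxKdl ?block_mxKdr.
Qed.

Lemma ext_mlift (A : cobj k) sigma beta rho :
  mlift ext_rep0 (@ext_rep A sigma beta rho) -> mlift sigma0 sigma /\ mlift rho0 rho.
Proof.
move=> [[El E1 EM] E0].
have {}El c l l' : [/\ sigma (c *: l + l') = c%:A *: sigma l + sigma l' &
    rho (c *: l + l') = c%:A *: rho l + rho l'].
  have := El c l l'; rewrite /ext_rep scale_block_mx add_block_mx.
  by case/block_inj.
have {}EM l l' : [/\ sigma (l * l') = sigma l *m sigma l' & rho (l * l') = rho l *m rho l'].
  have := EM l l'; rewrite /ext_rep mulmx_block !mulmx0 !mul0mx !addr0 !add0r.
  by case/block_inj.
have {}E0 l : [/\ map_mx (@res k A) (sigma l) = sigma0 l & map_mx (@res k A) (rho l) = rho0 l].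
  by have := E0 l; rewrite /ext_rep /ext_rep0 map_block_mx; case/block_inj.
move: E1; rewrite /ext_rep scalar_mx_block => /block_inj[s1 _ _ r1].
split; split; try (split=> //).
- by move=> c l l'; case: (El c l l').
- by move=> l l'; case: (EM l l').
- by move=> l; case: (E0 l).
- by move=> c l l'; case: (El c l l').
- by move=> l l'; case: (EM l l').
- by move=> l; case: (E0 l).
Qed.

Lemma ext_rep_dl0 (A : cobj k) (tau : L -> 'M[A]_(w + v)) :
  (forall l, dlsubmx (tau l) = 0) ->
  exists sigma beta rho, tau = @ext_rep A sigma beta rho.
Proof.
move=> h; exists (fun l => ulsubmx (tau l)), (fun l => ursubmx (tau l)), (fun l => drsubmx (tau l)).
by apply/funext => l; rewrite /ext_rep -(h l) submxK.
Qed.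

Lemma const_mlift (A : cobj k) n (tau0 : L -> 'M[k]_n) : is_rep idfun tau0 ->
  mlift tau0 (fun l => map_mx (in_alg A) (tau0 l)).
Proof.
move=> [tl t1 tM]; split; first split.
- by move=> c l l'; rewrite tl map_mxD map_mxZ.
- by rewrite t1 map_mx1.
- by move=> l l'; rewrite tM map_mxM.
by move=> l; exact: map_res_alg.
Qed.

Lemma conj_mlift (A : cobj k) n (tau0 : L -> 'M[k]_n) (tau : L -> 'M[A]_n) (X Y : 'M[A]_n) :
  map_mx (@res k A) X = 1%:M -> X *m Y = 1%:M -> Y *m X = 1%:M ->
  mlift tau0 tau -> mlift tau0 (fun l => X *m tau l *m Y).
Proof.
move=> X1 XY YX [[tl t1 tM] t0]; split; first split.
- by move=> c l l'; rewrite tl mulmxDr mulmxDl -scalemxAr -scalemxAl.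
- by rewrite t1 mulmx1.
- by move=> l l'; rewrite tM !mulmxA -[_ *m Y *m X]mulmxA YX mulmx1.
move=> l; rewrite !map_mxM X1 mul1mx t0 -[map_mx _ Y]mul1mx -X1 -map_mxM XY map_mx1.
exact: mulmx1.
Qed.

(** The constant lift of the middle term maps to [rho]: the trace of [p0] times [g] is an
    intertwiner, and it reduces to [p0] times the trace of [g], that is to [p0]. A change of basis
    then turns it into the standard projection. *)
Lemma ext_rep_ex_sub (A : cobj k) rho : mlift rho0 rho ->
  exists sigma beta, mlift ext_rep0 (@ext_rep A sigma beta rho).
Proof.
move=> hr; have [g gP] := ext_proj; have ht := const_mlift A ext_is_rep.
set tau := fun l => _ in ht.
pose p0 : 'M[k]_(v, w + v) := row_mx 0 1%:M.
have p0E l : p0 *m ext_rep0 l = rho0 l *m p0.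
  by rewrite mul_row_block mul_mx_row !mul0mx !mul1mx !mulmx0 mulmx1 !add0r.
pose p := htr x y rho tau (map_mx (in_alg A) (p0 *m g)).
have pE l : rho l *m p = p *m tau l.
  by apply: (htr_intertwine xyb _ _ _ _ (iota := in_alg A)); [case: hr | case: ht].
have p_res : map_mx (@res k A) p = p0.
  rewrite map_htr map_res_alg (eq_htr (rho' := ext_rep0) _ _ _ (proj2 hr)).
    by rewrite -(htr_mull _ _ _ _ p0E) gP mulmx1.
  by move=> l; exact: map_res_alg.
(* The rows of [p] are completed to a matrix of residue 1; in the new coordinates the last v rows of
   the representation are those of a quotient [rho]. *)
pose X : 'M[A]_(w + v) := col_mx (row_mx 1%:M 0) p.
have X1 : map_mx (@res k A) X = 1%:M.
  by rewrite map_col_mx p_res map_row_mx map_mx1 map_mx0 scalar_mx_block.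
have [Y [XY YX _]] := res1_mx_inv X1; have := conj_mlift X1 XY YX ht.
set tau' := fun l => _ => ht'.
have E l : dsubmx (tau' l) = rho l *m row_mx 0 1%:M.
  rewrite /tau' !mul_col_mx col_mxKd -pE -mulmxA; congr (_ *m _).
  have := congr1 dsubmx XY; rewrite mul_col_mx col_mxKd scalar_mx_block.
  by rewrite /block_mx col_mxKd.
have [l|sigma [beta [rho' tE]]] := @ext_rep_dl0 A tau'.
  by rewrite /dlsubmx E mul_mx_row row_mxKl mulmx0.
exists sigma, beta; suff <- : rho' = rho by rewrite -tE.
apply/funext => l; have := E l; rewrite tE /ext_rep /block_mx col_mxKd mul_mx_row.
by rewrite mulmx0 mulmx1 => /eq_row_mx[].
Qed.

(** Dual to [ext_rep_ex_sub]: the inclusion is averaged into a map from [sigma] to the constant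
    lift. That maps into a projective module lift in this way reflects the self-injectivity of a
    Frobenius algebra. *)
Lemma ext_rep_ex_quo (A : cobj k) sigma : mlift sigma0 sigma ->
  exists rho beta, mlift ext_rep0 (@ext_rep A sigma beta rho).
Proof.
move=> hs; have [g gP] := ext_proj; have ht := const_mlift A ext_is_rep.
set tau := fun l => _ in ht.
pose j0 : 'M[k]_(w + v, w) := col_mx 1%:M 0.
have j0E l : ext_rep0 l *m j0 = j0 *m sigma0 l.
  by rewrite mul_block_col mul_col_mx !mulmx0 mulmx1 !mul0mx mul1mx !addr0.
pose j := htr x y tau sigma (map_mx (in_alg A) (g *m j0)).
have jE l : tau l *m j = j *m sigma l.
  by apply: (htr_intertwine xyb _ _ _ _ (iota := in_alg A)); [case: ht | case: hs].
have j_res : map_mx (@res k A) j = j0.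
  rewrite map_htr map_res_alg (eq_htr (sigma' := ext_rep0) (rho' := sigma0) _ _ _ _ (proj2 hs)).
    by rewrite -(htr_mulr _ _ _ _ j0E) gP mul1mx.
  by move=> l; exact: map_res_alg.
pose X : 'M[A]_(w + v) := row_mx j (col_mx 0 1%:M).
have X1 : map_mx (@res k A) X = 1%:M.
  rewrite map_row_mx j_res map_col_mx map_mx1 map_mx0 scalar_mx_block.
  by rewrite block_mxEh.
have [Y [XY YX Y1]] := res1_mx_inv X1; have := conj_mlift Y1 YX XY ht.
set tau' := fun l => _ => ht'.
have E l : lsubmx (tau' l) = col_mx 1%:M 0 *m sigma l.
  rewrite /tau' mul_mx_row row_mxKl -mulmxA jE mulmxA; congr (_ *m _).
  have := congr1 lsubmx YX; rewrite mul_mx_row row_mxKl scalar_mx_block.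
  by rewrite block_mxEh row_mxKl.
have [l|sigma' [beta [rho tE]]] := @ext_rep_dl0 A tau'.
  have := congr1 dsubmx (E l); rewrite mul_col_mx mul0mx col_mxKd => <-.
  by rewrite /dlsubmx; apply/matrixP => i i'; rewrite !mxE.
exists rho, beta; suff <- : sigma' = sigma by rewrite -tE.
apply/funext => l; have := E l; rewrite tE /ext_rep block_mxEh row_mxKl mul_col_mx.
by rewrite mul0mx mul1mx => /eq_col_mx[].
Qed.

(** The trace u of the constant matrix [g0] commutes with [tau] and has residue 1, so it is
    invertible; the trace of u^-1 [g0] is then u^-1 u = 1. *)
Lemma trace_projective_lift (A : cobj k) n (tau0 : L -> 'M[k]_n) (tau : L -> 'M[A]_n) :
  trace_projective tau0 -> mlift tau0 tau ->
  exists g, htr x y tau tau g = 1%:M.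
Proof.
move=> [g0 g0P] [tr t0].
pose u := htr x y tau tau (map_mx (in_alg A) g0).
have u1 : map_mx (@res k A) u = 1%:M.
  by rewrite map_htr (eq_htr _ _ _ t0 t0) map_res_alg.
have uE l : tau l *m u = u *m tau l by exact: (htr_intertwine (iota := in_alg A) xyb).
have [z [uz zu _]] := res1_mx_inv u1; exists (z *m map_mx (in_alg A) g0).
rewrite -(htr_mull _ _ _ _ (sigma := tau)) // => l.
by rewrite -[LHS]mulmx1 -uz !mulmxA -[z *m _ *m u]mulmxA uE !mulmxA zu mul1mx.
Qed.

(** As in the comparison of two projective resolutions, the conjugation of the quotients is lifted
    to the middle terms; the lift is block triangular and its upper left block conjugates the
    subrepresentations. *)
Lemma ext_rep_sub_inj (A : cobj k) sigma beta rho sigma' beta' rho' :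
  mlift ext_rep0 (@ext_rep A sigma beta rho) ->
  mlift ext_rep0 (@ext_rep A sigma' beta' rho') ->
  strict_eq rho rho' -> strict_eq sigma sigma'.
Proof.
set tau := ext_rep _ _ _; set tau' := ext_rep _ _ _ => ht ht' [X0 [X01 hX0]].
have [g gP] := trace_projective_lift ext_proj ht.
pose p : 'M[A]_(v, w + v) := row_mx 0 1%:M.
have pE l : p *m tau l = rho l *m p.
  by rewrite mul_row_block mul_mx_row !mul0mx !mul1mx !mulmx0 mulmx1 !add0r.
have pE' l : p *m tau' l = rho' l *m p.
  by rewrite mul_row_block mul_mx_row !mul0mx !mul1mx !mulmx0 mulmx1 !add0r.
pose Y : 'M[A]_(w + v) := block_mx 1%:M 0 0 X0.
have pY : p *m Y = X0 *m p.
  by rewrite mul_row_block mul_mx_row !mul0mx !mul1mx !mulmx0 mulmx1 !add0r.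
have Y1 : map_mx (@res k A) Y = 1%:M.
  by rewrite map_block_mx map_mx1 !map_mx0 X01 scalar_mx_block.
(* Y is a bare matrix over [X0] with residue 1. Averaging it against [g] gives an intertwiner that
   still induces [X0] on the quotients, and whose residue is the trace of the residue of [g], namely
   1. *)
pose X := htr x y tau' tau (Y *m g).
have XE l : X *m tau l = tau' l *m X.
  by rewrite (htr_intertwine (iota := in_alg A) xyb _ _ (proj1 ht') (proj1 ht)).
have X1 : map_mx (@res k A) X = 1%:M.
  have := congr1 (map_mx (@res k A)) gP; rewrite !map_htr map_mxM Y1 mul1mx map_mx1.
  by rewrite !(eq_htr _ _ _ (proj2 ht) (proj2 ht)) (eq_htr _ _ _ (proj2 ht') (proj2 ht)).
have pX : p *m X = X0 *m p.
  rewrite (htr_mull _ _ _ _ pE') mulmxA pY -mulmxA -(htr_mull _ _ _ _ (sigma := rho) hX0).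
  by rewrite -(htr_mull _ _ _ _ pE) gP mulmx1.
have XD : X = block_mx (ulsubmx X) (ursubmx X) 0 X0.
  rewrite -{1}[X]submxK; move: pX; rewrite -{1}[X]submxK mul_row_block mul_mx_row.
  by rewrite !mul0mx !mul1mx !add0r mulmx0 mulmx1 => /eq_row_mx[-> ->].
exists (ulsubmx X); split=> [|l].
  by move: X1; rewrite {1}XD map_block_mx scalar_mx_block => /block_inj[].
have := XE l; rewrite XD /tau /tau' /ext_rep !mulmx_block => /block_inj[+ _ _ _].
by rewrite block_mxKul !mulmx0 !addr0.
Qed.

(** Dual to [ext_rep_sub_inj]: the conjugation is extended from the subrepresentations, so [g] now
    belongs to the target [tau'] and multiplies on the left. *)
Lemma ext_rep_quo_inj (A : cobj k) sigma beta rho sigma' beta' rho' :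
  mlift ext_rep0 (@ext_rep A sigma beta rho) ->
  mlift ext_rep0 (@ext_rep A sigma' beta' rho') ->
  strict_eq sigma sigma' -> strict_eq rho rho'.
Proof.
set tau := ext_rep _ _ _; set tau' := ext_rep _ _ _ => ht ht' [X0 [X01 hX0]].
have [g gP] := trace_projective_lift ext_proj ht'.
pose j : 'M[A]_(w + v, w) := col_mx 1%:M 0.
have jE l : tau l *m j = j *m sigma l.
  by rewrite mul_block_col mul_col_mx !mulmx0 mulmx1 !mul0mx mul1mx !addr0.
have jE' l : tau' l *m j = j *m sigma' l.
  by rewrite mul_block_col mul_col_mx !mulmx0 mulmx1 !mul0mx mul1mx !addr0.
pose Y : 'M[A]_(w + v) := block_mx X0 0 0 1%:M.
have Yj : Y *m j = j *m X0.
  by rewrite mul_block_col mul_col_mx !mulmx0 mulmx1 !mul0mx mul1mx !addr0.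
have Y1 : map_mx (@res k A) Y = 1%:M.
  by rewrite map_block_mx map_mx1 !map_mx0 X01 scalar_mx_block.
pose X := htr x y tau' tau (g *m Y).
have XE l : X *m tau l = tau' l *m X.
  by rewrite (htr_intertwine (iota := in_alg A) xyb _ _ (proj1 ht') (proj1 ht)).
have X1 : map_mx (@res k A) X = 1%:M.
  have := congr1 (map_mx (@res k A)) gP; rewrite !map_htr map_mxM Y1 mulmx1 map_mx1.
  by rewrite !(eq_htr _ _ _ (proj2 ht') (proj2 ht')) (eq_htr _ _ _ (proj2 ht') (proj2 ht)).
have Xj : X *m j = j *m X0.
  rewrite (htr_mulr _ _ _ _ jE) -mulmxA Yj mulmxA -(htr_mulr _ _ _ _ (fun l => esym (hX0 l))) //.
  by rewrite -(htr_mulr _ _ _ _ jE') gP mul1mx.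
have XD : X = block_mx X0 (ursubmx X) 0 (drsubmx X).
  rewrite -{1}[X]submxK; move: Xj; rewrite -{1}[X]submxK mul_block_col mul_col_mx.
  by rewrite !mulmx0 !mulmx1 !addr0 mul0mx mul1mx => /eq_col_mx[-> ->].
exists (drsubmx X); split=> [|l].
  by move: X1; rewrite {1}XD map_block_mx scalar_mx_block => /block_inj[].
have := XE l; rewrite XD /tau /tau' /ext_rep !mulmx_block => /block_inj[_ _ _].
by rewrite block_mxKdr !mul0mx !add0r.
Qed.

Lemma linked_ext : linked rho0 sigma0.
Proof.
exists (fun A rho sigma => exists beta, mlift ext_rep0 (@ext_rep A sigma beta rho)).
split.
- by move=> A rho sigma [beta /ext_mlift[]].
- by move=> A rho /ext_rep_ex_sub[sigma [beta h]]; exists sigma, beta.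
- by move=> A sigma /ext_rep_ex_quo[rho [beta h]]; exists rho, beta.
- move=> A rho sigma rho' sigma' [beta h] [beta' h'].
  by split; [exact: ext_rep_sub_inj h h' | exact: ext_rep_quo_inj h h'].
- move=> A B f rho sigma [beta /(mlift_chom f) h]; exists (fun l => map_mx f (beta l)).
  by move: h; under eq_fun do rewrite map_block_mx map_mx0.
Qed.

End Exact.

End Linked.

(** * Subspaces of a finite dimensional space given by predicates *)

Section Subspaces.

Context (k : fieldType).

(** A matrix of maximal rank with row space inside P spans P, since a further vector of P would
    raise the rank. *)
Lemma subspace_mx N (P : 'rV[k]_N -> Prop) : P 0 ->
  (forall c u v, P u -> P v -> P (c *: u + v)) ->
  exists U : 'M[k]_N, forall u, P u <-> (u <= U)%MS.
Proof.
move=> P0 PD; pose Q r := `[< exists U : 'M[k]_N, \rank U = r /\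
  forall u, (u <= U)%MS -> P u >].
have exQ : exists r, Q r.
  by exists 0; apply/asboolP; exists 0; rewrite mxrank0; split=> // u; rewrite submx0 => /eqP ->.
have bQ r : Q r -> (r <= N)%N by move=> /asboolP[U [<- _]]; exact: rank_leq_row.
case: (ex_maxnP exQ bQ) => r /asboolP[U [Ur UP]] rmax; exists U => u; split; last exact: UP.
move=> Pu; apply/negPn/negP => nu.
suff /rmax : Q (\rank (U + u)%MS).
  rewrite leqNgt -Ur => /negP; apply; rewrite ltn_neqAle mxrankS ?addsmxSl // andbT.
  apply/eqP => /esym e; case/negP: nu.
  have := mxrank_leqif_sup (addsmxSl U u); rewrite /leqif => -[_].
  by rewrite e eqxx => /esym; exact/submx_trans/addsmxSr.
apply/asboolP; exists (U + u)%MS; split=> // x /sub_addsmxP[[a b] /= ->].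
rewrite addrC [b]mx11_scalar mul_scalar_mx; apply: PD => //.
by apply: UP; exact: submxMl.
Qed.

Lemma subspace_dcc N (P : nat -> 'rV[k]_N -> Prop) : (forall i, P i 0) ->
  (forall i c u v, P i u -> P i v -> P i (c *: u + v)) ->
  (forall i u, P i.+1 u -> P i u) ->
  exists i, forall j, (i <= j)%N -> forall u, P i u -> P j u.
Proof.
move=> P0 PD Pdec; have [U UE] := choice (fun i => subspace_mx (P0 i) (PD i)).
have dec i j u : (i <= j)%N -> P j u -> P i u.
  by move=> /subnK <-; elim: (j - i)%N => // e IHe h; exact/IHe/Pdec.
have exr : exists r, `[< exists i, \rank (U i) = r >].
  by exists (\rank (U 0)); apply/asboolP; exists 0%N.
case: (ex_minnP exr) => r /asboolP[i ri] rmin; exists i => j ij u /UE ui; apply/UE.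
have Uji : (U j <= U i)%MS.
  by apply/row_subP => a; apply/UE/(dec _ _ _ ij)/UE/row_sub.
apply: submx_trans ui _; have [h <-] := mxrank_leqif_sup Uji.
by rewrite eqn_leq h ri rmin //; apply/asboolP; exists j.
Qed.

End Subspaces.

(** * The Artinian quotients A/m^(s+1) *)

Section Truncation.

Context (k : fieldType) (A : cobj k) (s : nat).

(** The exponent is [s.+1] so that the quotient is nonzero, with residue field k, for every [s]. *)
Definition trunc_ideal : pred A := fun x => `[< mpow A s.+1 x >].

Lemma trunc_ideal_closed : idealr_closed trunc_ideal.
Proof.
split=> [||a x y /asboolP hx /asboolP hy].
- by apply/asboolP; exact: ideal_pow0.
- apply/negP => /asboolP /(@ideal_pow_le _ _ 1 s.+1 _ isT) /mpow1.
  by rewrite res1; apply/eqP; rewrite oner_eq0.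
- by apply/asboolP/ideal_powD => //; exact: ideal_powMl.
Qed.

HB.instance Definition _ := isIdealr.Build A trunc_ideal trunc_ideal_closed.

Definition trunc := {ideal_quot (trunc_ideal : idealr A)}.

HB.instance Definition _ := GRing.ComNzRing.on trunc.

Definition tpi (x : A) : trunc := (\pi_trunc x)%qT.

Lemma tpiD : {morph tpi : x y / x + y}. Proof. exact: Quotient.pi_add. Qed.
Lemma tpiM : {morph tpi : x y / x * y}. Proof. exact: Quotient.pi_mul. Qed.
Lemma tpi1 : tpi 1 = 1. Proof. by rewrite /tpi piE. Qed.
Lemma tpi0 : tpi 0 = 0. Proof. by rewrite /tpi piE. Qed.

Lemma tpiP x y : tpi x = tpi y <-> mpow A s.+1 (x - y).
Proof.
split=> [/eqP|h]; first by rewrite /tpi -Quotient.idealrBE => /asboolP.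
by apply/eqP; rewrite /tpi -Quotient.idealrBE; apply/asboolP.
Qed.

Lemma tpi_ind (P : trunc -> Prop) : (forall x, P (tpi x)) -> forall x, P x.
Proof. by move=> h x; rewrite -[x]reprK; exact: h. Qed.

Definition trunc_scale (c : k) (x : trunc) : trunc := tpi c%:A * x.

Lemma trunc_scaleE c x : trunc_scale c (tpi x) = tpi (c *: x).
Proof. by rewrite /trunc_scale -tpiM mulr_algl. Qed.

Lemma trunc_scaleA c d x : trunc_scale c (trunc_scale d x) = trunc_scale (c * d) x.
Proof. by elim/tpi_ind: x => x; rewrite !trunc_scaleE scalerA. Qed.
Lemma trunc_scale1 : left_id 1 trunc_scale.
Proof. by elim/tpi_ind => x; rewrite trunc_scaleE scale1r. Qed.
Lemma trunc_scaleDr : right_distributive trunc_scale +%R.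
Proof. by move=> c x y; rewrite /trunc_scale mulrDr. Qed.
Lemma trunc_scaleDl x : {morph trunc_scale^~ x : c d / c + d}.
Proof. by move=> c d; rewrite /trunc_scale scalerDl tpiD mulrDl. Qed.

HB.instance Definition _ := GRing.Zmodule_isLmodule.Build k trunc
  trunc_scaleA trunc_scale1 trunc_scaleDr trunc_scaleDl.

Lemma tpiZ c x : tpi (c *: x) = c *: tpi x.
Proof. by rewrite -trunc_scaleE. Qed.

Lemma trunc_scaleAl (c : k) (x y : trunc) : c *: (x * y) = (c *: x) * y.
Proof. exact: mulrA. Qed.

HB.instance Definition _ := GRing.Lmodule_isLalgebra.Build k trunc trunc_scaleAl.

Lemma trunc_scaleAr (c : k) (x y : trunc) : c *: (x * y) = x * (c *: y).
Proof. exact: mulrCA. Qed.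

HB.instance Definition _ := GRing.Lalgebra_isAlgebra.Build k trunc trunc_scaleAr.

Definition trunc_res (x : trunc) : k^o := res (repr x).

Lemma trunc_resE x : trunc_res (tpi x) = res x.
Proof.
suff /mpow1 : mpow A 1 (repr (tpi x) - x).
  by rewrite resB => /eqP; rewrite subr_eq0 => /eqP.
by apply: (@ideal_pow_le _ _ 1 s.+1) => //; apply/tpiP; rewrite /tpi reprK.
Qed.

Lemma trunc_res_linear : linear trunc_res.
Proof.
move=> c; elim/tpi_ind=> x; elim/tpi_ind=> y.
by rewrite -tpiZ -tpiD !trunc_resE resD resZ.
Qed.

Lemma trunc_res_monoid : monoid_morphism trunc_res.
Proof.
split; first by rewrite -tpi1 trunc_resE res1.
by elim/tpi_ind=> x; elim/tpi_ind=> y; rewrite -tpiM !trunc_resE resM.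
Qed.

HB.instance Definition _ :=
  GRing.isLinear.Build k trunc k^o _ trunc_res trunc_res_linear.
HB.instance Definition _ :=
  GRing.isMonoidMorphism.Build trunc k^o trunc_res trunc_res_monoid.

Lemma tpi_zmod : zmod_morphism tpi.
Proof. by move=> x y; rewrite tpiD -scaleN1r tpiZ scaleN1r. Qed.
Lemma tpi_monoid : monoid_morphism tpi.
Proof. by split; [exact: tpi1 | exact: tpiM]. Qed.

HB.instance Definition _ := GRing.isZmodMorphism.Build A trunc tpi tpi_zmod.
HB.instance Definition _ := GRing.isMonoidMorphism.Build A trunc tpi tpi_monoid.

Let tmax (x : trunc) : Prop := trunc_res x = 0.

Lemma trunc_pow n x : ideal_pow tmax n x -> exists2 a, mpow A n a & tpi a = x.
Proof.
move=> [l [hl ->]].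
pose lift (p : trunc * n.-tuple trunc) := (repr p.1, [tuple repr (tnth p.2 i) | i < n]).
exists (\sum_(p <- map lift l) p.1 * \prod_(i < n) tnth p.2 i).
  exists (map lift l); split=> // _ /mapP[p /hl hp ->] i.
  by rewrite tnth_mktuple; exact: hp.
rewrite big_map raddf_sum; apply: eq_bigr => p _; rewrite /= tpiM rmorph_prod /tpi reprK.
by congr (_ * _); apply: eq_bigr => i _; rewrite tnth_mktuple /= /tpi reprK.
Qed.

Lemma trunc_pow_nil x : ideal_pow tmax s.+1 x -> x = 0.
Proof. by move=> /trunc_pow[a ha <-]; rewrite -tpi0; apply/tpiP; rewrite subr0. Qed.

Lemma trunc_tmax_ideal : ideal tmax.
Proof.
split=> [|x y hx hy|a x hx]; rewrite /tmax ?rmorph0 //.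
  by rewrite rmorphD /= hx hy addr0.
by rewrite rmorphM /= hx mulr0.
Qed.

Lemma trunc_ideal1 (I : trunc -> Prop) x : ideal I -> I x -> trunc_res x <> 0 -> I 1.
Proof.
move=> [_ _ IM]; elim/tpi_ind: x => x Ix; rewrite trunc_resE => /eqP/res_inv[y xy].
by rewrite -tpi1 -xy mulrC tpiM; exact: IM.
Qed.

Lemma trunc_local (I : trunc -> Prop) :
  maximal_ideal I <-> forall x, I x <-> trunc_res x = 0.
Proof.
have sub (J : trunc -> Prop) : ideal J -> ~ J 1 -> forall x, J x -> trunc_res x = 0.
  by move=> iJ J1 x Jx; apply: contrapT => nz; apply/J1/(trunc_ideal1 iJ Jx nz).
have res1 : trunc_res 1 <> 0 by rewrite rmorph1; apply/eqP; rewrite oner_eq0.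
split=> [[iI I1 Imax] x|IE].
  split; first exact: sub.
  exact: (Imax _ trunc_tmax_ideal res1 (sub _ iI I1)).
have {}IE : I = tmax by apply/funext => x; apply/propext.
by rewrite IE; split=> [||J iJ J1 _]; [exact: trunc_tmax_ideal | exact: res1 | exact: sub].
Qed.

Lemma trunc_noetherian : noetherian trunc.
Proof.
move=> I [I0 ID IM]; pose J a := I (tpi a).
have [|g hg] := @cobj_noetherian k A J.
  split=> [|x y hx hy|a x hx]; rewrite /J ?tpi0 ?tpiD ?tpiM //; first exact: ID.
  exact: IM.
have gE i (h : (i < size (map tpi g))%N) : (map tpi g)`_i = tpi g`_i.
  by rewrite (nth_map 0) -?(size_map tpi).
exists (map tpi g) => x; elim/tpi_ind: x => x; rewrite -[I _]/(J x); split.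
  move=> /hg[c ->]; exists (fun i => tpi (c (cast_ord (size_map tpi g) i))).
  rewrite raddf_sum /= (reindex (cast_ord (size_map tpi g))) /=; last first.
    by exists (cast_ord (esym (size_map tpi g))) => i _; rewrite ?cast_ordK ?cast_ordKV.
  by apply: eq_bigr => i _; rewrite tpiM gE.
rewrite /J => -[c ->]; apply: (big_ind I) => // i _; apply: IM; rewrite gE // -/(J _).
have hi : (i < size g)%N by rewrite -(size_map tpi).
apply/hg; exists (fun j => (j == Ordinal hi)%:R).
rewrite (bigD1 (Ordinal hi)) //= eqxx mul1r big1 ?addr0 // => j /negPf ->.
by rewrite mul0r.
Qed.

(** The power [s.+1] of the maximal ideal vanishes, so a Cauchy sequence is constant from the index
    [s.+1] on. *)
Lemma trunc_complete : adic_complete tmax.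
Proof.
split=> [x h|u hu]; first exact: trunc_pow_nil (h s.+1).
have stab n : u (n + s.+1)%N = u s.+1.
  elim: n => // n <-; apply/eqP; rewrite -subr_eq0 addSn; apply/eqP/trunc_pow_nil.
  by apply: ideal_pow_le (hu _); rewrite leq_addl.
have early n m : ideal_pow tmax n (u (m + n)%N - u n).
  elim: m => [|m IHm]; first by rewrite subrr; exact: ideal_pow0.
  rewrite addSn -(subrKA (u (m + n)%N)); apply: ideal_powD => //.
  by apply: ideal_pow_le (hu _); rewrite leq_addl.
exists (u s.+1) => n; rewrite -(stab n) addnC; exact: early.
Qed.

Definition trunc_cobj : cobj k :=
  @CObj k trunc trunc_res trunc_local trunc_noetherian trunc_complete.

Lemma trunc_span : exists N (z : 'I_N -> A), forall x, exists c : 'I_N -> k,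
  mpow A s.+1 (x - \sum_j c j *: z j).
Proof.
elim: s.+1 => [|n [N [z hz]]].
  by exists 0, (fun=> 0) => x; exists (fun=> 0); exact: ideal_pow_0.
have [r [t [_ tsp]]] := mpow_span A n.
exists (N + r)%N, (fun j => match split j with inl i => z i | inr i => t i end) => x.
have [c /tsp[d hd]] := hz x.
exists (fun j => match split j with inl i => c i | inr i => d i end).
rewrite big_split_ord /= opprD addrA; congr (mpow A n.+1 _): hd; congr (_ - _ - _).
  by apply: eq_bigr => i _; rewrite (unsplitK (inl i)).
by apply: eq_bigr => i _; rewrite (unsplitK (inr i)).
Qed.

(** The quotient is spanned over k by finitely many elements; ideals pull back to subspaces of k^N,
    where descending chains stop. *)
Lemma trunc_artinian : artinian trunc_cobj.
Proof.
move=> I idI Idec; have [N [z hz]] := trunc_span.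
pose e (u : 'rV[k]_N) : trunc := \sum_j u 0 j *: tpi (z j).
have eD c u v : e (c *: u + v) = c *: e u + e v.
  rewrite /e scaler_sumr -big_split; apply: eq_bigr => j _.
  by rewrite !mxE scalerDl scalerA.
have [|||i hi] := @subspace_dcc k N (fun i u => I i (e u)).
- move=> i; have -> : e 0 = 0 by rewrite /e big1 // => j _; rewrite mxE scale0r.
  by case: (idI i).
- move=> i c u v Iu Iv; rewrite eD; case: (idI i) => _ ID IM; apply: ID => //.
  exact: IM.
- by move=> i u; exact: Idec.
exists i => j ij x; elim/tpi_ind: x => x.
have [c hc] := hz x; have -> : tpi x = e (\row_l c l).
  rewrite (proj2 (tpiP _ _) hc) raddf_sum; apply: eq_bigr => l _.
  by rewrite mxE /= tpiZ.
exact: hi.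
Qed.

Lemma tpi_chom : exists q : chom A trunc_cobj, q =1 tpi.
Proof.
by apply: chom_of_fun; [exact: tpiD | exact: tpiM | exact: tpiZ | exact: tpi1 | exact: trunc_resE].
Qed.

End Truncation.

Lemma trunc_chom (k : fieldType) (A : cobj k) s :
  exists p : chom (trunc_cobj A s.+1) (trunc_cobj A s), forall x, p (tpi s.+1 x) = tpi s x.
Proof.
pose p (x : trunc A s.+1) : trunc A s := tpi s (repr x).
have pE x : p (tpi s.+1 x) = tpi s x.
  by apply/tpiP/ideal_powS/tpiP; rewrite /tpi reprK.
have [||||x|q qE] := @chom_of_fun k (trunc_cobj A s.+1) (trunc_cobj A s) p.
- by elim/tpi_ind=> x; elim/tpi_ind=> y; rewrite -tpiD !pE tpiD.
- by elim/tpi_ind=> x; elim/tpi_ind=> y; rewrite -tpiM !pE tpiM.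
- by move=> c; elim/tpi_ind=> x; rewrite -tpiZ !pE tpiZ.
- by rewrite -tpi1 pE tpi1.
- by elim/tpi_ind: x => x; rewrite pE; etransitivity; [exact: trunc_resE | rewrite [RHS]trunc_resE].
by exists q => x; rewrite qE pE.
Qed.

(** * Versality and universality for matrix representations *)

Section MatrixVersality.

Context (k : fieldType) (L : falgType k).

Definition mx_smooth n (rho0 : L -> 'M[k]_n) (R : cobj k) (rhoU : L -> 'M[R]_n) : Prop :=
  forall (A B : cobj k) (pi : chom A B) (f : chom R B) (rho : L -> 'M[A]_n),
    artinian A -> artinian B -> surjective pi -> mlift rho0 rho ->
    strict_eq (fun l => map_mx pi (rho l)) (fun l => map_mx f (rhoU l)) ->
    exists g : chom R A, (forall r, pi (g r) = f r) /\
      strict_eq (fun l => map_mx g (rhoU l)) rho.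

Definition mx_versal n (rho0 : L -> 'M[k]_n) (R : cobj k) (rhoU : L -> 'M[R]_n) : Prop :=
  [/\ mlift rho0 rhoU, mx_smooth rho0 rhoU,
      forall rho : L -> 'M[dual_numbers k]_n, mlift rho0 rho ->
        exists f : chom R (dual_numbers k), strict_eq (fun l => map_mx f (rhoU l)) rho
    & forall f g : chom R (dual_numbers k),
        strict_eq (fun l => map_mx f (rhoU l)) (fun l => map_mx g (rhoU l)) -> f =1 g].

Definition mx_universal n (rho0 : L -> 'M[k]_n) (R : cobj k) (rhoU : L -> 'M[R]_n) : Prop :=
  [/\ mlift rho0 rhoU,
      forall (A : cobj k) (rho : L -> 'M[A]_n), mlift rho0 rho ->
        exists f : chom R A, strict_eq (fun l => map_mx f (rhoU l)) rho
    & forall (A : cobj k) (f g : chom R A),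
        strict_eq (fun l => map_mx f (rhoU l)) (fun l => map_mx g (rhoU l)) -> f =1 g].

Lemma map_mx_chom_comp (R A B : cobj k) (f : chom R A) (g : chom A B) (h : chom R B) m n
    (X : 'M[R]_(m, n)) : (forall r, g (f r) = h r) -> map_mx g (map_mx f X) = map_mx h X.
Proof. by move=> E; apply/matrixP => i j; rewrite !mxE /= -E. Qed.

Section Surjectivity.

Context (d : nat) (x y : 'I_d -> L) (b : L -> L -> k).
Hypothesis xyb : dual_bases x y b.
Context (n : nat) (rho0 : L -> 'M[k]_n).
Hypothesis rho0_scalar : stably_scalar x y rho0.
Context (R : cobj k) (rhoU : L -> 'M[R]_n).
Hypothesis hU : mlift rho0 rhoU.
Hypothesis smoothU : mx_smooth rho0 rhoU.

Lemma tpi_inj (A : cobj k) (a a' : A) : (forall s, tpi s a = tpi s a') -> a = a'.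
Proof.
move=> h; apply/eqP; rewrite -subr_eq0; apply/eqP/mpow_sep => s.
exact/ideal_powS/tpiP.
Qed.

(** A is the limit of its truncations: values are found pointwise by completeness, and as
    truncations separate points the resulting map is a morphism. *)
Lemma chom_of_trunc (A : cobj k) (u : forall s, chom R (trunc_cobj A s)) :
  (forall s r a, u s.+1 r = tpi s.+1 a -> u s r = tpi s a) ->
  exists f : chom R A, forall s r, tpi s (f r) = u s r.
Proof.
move=> hu; have ex r : exists a : A, forall s, tpi s a = u s r.
  pose a s : A := repr (u s r : trunc A s).
  have aE s : tpi s (a s) = u s r by rewrite /tpi /a reprK.
  have aS s : tpi s (a s.+1) = u s r by rewrite (hu s r (a s.+1)) // aE.
  have [s|z hz] := @mpow_lim k A a; first by apply/ideal_powS/tpiP; rewrite aS aE.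
  by exists z => s; rewrite -aS; apply/tpiP.
have [F FE] := choice ex.
have [||||r|f fE] := @chom_of_fun k R A F.
- by move=> r r'; apply: tpi_inj => s; rewrite tpiD !FE rmorphD.
- by move=> r r'; apply: tpi_inj => s; rewrite tpiM !FE rmorphM.
- by move=> c r; apply: tpi_inj => s; rewrite tpiZ !FE chomZ.
- by apply: tpi_inj => s; rewrite tpi1 !FE rmorph1.
- by rewrite -(trunc_resE 0) FE; exact: (res_chom (u 0%N)).
by exists f => s r; rewrite fE FE.
Qed.

(** Smoothness lifts the map from one truncation of A to the next. Compatibility of the maps is
    ensured, that of the conjugations is not; [strict_eq_complete] repairs the latter. *)
Lemma versal_surj (A : cobj k) (rho : L -> 'M[A]_n) : mlift rho0 rho ->
  exists f : chom R A, strict_eq (fun l => map_mx f (rhoU l)) rho.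
Proof.
move=> hrho.
pose q s := projT1 (cid (tpi_chom A s)).
have qE s : q s =1 tpi s := projT2 (cid (tpi_chom A s)).
pose p s := projT1 (cid (trunc_chom A s)).
have pE s : forall a, p s (tpi s.+1 a) = tpi s a := projT2 (cid (trunc_chom A s)).
pose good s (f : chom R (trunc_cobj A s)) :=
  strict_eq (fun l => map_mx (q s) (rho l)) (fun l => map_mx f (rhoU l)).
(* Existence is turned into data, so that a fixpoint can iterate it while keeping each map
   compatible with the previous one. *)
have step s (f : {f | good s f}) :
    {f' : {f' | good s.+1 f'} | forall r, p s (sval f' r) = sval f r}.
  apply: cid; case: f => f fg /=.
  have [|||||g [gE gP]] := @smoothU _ _ (p s) f (fun l => map_mx (q s.+1) (rho l)).
  - exact: trunc_artinian.
  - exact: trunc_artinian.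
  - by elim/tpi_ind=> a; exists (tpi s.+1 a); exact: pE.
  - exact: mlift_chom.
  - move: fg; rewrite /good; congr strict_eq; apply/funext => l.
    by apply/esym/map_mx_chom_comp => a; rewrite !qE pE.
  by exists (exist _ g (strict_eq_sym gP)).
(* The bottom truncation is A/m = k, and the only morphism to it is the residue map. *)
have [f0 f0E] : exists f0 : chom R (trunc_cobj A 0), forall r, f0 r = tpi 0 (res r)%:A.
  apply: chom_of_fun => [r r'|r r'|c r||r].
  - by rewrite resD scalerDl tpiD.
  - by rewrite resM -tpiM mulr_algl scalerA.
  - by rewrite resZ -scalerA tpiZ.
  - by rewrite res1 scale1r tpi1.
  - by etransitivity; [exact: trunc_resE | exact: res_alg].
have good0 : good 0 f0.
  suff E l : map_mx (q 0) (rho l) = map_mx f0 (rhoU l).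
    by rewrite /good (funext E); exact: strict_eq_refl.
  apply/matrixP => i j; rewrite !mxE qE f0E; apply/tpiP/mpow1; rewrite resB res_alg.
  have [[_ hr] [_ hr']] := (hrho, hU); move: (hr l); rewrite -(hr' l) => /matrixP/(_ i j).
  by rewrite !mxE => ->; rewrite subrr.
pose u := fix u s : {f | good s f} :=
  if s is s'.+1 then sval (step s' (u s')) else exist _ f0 good0.
have [|f fE] := @chom_of_trunc A (fun s => sval (u s)).
  by move=> s r a /(congr1 (p s)); rewrite pE /=; case: (step s (u s)) => f' /= ->.
exists f; apply: (strict_eq_complete xyb rho0_scalar (mlift_chom f hU)) => s.
have [X [X1 hX]] := strict_eq_sym (svalP (u s)).
(* Arbitrary representatives of the entries of X conjugate modulo m^(s+1), which is all that
   [strict_eq_complete] asks. *)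
have XE : map_mx (@tpi k A s) (map_mx (@repr _ (trunc A s)) X) = X.
  by apply/matrixP => i j; rewrite !mxE /tpi reprK.
exists (map_mx (@repr _ (trunc A s)) X); split.
  by rewrite -X1 -{2}XE; apply/matrixP => i j; rewrite !mxE; apply/esym/trunc_resE.
move=> l i j; set Z := map_mx _ X.
suff /matrixP/(_ i j) : map_mx (@tpi k A s) (Z *m map_mx f (rhoU l)) =
    map_mx (@tpi k A s) (rho l *m Z).
  by rewrite !mxE => /tpiP.
rewrite !map_mxM XE.
have -> : map_mx (@tpi k A s) (map_mx f (rhoU l)) = map_mx (sval (u s)) (rhoU l).
  by apply/matrixP => a a'; rewrite !mxE /= fE.
have -> : map_mx (@tpi k A s) (rho l) = map_mx (q s) (rho l).
  by apply/matrixP => a a'; rewrite !mxE /= qE.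
exact: hX.
Qed.

End Surjectivity.

Lemma versal_universal d (x y : 'I_d -> L) b n (rho0 : L -> 'M[k]_n) (R : cobj k)
    (rhoU : L -> 'M[R]_n) : dual_bases x y b -> stably_scalar x y rho0 ->
  mx_versal rho0 rhoU -> mx_universal rho0 rhoU.
Proof.
move=> xyb sc [hU smU _ tU]; split=> // A.
  by move=> rho; exact: (versal_surj xyb sc hU smU).
by move=> f g; exact: (versal_inj xyb sc hU tU).
Qed.

Lemma universal_iso n (rho0 : L -> 'M[k]_n) (R R' : cobj k) (rhoU : L -> 'M[R]_n)
    (rhoU' : L -> 'M[R']_n) :
  mx_universal rho0 rhoU -> mx_universal rho0 rhoU' -> cobj_iso R R'.
Proof.
move=> [hU exU uU] [hU' exU' uU'].
have [f hf] := exU _ _ hU'; have [g hg] := exU' _ _ hU.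
have idE (B C : cobj k) (rB : L -> 'M[B]_n) (rC : L -> 'M[C]_n) (u : chom B C) (v : chom C B) :
    (forall f g : chom B B,
      strict_eq (fun l => map_mx f (rB l)) (fun l => map_mx g (rB l)) -> f =1 g) ->
    strict_eq (fun l => map_mx u (rB l)) rC -> strict_eq (fun l => map_mx v (rC l)) rB ->
    cancel u v.
  move=> uB hu hv z.
  have [i iE] : exists i : chom B B, i =1 id by apply: chom_of_fun.
  have [w wE] : exists w : chom B B, w =1 (fun z => v (u z)).
    apply: chom_of_fun => [a a'|a a'|c a||a].
    - by rewrite !rmorphD.
    - by rewrite !rmorphM.
    - by rewrite !chomZ.
    - by rewrite !rmorph1.
    - by rewrite !res_chom.
  rewrite -wE -[RHS]iE; apply: uB.
  have -> : (fun l => map_mx i (rB l)) = rB.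
    by apply/funext => l; apply/matrixP => a a'; rewrite !mxE iE.
  apply: strict_eq_trans hv; have := strict_eq_chom v hu.
  congr strict_eq; apply/funext => l; apply: map_mx_chom_comp => a.
  by rewrite wE.
by exists f, g; split; [exact: idE (@uU _) hf hg | exact: idE (@uU' _) hg hf].
Qed.

Lemma versal_linked m n (rho0 : L -> 'M[k]_m) (sigma0 : L -> 'M[k]_n) (R : cobj k)
    (sigmaU : L -> 'M[R]_n) : linked rho0 sigma0 -> mx_versal sigma0 sigmaU ->
  exists rhoU : L -> 'M[R]_m, mx_versal rho0 rhoU.
Proof.
move=> [E [E1 E2 E3 E4 E5]] [hU smU exU uU].
have [rhoU EU] := E3 _ _ hU; exists rhoU; split.
- by case: (E1 _ _ _ EU).
- move=> A B pi f rho aA aB spi hrho hs; have [sigma Es] := E2 _ _ hrho.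
  have [_ hsig] := E1 _ _ _ Es.
  have [|g [gE gP]] := smU A B pi f sigma aA aB spi hsig.
    exact/(E4 _ _ _ _ _ (E5 _ _ pi _ _ Es) (E5 _ _ f _ _ EU)).
  by exists g; split=> //; apply/(E4 _ _ _ _ _ (E5 _ _ g _ _ EU) Es).
- move=> rho hrho; have [sigma Es] := E2 _ _ hrho; have [_ hsig] := E1 _ _ _ Es.
  have [f fP] := exU _ hsig; exists f.
  exact/(E4 _ _ _ _ _ (E5 _ _ f _ _ EU) Es).
- move=> f g h; apply: uU.
  exact/(E4 _ _ _ _ _ (E5 _ _ f _ _ EU) (E5 _ _ g _ _ EU)).
Qed.

End MatrixVersality.

(** * Linear maps between column spaces as matrices *)

Section LinearMaps.

Lemma inj_surj_bij (T U : Type) (f : T -> U) : injective f -> surjective f -> bijective f.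
Proof.
by move=> fI /choice[g gK]; exists g => // x; apply: fI; rewrite gK.
Qed.

Context (A : comNzRingType).

Lemma mulmx_ext m n (X Y : 'M[A]_(m, n)) : (forall u : 'cV_n, X *m u = Y *m u) -> X = Y.
Proof.
move=> h; apply/matrixP => i j.
by have /matrixP/(_ i 0) := h (delta_mx j 0); rewrite -!colE !mxE.
Qed.

Lemma lin_mx m n (F : {linear 'cV[A]_n -> 'cV[A]_m}) :
  exists X : 'M[A]_(m, n), forall u, F u = X *m u.
Proof.
exists (\matrix_(i, j) F (delta_mx j 0) i 0) => u.
rewrite {1}[u]matrix_sum_delta linear_sum /=.
apply/matrixP => i j; rewrite !mxE summxE; apply: eq_bigr => s _.
by rewrite (ord1 j) big_ord1 linearZ /= !mxE mulrC.
Qed.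

Lemma linear_mx m n (F : 'cV[A]_n -> 'cV[A]_m) : linear F ->
  exists X : 'M[A]_(m, n), forall u, F u = X *m u.
Proof.
move=> Fl; pose mF := GRing.isLinear.Build _ _ _ _ F Fl.
exact: (lin_mx (HB.pack_for {linear 'cV[A]_n -> 'cV[A]_m} F mF)).
Qed.

End LinearMaps.

(** * Lifts of a module read in a basis *)

Section MatrixLifts.

Context (k : fieldType) (L : falgType k) (V : lmodType L).

(** k acts on [V] only through L, whence the scalars [c%:A]. *)
Definition presents n (rho0 : L -> 'M[k]_n) (e : 'cV[k]_n -> V) : Prop :=
  [/\ forall c u u', e (c *: u + u') = (c%:A : L) *: e u + e u', bijective e
    & forall l u, e (rho0 l *m u) = l *: e u].

Context (n : nat) (rho0 : L -> 'M[k]_n) (e : 'cV[k]_n -> V).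
Hypothesis rho0e : presents rho0 e.

Lemma presents_inj : injective e.
Proof. by case: rho0e => _ /bij_inj. Qed.

Lemma presentsD u u' : e (u + u') = e u + e u'.
Proof. by case: rho0e => h _ _; have := h 1 u u'; rewrite !scale1r. Qed.

Lemma presents0 : e 0 = 0.
Proof.
by have /eqP := presentsD 0 0; rewrite addr0 -subr_eq0 opprD addNKr oppr_eq0 => /eqP.
Qed.

Lemma presentsZ c u : e (c *: u) = (c%:A : L) *: e u.
Proof. by case: rho0e => h _ _; have := h c u 0; rewrite presents0 !addr0. Qed.

Lemma presents_sum (I : Type) (r : seq I) (F : I -> 'cV[k]_n) :
  e (\sum_(i <- r) F i) = \sum_(i <- r) e (F i).
Proof. exact: (big_morph e presentsD presents0). Qed.

(** E is a basis of M over A reducing, through [lift_phi], to the fixed basis of V; because of this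
    last clause, isomorphisms of lifts become matrices of residue 1. *)
Definition lift_presents (A : cobj k) (M : Defs.lift V A) (rho : L -> 'M[A]_n)
    (E : 'cV[A]_n -> M) : Prop :=
  [/\ linear E, bijective E, forall l u, E (rho l *m u) = tact l (E u)
    & forall u, lift_phi (tensor (cres A) 1 (E u) : bc (cres A) M) = e (map_mx (@res k A) u)].

Lemma bc_res_tensor (A : cobj k) (M : tmod L A) (z : bc (cres A) M) :
  exists m, z = tensor (cres A) 1 m.
Proof.
elim/tens_ind: z => [c m||_ _ [m ->] [m' ->]].
- exists (c%:A *: m); rewrite -tensor_bal mul1r; congr tensor.
  exact: (esym (res_alg A c)).
- by exists 0; rewrite tensor0.
- by exists (m + m'); rewrite tensorDr.
Qed.

Lemma tensor_sum (A B : comNzRingType) (alpha : {rmorphism A -> B}) (M : lmodType A)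
    (b : B) (I : Type) (r : seq I) (F : I -> M) :
  tensor alpha b (\sum_(i <- r) F i) = \sum_(i <- r) tensor alpha b (F i).
Proof.
by apply: (big_morph (tensor alpha b)) => [x y|]; [exact: tensorDr | exact: tensor0].
Qed.

Lemma cV_sum_delta (A : comNzRingType) (u : 'cV[A]_n) : u = \sum_i u i 0 *: delta_mx i 0.
Proof.
rewrite {1}[u]matrix_sum_delta; apply: eq_bigr => i _.
by rewrite big_ord1.
Qed.

Lemma tensor_res (A : cobj k) (M : lmodType A) (a : A) (m : M) :
  tensor (cres A) 1 (a *: m) = tensor (cres A) (res a : k^o) m.
Proof. by rewrite -tensor_bal mul1r. Qed.

Lemma tensor_res0 (A : cobj k) N (M : lmodType A) (E : {linear 'cV[A]_N -> M}) (u : 'cV[A]_N) :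
  map_mx (@res k A) u = 0 -> tensor (cres A) 1 (E u) = 0.
Proof.
move=> u0; rewrite [u]matrix_sum_delta linear_sum /= tensor_sum big1 // => i _.
move/matrixP/(_ i 0): u0; rewrite !mxE big_ord1 linearZ /= tensor_res => ->.
by rewrite tensorE scale0r.
Qed.

Lemma lift_phi0 (A : cobj k) (M : Defs.lift V A) : lift_phi (0 : bc (cres A) M) = 0.
Proof.
by have /eqP := lift_phiD (0 : bc (cres A) M) 0;
  rewrite addr0 -subr_eq0 opprD addNKr oppr_eq0 => /eqP.
Qed.

Section Presented.

Context (A : cobj k) (M : Defs.lift V A) (rho : L -> 'M[A]_n) (E : 'cV[A]_n -> M).
Hypothesis rhoE : lift_presents rho E.

Lemma lift_presents_mlift : mlift rho0 rho.
Proof.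
have [El /bij_inj Ei Ea Ep] := rhoE; split; first split.
- move=> c l l'; apply: mulmx_ext => u; apply: Ei.
  by rewrite mulmxDl -scalemxAl El !Ea -tact_scalar -tactM -tactDl mulr_algl.
- by apply: mulmx_ext => u; apply: Ei; rewrite Ea tact1 mul1mx.
- by move=> l l'; apply: mulmx_ext => u; apply: Ei; rewrite -mulmxA !Ea tactM.
move=> l; apply: mulmx_ext => u; apply: presents_inj; case: rho0e => _ _ ->.
rewrite -{1}(map_res_alg A u) -map_mxM -Ep Ea.
have <- : tact l (tensor (cres A) 1 (E (map_mx (in_alg A) u)) : bc (cres A) M) =
    tensor (cres A) 1 (tact l (E (map_mx (in_alg A) u))) by exact: bc_actE.
by rewrite lift_phi_act Ep map_res_alg.
Qed.

End Presented.

Lemma lift_iso_strict (A : cobj k) (M N : Defs.lift V A) rho rho'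
    (E : 'cV[A]_n -> M) (E' : 'cV[A]_n -> N) :
  lift_presents rho E -> lift_presents rho' E' ->
  (lift_iso M N <-> strict_eq rho rho').
Proof.
move=> [El [F EK FK] Ea Ep] [El' [F' EK' FK'] Ea' Ep'].
have Fl : linear F by move=> a x y; apply: (can_inj EK); rewrite El !FK.
have Fl' : linear F' by move=> a x y; apply: (can_inj EK'); rewrite El' !FK'.
split=> [[f [[fb fa] fphi]]|[X [X1 hX]]].
  have [|X hX] := @linear_mx A n n (F' \o f \o E).
    by move=> a x y; rewrite /= El linearP Fl'.
  exists X; split=> [|l].
    apply: mulmx_ext => u; apply: presents_inj.
    rewrite mul1mx -{1}(map_res_alg A u) -map_mxM -Ep' -hX /= FK'.
    by rewrite -(bc_mapE (cres A) f) fphi Ep map_res_alg.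
  apply: mulmx_ext => u; apply: (can_inj EK').
  by rewrite -!mulmxA -hX /= FK' Ea fa Ea' -hX /= FK'.
have [Y [XY YX _]] := res1_mx_inv X1.
pose f (m : M) : N := E' (X *m F m).
have fl : linear f by move=> a x y; rewrite /f Fl mulmxDr -scalemxAr El'.
pose mf := GRing.isLinear.Build _ _ _ _ f fl.
pose lf : {linear M -> N} := HB.pack f mf.
exists lf; split; first split.
- exists (fun m => E (Y *m F' m)) => m /=; rewrite /f.
    by rewrite EK' mulmxA YX mul1mx FK.
  by rewrite EK mulmxA XY mul1mx FK'.
- move=> l m /=; rewrite /f -Ea' mulmxA -hX -mulmxA; congr (E' (X *m _)).
  by apply: (can_inj EK); rewrite FK Ea FK.
move=> z; have [m ->] := bc_res_tensor z; rewrite bc_mapE /= /f Ep'.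
by rewrite map_mxM X1 mul1mx -Ep FK.
Qed.

Lemma lift_presents_bc (A B : cobj k) (f : chom A B) (M : Defs.lift V A) rho
    (E : 'cV[A]_n -> M) : lift_presents rho E ->
  exists E', @lift_presents B (bc_lift f M) (fun l => map_mx f (rho l)) E'.
Proof.
move=> [El [F EK FK] Ea Ep].
have Fl : linear F by move=> a x y; apply: (can_inj EK); rewrite El !FK.
pose mE := GRing.isLinear.Build _ _ _ _ E El.
pose lE : {linear 'cV[A]_n -> M} := HB.pack E mE.
pose E' (y : 'cV[B]_n) : bc f M := \sum_i y i 0 *: tensor f 1 (E (delta_mx i 0)).
have El' : linear E'.
  move=> b y y'; rewrite /E' scaler_sumr -big_split; apply: eq_bigr => i _.
  by rewrite !mxE scalerDl scalerA.
pose mE' := GRing.isLinear.Build _ _ _ _ E' El'.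
pose lE' : {linear 'cV[B]_n -> bc f M} := HB.pack E' mE'.
have EZ a x : E (a *: x) = a *: E x by exact: (linearZZ lE).
have Esum (F0 : 'I_n -> 'cV[A]_n) : E (\sum_i F0 i) = \sum_i E (F0 i) by exact: (linear_sum lE).
have EZ' a x : E' (a *: x) = a *: E' x by exact: (linearZZ lE').
have Esum' (F0 : 'I_n -> 'cV[B]_n) : E' (\sum_i F0 i) = \sum_i E' (F0 i) by exact: (linear_sum lE').
have E0' : E' 0 = 0 by exact: (linear0 lE').
have ED' x y : E' (x + y) = E' x + E' y by exact: (linearD lE').
have FZ a m : F (a *: m) = a *: F m by apply: (can_inj EK); rewrite EZ !FK.
have Emap u : E' (map_mx f u) = tensor f 1 (E u).
  rewrite {2}[u]cV_sum_delta Esum tensor_sum.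
  by apply: eq_bigr => i _; rewrite EZ -tensor_bal mul1r mxE [RHS]tensorE.
(* This balanced map induces the inverse of [E'], by taking coordinates over A and mapping them to
   B. *)
pose G b (m : M) : 'cV[B]_n := b *: map_mx f (F m).
have Gbal : balanced f G.
  split=> [b b' m|b m m'|b a m]; rewrite /G ?scalerDl //.
    by have := Fl 1 m m'; rewrite !scale1r => ->; rewrite map_mxD scalerDr.
  by rewrite FZ map_mxZ scalerA.
exists E'; split=> //.
- exists (tens_rec G) => [y|z].
    rewrite {2}[y]cV_sum_delta /E' (big_morph _ (tens_recD Gbal) (tens_rec0 Gbal)).
    apply: eq_bigr => i _; rewrite tensorZ mulr1 (tens_recE Gbal) /G EK.
    by congr (_ *: _); apply/matrixP => a b; rewrite !mxE rmorph_nat.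
  elim/tens_ind: z => [b m||z z' hz hz'].
  + rewrite (tens_recE Gbal) /G EZ' Emap FK.
    by rewrite [RHS]tensorE.
  + by rewrite (tens_rec0 Gbal) E0'.
  + by rewrite (tens_recD Gbal) ED' hz hz'.
- move=> l y; rewrite {1}[y]cV_sum_delta mulmx_sumr Esum'.
  rewrite /tact /= [in RHS]/E' (big_morph _ (@bc_actD _ _ _ _ f M l) (@bc_act0 _ _ _ _ f M l)).
  apply: eq_bigr => i _; rewrite -scalemxAr EZ'.
  rewrite tensorZ mulr1 bc_actE -Ea [RHS]tensorE -Emap map_mxM; congr (_ *: E' (_ *m _)).
  by apply/matrixP => a b; rewrite !mxE rmorph_nat.
- move=> y; rewrite /= /bc_phi /E' tensor_sum (big_morph _ (@bc_collapseD _ _ _ _ _ f M) (@bc_collapse0 _ _ _ _ _ f M)).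
  rewrite (big_morph _ (@lift_phiD _ _ _ _ M) (lift_phi0 M)) [y in RHS]cV_sum_delta.
  rewrite raddf_sum /= presents_sum; apply: eq_bigr => i _.
  rewrite tensorZ mulr1 bc_collapseE mul1r.
  have -> : map_mx (@res k B) (y i 0 *: delta_mx i 0) = (res (y i 0)) *: (delta_mx i 0 : 'cV[k]_n).
    by apply/matrixP => a b; rewrite !mxE resM rmorph_nat.
  rewrite presentsZ.
  have -> : tensor (cres A) (cres B (y i 0)) (E (delta_mx i 0)) =
      tact ((res (y i 0))%:A : L) (tensor (cres A) 1 (E (delta_mx i 0)) : bc (cres A) M).
    rewrite tact_scalar /= tensorZ mulr1; congr tensor.
    exact: esym (mulr1 _).
  rewrite lift_phi_act Ep; congr (_ *: e _).
  by apply/matrixP => a b; rewrite !mxE rmorph_nat.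
Qed.

End MatrixLifts.

(** * The lift defined by a matrix representation *)

Section LiftOfMatrices.

Context (k : fieldType) (L : falgType k) (V : lmodType L).
Context (n : nat) (rho0 : L -> 'M[k]_n) (e : 'cV[k]_n -> V).
Hypothesis rho0e : presents rho0 e.
Context (A : cobj k) (rho : L -> 'M[A]_n).
Hypothesis hrho : mlift rho0 rho.

Lemma mx_act_linear l : linear (fun u : 'cV[A]_n => rho l *m u).
Proof. by move=> a u u'; rewrite mulmxDr scalemxAr. Qed.

Lemma mx_actDl l l' (u : 'cV[A]_n) : rho (l + l') *m u = rho l *m u + rho l' *m u.
Proof.
case: hrho => -[rl _ _] _; have := rl 1 l l'; rewrite scale1r rmorph1 scale1r => ->.
by rewrite mulmxDl.
Qed.

Lemma mx_act1 (u : 'cV[A]_n) : rho 1 *m u = u.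
Proof. by case: hrho => -[_ -> _] _; rewrite mul1mx. Qed.

Lemma mx_actM l l' (u : 'cV[A]_n) : rho (l * l') *m u = rho l *m (rho l' *m u).
Proof. by case: hrho => -[_ _ ->] _; rewrite mulmxA. Qed.

Lemma mx_act_scalar c (u : 'cV[A]_n) : rho c%:A *m u = (c%:A : A) *: u.
Proof.
case: hrho => -[rl r1 _] _; have r0 : rho 0 = 0.
  have /eqP := rl 1 0 0; rewrite scale1r rmorph1 scale1r addr0.
  by rewrite -subr_eq0 opprD addNKr oppr_eq0 => /eqP.
by have := rl c 1 0; rewrite addr0 r0 addr0 r1 => ->; rewrite -scalemxAl mul1mx.
Qed.

Definition mx_tmod : tmod L A :=
  @TMod k L A 'cV[A]_n (fun l u => rho l *m u) mx_act_linear mx_actDl mx_act1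
    mx_actM mx_act_scalar.

Lemma mx_tmod_fin_gen : tmod_fin_gen mx_tmod.
Proof.
exists [seq delta_mx i 0 : mx_tmod | i <- enum 'I_n] => u.
exists [seq (u i 0, 1, delta_mx i 0 : mx_tmod) | i <- enum 'I_n]; split.
  by move=> p /mapP[i _ ->]; apply: map_f; rewrite mem_enum.
rewrite big_map big_enum /= {1}[u]cV_sum_delta; apply: eq_bigr => i _.
by congr (_ *: _); exact: (esym (mx_act1 _)).
Qed.

Lemma mx_tmod_free : is_free mx_tmod.
Proof.
exists 'I_n, (fun i => delta_mx i 0 : mx_tmod); split=> [u|s c us /= E i si].
  exists [seq (u i 0, i) | i <- enum 'I_n].
  by rewrite big_map big_enum /= {1}[u]cV_sum_delta.
move/matrixP/(_ i 0): E; rewrite summxE (bigD1_seq i) //= !mxE !eqxx mulr1.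
rewrite big1 ?addr0 // => j ji; rewrite !mxE andbT.
by rewrite eq_sym (negPf ji) mulr0.
Qed.

Definition mx_phi : bc (cres A) mx_tmod -> V :=
  tens_rec (fun (c : k^o) u => e ((c : k) *: map_mx (@res k A) u)).

Lemma mx_phi_bal :
  balanced (cres A) (fun (c : k^o) (u : mx_tmod) => e ((c : k) *: map_mx (@res k A) u)).
Proof.
split=> [c c' u|c u u'|c a u]; rewrite -?(presentsD rho0e); congr e.
- exact: scalerDl.
- by rewrite map_mxD scalerDr.
- by rewrite map_mxZ scalerA.
Qed.

Lemma mx_phiE u : mx_phi (tensor (cres A) 1 u) = e (map_mx (@res k A) u).
Proof. by rewrite /mx_phi (tens_recE mx_phi_bal) scale1r. Qed.

Lemma mx_phiD : {morph mx_phi : x y / x + y}.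
Proof. exact: (tens_recD mx_phi_bal). Qed.

Lemma mx_phi_act l x : mx_phi (tact l x) = l *: mx_phi x.
Proof.
have [u ->] := bc_res_tensor x; rewrite /tact /= bc_actE !mx_phiE map_mxM.
by case: hrho => _ ->; case: rho0e.
Qed.

Lemma mx_phi_bij : bijective mx_phi.
Proof.
apply: inj_surj_bij => [x y|v].
  have [u ->] := bc_res_tensor x; have [u' ->] := bc_res_tensor y.
  rewrite !mx_phiE => /(presents_inj rho0e) E.
  rewrite -[u](subrK u') tensorDr.
  rewrite (tensor_res0 (idfun : {linear 'cV[A]_n -> 'cV[A]_n})) ?add0r //=.
  by rewrite map_mxB E subrr.
case: rho0e => _ [f _ ef] _; exists (tensor (cres A) 1 (map_mx (in_alg A) (f v) : mx_tmod)).
by rewrite mx_phiE map_res_alg.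
Qed.

Definition mx_lift : Defs.lift V A :=
  @Lift k L V A mx_tmod mx_tmod_fin_gen mx_tmod_free mx_phi mx_phiD mx_phi_act mx_phi_bij.

Lemma mx_lift_presents : lift_presents e (M := mx_lift) rho id.
Proof. by split=> //; [exists id | exact: mx_phiE]. Qed.

End LiftOfMatrices.

(** * Every lift comes from matrices *)

Section MatricesOfLift.

Context (k : fieldType) (L : falgType k) (V : lmodType L).

(** Finite generation passes from A (x) L to A by letting a k-basis of L act on the generators. *)
Lemma tmod_span (A : cobj k) (M : tmod L A) : tmod_fin_gen M ->
  exists s : seq M, forall m, exists t : seq (A * M),
    (forall p, p \in t -> p.2 \in s) /\ m = \sum_(p <- t) p.1 *: p.2.
Proof.
move=> [s hs]; pose B := vbasis (fullv : {vspace L}).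
exists [seq tact l m | l <- B, m <- s] => m; have [t [ht ->]] := hs m.
elim: t ht => [|p t IHt] ht; first by exists [::]; split=> //; rewrite !big_nil.
rewrite big_cons; have [|t' [ht' ->]] := IHt; first by move=> q qt; apply: ht; rewrite inE qt orbT.
have ps : p.2 \in s by apply: ht; rewrite inE eqxx.
have tact_sum (I : Type) (r : seq I) (F : I -> L) (x : M) :
    tact (\sum_(i <- r) F i) x = \sum_(i <- r) tact (F i) x.
  apply: (big_morph (fun l => tact l x)) => [l l'|]; first exact: tactDl.
  by have := tact_scalar 0 x; rewrite !scale0r.
exists ([seq (p.1.1 * (coord B i p.1.2)%:A, tact B`_i p.2) | i <- enum 'I_(\dim (fullv : {vspace L}))] ++ t').
split=> [q|].
  rewrite mem_cat => /orP[/mapP[i _ ->] /=|/ht' //].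
  by apply: allpairs_f => //; apply: mem_nth; rewrite size_tuple.
rewrite big_cat big_map big_enum /=; congr (_ + _).
rewrite {1}(coord_vbasis (memvf p.1.2)) tact_sum scaler_sumr; apply: eq_bigr => i _.
by rewrite -scalerA -tact_scalar -tactM mulr_algl.
Qed.

(** The index type of a basis may be infinite a priori; the finitely many basis elements that occur
    in expansions of the generators already span. *)
Lemma free_fin_gen_basis (A : cobj k) (M : tmod L A) : tmod_fin_gen M -> is_free M ->
  exists N (E : {linear 'cV[A]_N -> M}), bijective E.
Proof.
move=> /tmod_span[G hG] [I [e [span indep]]].
have [S [uS hS]] : exists S : seq I, uniq S /\
    forall m, exists t : seq (A * I), (forall p, p \in t -> p.2 \in S) /\
      m = \sum_(p <- t) p.1 *: e p.2.
  have [t tE] := choice span.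
  exists (undup (flatten [seq map snd (t g) | g <- G])); rewrite undup_uniq; split=> // m.
  have [u [hu ->]] := hG m; elim: u hu => [|p u IHu] hu; first by exists [::]; split=> //; rewrite !big_nil.
  rewrite big_cons; have [|u' [hu' ->]] := IHu; first by move=> q qu; apply: hu; rewrite inE qu orbT.
  exists ([seq (p.1 * q.1, q.2) | q <- t p.2] ++ u'); split=> [q|].
    rewrite mem_cat => /orP[/mapP[q' q't ->] /=|/hu' //]; rewrite mem_undup.
    apply/flattenP; exists (map snd (t p.2)); last exact: map_f.
    by apply: map_f; apply: hu; rewrite inE eqxx.
  rewrite big_cat big_map /=; congr (_ + _).
  by rewrite {1}[p.2]tE scaler_sumr; apply: eq_bigr => q _; rewrite scalerA.
pose E (u : 'cV[A]_(size S)) : M := \sum_i u i 0 *: e (tnth (in_tuple S) i).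
have El : linear E.
  move=> a u u'; rewrite /E scaler_sumr -big_split; apply: eq_bigr => i _.
  by rewrite !mxE scalerDl scalerA.
pose mE := GRing.isLinear.Build _ _ _ _ E El.
pose lE : {linear 'cV[A]_(size S) -> M} := HB.pack E mE.
exists (size S), lE; apply: inj_surj_bij => [u u'|m].
  move=> /eqP; rewrite -subr_eq0 -linearB => /eqP E0; apply/eqP; rewrite -subr_eq0.
  move: (u - u') E0 => {u u'} u /= E0; apply/eqP/matrixP => i j; rewrite (ord1 j) mxE.
  have c0 x : Defs.coord span x (0 : M) = 0.
    have /eqP := coord_linear span indep x 1 0 0; rewrite scale1r addr0 mul1r.
    by rewrite -subr_eq0 opprD addNKr oppr_eq0 => /eqP.
  have cS x (r : seq 'I_(size S)) (F : 'I_(size S) -> M) :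
      Defs.coord span x (\sum_(i <- r) F i) = \sum_(i <- r) Defs.coord span x (F i).
    apply: (big_morph (Defs.coord span x)) => [y y'|//].
    by have := coord_linear span indep x 1 y y'; rewrite scale1r mul1r.
  have := congr1 (Defs.coord span (tnth (in_tuple S) i)) E0; rewrite c0 /E cS.
  have cZ x a y : Defs.coord span x (a *: y) = a * Defs.coord span x y.
    by have := coord_linear span indep x a y 0; rewrite c0 !addr0.
  rewrite (bigD1 i) //= cZ (Defs.coord_basis span indep) eqxx mulr1 big1 ?addr0 // => l li.
  rewrite cZ (Defs.coord_basis span indep); set x0 := tnth _ i.
  rewrite /x0 !(tnth_nth x0) /= nth_uniq //.
  by rewrite -[(l == i :> nat)]/(l == i) (negPf li) mulr0.
have [t [ht ->]] := hS m; elim: t ht => [|p t IHt] ht.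
  by exists 0; rewrite linear0 big_nil.
have [|u uE] := IHt; first by move=> q qt; apply: ht; rewrite inE qt orbT.
have /tnthP[i ip] : p.2 \in in_tuple S by apply: ht; rewrite inE eqxx.
exists (p.1 *: delta_mx i 0 + u); rewrite linearP big_cons uE; congr (_ *: _ + _).
rewrite /= /E (bigD1 i) //= !mxE !eqxx scale1r ip big1 ?addr0 // => l li.
by rewrite !mxE (negPf li) scale0r.
Qed.

Context (n : nat) (rho0 : L -> 'M[k]_n) (e : 'cV[k]_n -> V).
Hypothesis rho0e : presents rho0 e.

(* Nakayama's lemma, by comparing a basis of M with a basis of its special fibre. *)
Lemma lift_presentsP (A : cobj k) (M : Defs.lift V A) :
  exists rho E, lift_presents e (M := M) rho E.
Proof.
have [N [B [F BK FK]]] := free_fin_gen_basis (@lift_fin_gen _ _ _ _ M) (@lift_free _ _ _ _ M).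
have [_ [f eK fK] ea] := rho0e.
have Fl : linear F by move=> a x y; apply: (can_inj BK); rewrite linearP !FK.
pose psi (u : 'cV[k]_N) : V := lift_phi (tensor (cres A) 1 (B (map_mx (in_alg A) u)) : bc (cres A) M).
have tensB u : tensor (cres A) 1 (B u) = tensor (cres A) 1 (B (map_mx (in_alg A) (map_mx (@res k A) u))).
  rewrite -{1}[u](subrK (map_mx (in_alg A) (map_mx (@res k A) u))) linearD tensorDr.
  by rewrite tensor_res0 ?add0r // map_mxB map_res_alg subrr.
have phiE u : lift_phi (tensor (cres A) 1 (B u) : bc (cres A) M) = psi (map_mx (@res k A) u).
  by rewrite tensB.
have psiP c u u' : psi (c *: u + u') = (c%:A : L) *: psi u + psi u'.
  rewrite /psi map_mxD map_mxZ /= linearP tensorDr lift_phiD -lift_phi_act; congr (lift_phi _ + _).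
  by rewrite tact_scalar /= tensorZ mulr1 tensor_res res_alg; congr tensor; exact: esym (mulr1 c).
have psi_surj v : exists u, psi u = v.
  have [g pK gK] := lift_phi_bij M; have [m mE] := bc_res_tensor (g v).
  by exists (map_mx (@res k A) (F m)); rewrite -phiE FK -mE gK.
have psi_inj : injective psi.
  have lbij := bij_inj (lift_phi_bij M); move=> u u' /lbij E.
  (* Tensors are told apart by a balanced map: this one reads off the residues of the coordinates in
     the basis [B]. *)
  pose G (c : k^o) (m : M) : 'cV[k]_N := (c : k) *: map_mx (@res k A) (F m).
  have Gbal : balanced (cres A) G.
    split=> [c c' m|c m m'|c a m]; rewrite /G; first exact: scalerDl.
      by have := Fl 1 m m'; rewrite !scale1r => ->; rewrite map_mxD scalerDr.
    have := Fl a m 0; rewrite (_ : F 0 = 0) ?addr0 => [->|]; first by rewrite map_mxZ scalerA.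
    by apply: (can_inj BK); rewrite FK linear0.
  by have := congr1 (tens_rec G) E; rewrite !(tens_recE Gbal) /G !BK !map_res_alg !scale1r.
have fP c v v' : f ((c%:A : L) *: v + v') = c *: f v + f v'.
  by apply: (can_inj eK); rewrite (presentsD rho0e) (presentsZ rho0e) !fK.
have [Q QE] : exists Q : 'M[k]_(n, N), forall u, f (psi u) = Q *m u.
  by apply: linear_mx => c u u'; rewrite psiP fP.
have [g gE] := choice psi_surj.
have [X XE] : exists X : 'M[k]_(N, n), forall u, g (e u) = X *m u.
  apply: linear_mx => c u u'; apply: psi_inj; rewrite psiP !gE.
  by rewrite (presentsD rho0e) (presentsZ rho0e).
have QX : Q *m X = 1%:M.
  by apply: mulmx_ext => u; rewrite -mulmxA -XE -QE gE eK mul1mx.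
have XQ : X *m Q = 1%:M.
  by apply: mulmx_ext => u; apply: psi_inj; rewrite -mulmxA -QE -XE gE fK mul1mx.
have nN : N = n by apply/eqP; rewrite eqn_leq (mulmx1_min XQ) (mulmx1_min QX).
(* [B] reduces to the basis [psi] of V; the constant matrix X changes it into a basis reducing to
   [e]. *)
subst N; pose E (u : 'cV[A]_n) : M := B (map_mx (in_alg A) X *m u).
have E_lin : linear E.
  by move=> a u u'; rewrite /E mulmxDr -scalemxAr linearP.
have EK : cancel E (fun m => map_mx (in_alg A) Q *m F m).
  by move=> u; rewrite /E BK mulmxA -map_mxM QX map_mx1 mul1mx.
have KE : cancel (fun m => map_mx (in_alg A) Q *m F m) E.
  by move=> m; rewrite /E mulmxA -map_mxM XQ map_mx1 mul1mx FK.
have act_mx l : exists X : 'M[A]_n, forall u,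
    map_mx (in_alg A) Q *m F (tact l (E u)) = X *m u.
  apply: linear_mx => a u u'; rewrite E_lin tactD tactZ Fl mulmxDr -scalemxAr.
  by [].
have [rho rhoE] := choice act_mx; exists rho, E; split=> //.
- by exists (fun m => map_mx (in_alg A) Q *m F m).
- by move=> l u; rewrite -rhoE KE.
- by move=> u; rewrite phiE map_mxM map_res_alg -XE gE.
Qed.

End MatricesOfLift.

(** * The deformation functor in terms of matrices *)

Section DeformationsOfMatrices.

Context (k : fieldType) (L : falgType k) (V : lmodType L).
Context (n : nat) (rho0 : L -> 'M[k]_n) (e : 'cV[k]_n -> V).
Hypothesis rho0e : presents rho0 e.

Definition def_presents (A : cobj k) (D : deformation V A) (rho : L -> 'M[A]_n) : Prop :=
  exists M E, D = deform M /\ lift_presents e (M := M) rho E.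

Lemma def_presents_mlift (A : cobj k) (D : deformation V A) rho :
  def_presents D rho -> mlift rho0 rho.
Proof. by move=> [M [E [_ /(lift_presents_mlift rho0e)]]]. Qed.

Lemma def_presentsP (A : cobj k) (D : deformation V A) : exists rho, def_presents D rho.
Proof.
case: D => D [M DE]; have [rho [E h]] := lift_presentsP rho0e M.
by exists rho, M, E; split=> //; exact: eq_exist.
Qed.

Lemma def_presents_ex (A : cobj k) (rho : L -> 'M[A]_n) :
  mlift rho0 rho -> exists D, def_presents D rho.
Proof.
move=> h; exists (deform (mx_lift rho0e h)), (mx_lift rho0e h), id; split=> //.
exact: mx_lift_presents.
Qed.

Lemma def_presents_eq (A : cobj k) (D D' : deformation V A) rho rho' :
  def_presents D rho -> def_presents D' rho' -> (D = D' <-> strict_eq rho rho').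
Proof.
move=> [M [E [-> h]]] [M' [E' [-> h']]].
exact: iff_trans (deformP _ _) (lift_iso_strict rho0e h h').
Qed.

Lemma def_presents_map (A B : cobj k) (f : chom A B) (D : deformation V A) rho :
  def_presents D rho -> def_presents (def_map f D) (fun l => map_mx f (rho l)).
Proof.
move=> [M [E [-> h]]]; have [E' h'] := lift_presents_bc rho0e f h.
by exists (bc_lift f M), E'; rewrite def_mapE.
Qed.

Lemma versal_mx (R : cobj k) : versal_deformation_ring V R ->
  exists rhoU : L -> 'M[R]_n, mx_versal rho0 rhoU.
Proof.
move=> [U [smU tU]]; have [rhoU hU] := def_presentsP U; exists rhoU; split.
- exact: def_presents_mlift hU.
- move=> A B pi f rho aA aB spi hrho hs; have [D hD] := def_presents_ex hrho.
  have [|g [gE gD]] := smU A B pi f D aA aB spi.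
    exact/(def_presents_eq (def_presents_map pi hD) (def_presents_map f hU)).
  by exists g; split=> //; apply/(def_presents_eq (def_presents_map g hU) hD).
- move=> rho /def_presents_ex[D hD]; have [[f fD] _] := tU D; exists f.
  exact/(def_presents_eq (def_presents_map f hU) hD).
- move=> f g fg; have [_ h] := tU (def_map f U); apply: h => //.
  by apply/esym/(def_presents_eq (def_presents_map f hU) (def_presents_map g hU)).
Qed.

(** A deformation is sent to its classifying map. Uniqueness of that map gives naturality and
    surjectivity; injectivity holds because the map recovers the deformation from [rhoU]. *)
Lemma universal_represents (R : cobj k) (rhoU : L -> 'M[R]_n) :
  mx_universal rho0 rhoU -> represents_deformations V R.
Proof.
move=> [hU exU uU].
have ex (A : cobj k) (D : deformation V A) : exists f : chom R A,
    forall rho, def_presents D rho -> strict_eq (fun l => map_mx f (rhoU l)) rho.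
  have [rho hD] := def_presentsP D; have [f fP] := exU _ _ (def_presents_mlift hD).
  exists f => rho' hD'; apply: strict_eq_trans fP _.
  exact/(def_presents_eq hD hD').
pose eta A D := projT1 (cid (ex A D)).
have etaP A D : forall rho, def_presents D rho ->
    strict_eq (fun l => map_mx (eta A D) (rhoU l)) rho := projT2 (cid (ex A D)).
exists eta; split.
- move=> A B f D r; have [rho hD] := def_presentsP D.
  have [h hE] : exists h : chom R B, h =1 fun r => f (eta A D r).
    apply: chom_of_fun => [a a'|a a'|c a||a].
    - by rewrite !rmorphD.
    - by rewrite !rmorphM.
    - by rewrite !chomZ.
    - by rewrite !rmorph1.
    - by rewrite !res_chom.
  rewrite -hE; apply: uU; apply: strict_eq_trans (etaP _ _ _ (def_presents_map f hD)) _.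
  apply: strict_eq_sym; have := strict_eq_chom f (etaP _ _ _ hD).
  by congr strict_eq; apply/funext => l; apply: map_mx_chom_comp => a; rewrite hE.
- move=> A D D' DD'; have [rho hD] := def_presentsP D; have [rho' hD'] := def_presentsP D'.
  apply/(def_presents_eq hD hD').
  apply: strict_eq_trans (strict_eq_sym (etaP _ _ _ hD)) _.
  have := etaP _ _ _ hD'; congr strict_eq; apply/funext => l.
  by apply/matrixP => i j; rewrite !mxE DD'.
- move=> A f; have [|D hD] := @def_presents_ex A (fun l => map_mx f (rhoU l)).
    exact: mlift_chom hU.
  by exists D; apply: uU; exact: etaP.
Qed.

End DeformationsOfMatrices.

(** * Dual bases and Higman's criterion *)

(** The y_i are any basis of L; non-degeneracy makes the Gram matrix invertible, and the columns of
    its inverse are the coordinates of the x_j. *)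
Lemma frobenius_dual_bases (k : fieldType) (L : falgType k) : frobenius L ->
  exists d (x y : 'I_d -> L) (b : L -> L -> k),
    dual_bases x y b /\ forall u, scalar (b^~ u).
Proof.
move=> [b [br bl bA n1 n2]].
pose e := vbasis (fullv : {vspace L}); pose d := \dim (fullv : {vspace L}).
have bDr u v w : b u (v + w) = b u v + b u w.
  by have := br u 1 v w; rewrite scale1r mul1r.
have b0r u : b u 0 = 0.
  by have /eqP := bDr u 0 0; rewrite addr0 -subr_eq0 opprD addNKr oppr_eq0 => /eqP.
have bDl u v w : b (v + w) u = b v u + b w u.
  by have := bl u 1 v w; rewrite scale1r mul1r.
have b0l u : b 0 u = 0.
  by have /eqP := bDl u 0 0; rewrite addr0 -subr_eq0 opprD addNKr oppr_eq0 => /eqP.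
have bZr u c v : b u (c *: v) = c * b u v.
  by have := br u c v 0; rewrite b0r !addr0.
have bZl u c v : b (c *: v) u = c * b v u.
  by have := bl u c v 0; rewrite b0l !addr0.
have bsr u (F : 'I_d -> L) : b u (\sum_i F i) = \sum_i b u (F i).
  exact: (big_morph (b u) (bDr u) (b0r u)).
have bsl u (F : 'I_d -> L) : b (\sum_i F i) u = \sum_i b (F i) u.
  exact: (big_morph (b^~ u) (bDl u) (b0l u)).
have eE l : l = \sum_(i < d) coord e i l *: e`_i by exact: coord_vbasis (memvf l).
have free_e (c : 'I_d -> k) : \sum_(i < d) c i *: e`_i = 0 -> forall i, c i = 0.
  by apply/freeP/basis_free/vbasisP.
pose B : 'M[k]_d := \matrix_(i, j) b e`_i e`_j.
have Bu : B \in unitmx.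
  rewrite -row_free_unit; apply: inj_row_free => r r0.
  apply/rowP => i; rewrite mxE; apply: (free_e (fun i => r 0 i)); apply: n1 => u.
  rewrite [u]eE bsr big1 // => j _; rewrite bZr bsl.
  move/rowP/(_ j): r0; rewrite !mxE => r0.
  rewrite (eq_bigr (fun i => r 0 i * B i j)) ?r0 ?mulr0 // => i' _.
  by rewrite bZl mxE.
pose x (j : 'I_d) := \sum_(l < d) invmx B l j *: e`_l.
have bex (i j : 'I_d) : b e`_i (x j) = (i == j)%:R.
  have /matrixP/(_ i j) := mulmxV Bu; rewrite !mxE => <-.
  by rewrite bsr; apply: eq_bigr => l _; rewrite bZr mxE mulrC.
exists d, x, (fun i => e`_i), b; split=> //; split=> // l.
  apply/eqP; rewrite -subr_eq0; apply/eqP/n2 => u.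
  rewrite [u]eE bsl big1 // => i _; rewrite bZl bDr -scaleN1r bZr bsr.
  rewrite (bigD1 i) //= bZr bex eqxx mulr1 big1 ?addr0 ?mulN1r ?subrr ?mulr0 // => j ji.
  by rewrite bZr bex eq_sym (negPf ji) mulr0.
rewrite {1}[l]eE; apply: eq_bigr => i _; congr (_ *: _).
rewrite {2}[l]eE bsl (bigD1 i) //= bZl bex eqxx mulr1 big1 ?addr0 // => j ji.
by rewrite bZl bex (negPf ji) mulr0.
Qed.

Section Higman.

Context (k : fieldType) (L : falgType k).
Context (d : nat) (x y : 'I_d -> L) (b : L -> L -> k).
Hypothesis xyb : dual_bases x y b.
Hypothesis b_linear : forall u, scalar (b^~ u).

Definition klinear (M N : lmodType L) (g : M -> N) : Prop :=
  forall c u v, g ((c%:A : L) *: u + v) = (c%:A : L) *: g u + g v.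

(** The coordinate-free form of lying in the image of [htr]. *)
Definition traced (M : lmodType L) (f : M -> M) : Prop :=
  exists g : M -> M, klinear g /\ forall v, f v = \sum_i x i *: g (y i *: v).

(** With the Frobenius functional b(-, 1), associativity gives b(y_i l, 1) = b(y_i, l), so the
    expansion of l on the x_i is a trace. *)
Lemma free_traced r : traced (id : 'rV[L]_r -> 'rV[L]_r).
Proof.
case: xyb => bA bx _.
exists (fun u : 'rV[L]_r => \row_j (b (u 0 j) 1)%:A : 'rV[L]_r); split=> [c u v|u]; apply/rowP => j.
  by rewrite !mxE mulr_algl b_linear scalerDl mulr_algl scalerA.
rewrite summxE [LHS]bx; apply: eq_bigr => i _.
by rewrite !mxE bA mulr1 mulr_algr.
Qed.

Lemma fin_gen_cover (V : lmodType L) : fin_gen V ->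
  exists r (q : {linear 'rV[L]_r -> V}), surjective q.
Proof.
move=> [s hs]; pose q (u : 'rV[L]_(size s)) := \sum_j u 0 j *: s`_j.
have ql : linear q.
  move=> c u v; rewrite /q scaler_sumr -big_split; apply: eq_bigr => j _.
  by rewrite !mxE scalerDl scalerA.
pose mq := GRing.isLinear.Build _ _ _ _ q ql.
exists (size s), (HB.pack_for {linear 'rV[L]_(size s) -> V} q mq) => v.
have [c ->] := hs v; exists (\row_j c j); apply: eq_bigr => j _.
by rewrite mxE.
Qed.

(** By projectivity of Q, the map Q -> V lifts through a free cover of V. So f factors through a
    free module, whose identity is a trace, and L-linear maps pass inside traces. *)
Lemma factors_traced (V : lmodType L) (f : endo V) : fin_gen V ->
  factors_proj f -> traced (endo_fun f).
Proof.
move=> /fin_gen_cover[r [q qs]] [Q [a [h [Qp fE]]]].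
have [h' h'E] := Qp _ _ q h qs; have [G [Gl GE]] := free_traced r.
exists (fun v => q (G (h' (a v)))); split=> [c u v|v].
  by rewrite !linearP Gl linearP.
rewrite fE -h'E {1}[h' _]GE linear_sum; apply: eq_bigr => i _.
by rewrite !linearZ.
Qed.

Lemma projective_traced (P : lmodType L) : fin_gen P -> projective P ->
  traced (id : P -> P).
Proof.
move=> fP pP; apply: (@factors_traced P (idfun : {linear P -> P})) => //.
by exists P, idfun, idfun.
Qed.

Lemma traced_prod (M N : lmodType L) : traced (id : M -> M) -> traced (id : N -> N) ->
  traced (id : M * N -> M * N).
Proof.
move=> [g [gl gE]] [h [hl hE]]; exists (fun p => (g p.1, h p.2)).
split=> [c u v|[u v]]; first by rewrite /= gl hl.
rewrite {1}[u]gE {1}[v]hE [LHS]surjective_pairing [RHS]surjective_pairing /=.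
by rewrite (big_morph fst (fun _ _ => erefl) erefl) (big_morph snd (fun _ _ => erefl) erefl).
Qed.

Section Presented.

Context (V : lmodType L) (n : nat) (rho0 : L -> 'M[k]_n) (e : 'cV[k]_n -> V).
Hypothesis rho0e : presents rho0 e.

Lemma presents_is_rep : is_rep idfun rho0.
Proof.
have ei := presents_inj rho0e; have [el _ ea] := rho0e; split.
- move=> c l l'; apply: mulmx_ext => u; apply: ei.
  rewrite mulmxDl -scalemxAl !(presentsD rho0e) (presentsZ rho0e) !ea.
  by rewrite scalerDl scalerA mulr_algl.
- by apply: mulmx_ext => u; apply: ei; rewrite ea scale1r mul1mx.
- by move=> l l'; apply: mulmx_ext => u; apply: ei; rewrite -mulmxA !ea scalerA.
Qed.

Lemma klinear_mx (g : V -> V) : klinear g ->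
  exists X : 'M[k]_n, forall u, e (X *m u) = g (e u).
Proof.
move=> gl; have [_ [f eK fK] _] := rho0e.
have [|X XE] := @linear_mx k n n (f \o g \o e).
  move=> c u v; apply: (can_inj eK).
  by rewrite (presentsD rho0e) (presentsZ rho0e) /= !fK (presentsD rho0e) (presentsZ rho0e) gl.
by exists X => u; rewrite -XE /= fK.
Qed.

Lemma traced_mx (f : V -> V) (X : 'M[k]_n) : traced f ->
  (forall u, e (X *m u) = f (e u)) -> exists g, X = htr x y rho0 rho0 g.
Proof.
move=> [g [gl gE]] XE; have [G GE] := klinear_mx gl; exists G.
apply: mulmx_ext => u; apply: (presents_inj rho0e); rewrite XE gE.
rewrite /htr mulmx_suml (presents_sum rho0e); apply: eq_bigr => i _.
by case: (rho0e) => _ _ ea; rewrite -!mulmxA ea GE ea.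
Qed.

Lemma traced_trace_projective : traced (id : V -> V) -> trace_projective x y rho0.
Proof.
move=> tV; have [|g gE] := @traced_mx id 1%:M tV; first by move=> u; rewrite mul1mx.
by exists g.
Qed.

(** An endomorphism and the homothety by the scalar of its stable class have the same image in k,
    hence differ by a map factoring through a projective module, which is a trace. *)
Lemma stable_end_stably_scalar : fin_gen V -> stable_end_is_k V ->
  stably_scalar x y rho0.
Proof.
move=> fV [phi [phib phiE]] X XC; have [_ [f eK fK] ea] := rho0e.
pose F v := e (X *m f v).
have Fl : linear F.
  move=> l u v; rewrite -{1}[u]fK -{1}[v]fK -ea -(presentsD rho0e) /F eK mulmxDr.
  by rewrite (presentsD rho0e) mulmxA -XC -mulmxA ea.
pose mF := GRing.isLinear.Build _ _ _ _ F Fl.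
pose lF : endo V := HB.pack_for {linear V -> V} F mF.
pose c := phi (stable_class lF).
have /stable_classP /asboolP /(factors_traced fV) tr :
    stable_class lF = stable_class (homothety V c).
  by apply: (bij_inj phib); rewrite phiE.
have [|g gE] := @traced_mx _ (X - c%:M) tr; last by exists c, g; rewrite -gE addrC subrK.
move=> u; rewrite mulmxBl mul_scalar_mx -scaleN1r scalerA mulN1r.
rewrite (presentsD rho0e) (presentsZ rho0e) !scaleNr.
by rewrite /= /F eK.
Qed.

End Presented.

End Higman.

(** * Bases of modules, kernels and extensions *)

Section Presentations.

Context (k : fieldType) (L : falgType k).

Definition kcomb (V : lmodType L) n (e : 'cV[k]_n -> V) : Prop :=
  forall c u v, e (c *: u + v) = (c%:A : L) *: e u + e v.

Lemma kcomb0 (V : lmodType L) n (e : 'cV[k]_n -> V) : kcomb e -> e 0 = 0.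
Proof.
move=> h; have /eqP := h 1 0 0; rewrite !scale1r addr0.
by rewrite -subr_eq0 opprD addNKr oppr_eq0 => /eqP.
Qed.

Lemma kcombD (V : lmodType L) n (e : 'cV[k]_n -> V) u v : kcomb e -> e (u + v) = e u + e v.
Proof. by move=> h; have := h 1 u v; rewrite !scale1r. Qed.

Lemma kcombB (V : lmodType L) n (e : 'cV[k]_n -> V) u v : kcomb e -> e (u - v) = e u - e v.
Proof. by move=> h; have := h (-1) v u; rewrite !scaleN1r addrC => ->; rewrite addrC. Qed.

Lemma fin_gen_kcomb (V : lmodType L) : fin_gen V ->
  exists N (s : 'cV[k]_N -> V), kcomb s /\ surjective s.
Proof.
move=> [g hg]; pose B := vbasis (fullv : {vspace L}).
pose d := \dim (fullv : {vspace L}).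
pose s (u : 'cV[k]_(size g * d)) : V :=
  \sum_(i < size g) (\sum_(j < d) vec_mx u^T i j *: B`_j) *: g`_i.
exists _, s; split=> [c u v|v].
  rewrite /s scaler_sumr -big_split; apply: eq_bigr => i _.
  rewrite /= scalerA mulr_algl -scalerDl scaler_sumr -big_split; congr (_ *: _).
  by apply: eq_bigr => j _; rewrite linearP /= linearP !mxE scalerA scalerDl.
have [c ->] := hg v; exists (mxvec (\matrix_(i, j) coord B j (c i)))^T.
rewrite /s trmxK mxvecK; apply: eq_bigr => i _; congr (_ *: _).
rewrite [RHS](coord_vbasis (memvf (c i))).
by apply: eq_bigr => j _; rewrite mxE.
Qed.

(** Along a surjection k^N -> V, the preimage of S is a row space U and the kernel a row space K; a
    complement of U :&: K in U maps bijectively onto S. *)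
Lemma subspace_basis (V : lmodType L) (S : V -> Prop) : fin_gen V -> S 0 ->
  (forall l u v, S u -> S v -> S (l *: u + v)) ->
  exists w (e : 'cV[k]_w -> V),
    [/\ kcomb e, injective e & forall v, S v <-> exists u, e u = v].
Proof.
move=> /fin_gen_kcomb[N [s [sl ss]]] S0 SD.
have s0 := kcomb0 sl.
have str c (u v : 'rV[k]_N) : s (c *: u + v)^T = (c%:A : L) *: s u^T + s v^T.
  by rewrite linearP sl.
have [||U UE] := @subspace_mx k N (fun u => S (s u^T)).
- by rewrite trmx0 s0.
- by move=> c u v Su Sv; rewrite str; exact: SD.
have [||K KE] := @subspace_mx k N (fun u => s u^T = 0).
- by rewrite trmx0.
- by move=> c u v su sv; rewrite str su sv scaler0 addr0.
pose C := row_base (U :\: K)%MS.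
have CU : (C <= U)%MS by rewrite eq_row_base diffmxSl.
pose e (u : 'cV[k]_(\rank (U :\: K)%MS)) : V := s (u^T *m C)^T.
have el : kcomb e by move=> c u v; rewrite /e linearP mulmxDl -scalemxAl str.
exists _, e; split=> // [u v|v].
  move=> /eqP; rewrite -subr_eq0 -(kcombB _ _ el) => /eqP e0.
  apply/eqP; rewrite -subr_eq0; move: (u - v) e0 => {u v} u /KE uK.
  have : (u^T *m C <= (U :\: K) :&: K)%MS.
    by rewrite sub_capmx uK andbT (submx_trans (submxMl _ _)) // eq_row_base.
  rewrite capmx_diff submx0 => /eqP uC0.
  have /row_free_inj fC : row_free C by exact: row_base_free.
  have : u^T = 0 by apply: fC; rewrite uC0 mul0mx.
  by move/(congr1 trmx); rewrite trmxK trmx0 => ->.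
split=> [Sv|[u <-]]; last by apply/UE; exact: submx_trans (submxMl _ _) CU.
have [z zv] := ss v.
have zU : (z^T <= U)%MS by apply/UE; rewrite trmxK zv.
have : (z^T <= (U :&: K) + (U :\: K))%MS by rewrite addsmxC addsmx_diff_cap_eq.
case/sub_addsmxP=> -[a c] /= zE.
have /submxP[f fE] : (c *m (U :\: K)%MS <= C)%MS by rewrite eq_row_base submxMl.
exists f^T; rewrite /e trmxK -fE -zv -[z]trmxK zE.
have aK : s (a *m (U :&: K)%MS)^T = 0.
  by apply/KE; rewrite (submx_trans (submxMl _ _)) // capmxSr.
by rewrite linearD (kcombD _ _ sl) aK add0r.
Qed.

Lemma stable_rep (V : lmodType L) w (e : 'cV[k]_w -> V) : kcomb e -> injective e ->
  (forall l u, exists u', e u' = l *: e u) ->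
  exists rho0 : L -> 'M[k]_w, forall l u, e (rho0 l *m u) = l *: e u.
Proof.
move=> el ei ea; have [f fE] := choice (fun lu : L * 'cV[k]_w => ea lu.1 lu.2).
have act_mx l : exists X : 'M[k]_w, forall u, f (l, u) = X *m u.
  apply: linear_mx => c u v; apply: ei; rewrite el !fE /= el scalerDr !scalerA.
  by rewrite mulr_algr mulr_algl.
have [rho0 rhoE] := choice act_mx; exists rho0 => l u.
by rewrite -rhoE fE.
Qed.

Lemma fin_gen_presents (V : lmodType L) : fin_gen V ->
  exists n (rho0 : L -> 'M[k]_n) (e : 'cV[k]_n -> V), presents rho0 e.
Proof.
move=> fV; have [//|//|n [e [el ei es]]] := @subspace_basis V (fun=> True) fV.
have eS : surjective e by move=> v; apply/es.
have [|rho0 ea] := stable_rep el ei; first by move=> l u; exact: eS.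
by exists n, rho0, e; split=> //; exact: inj_surj_bij.
Qed.

Definition presents_ker (P V : lmodType L) (pi : {linear P -> V}) w
    (sigma0 : L -> 'M[k]_w) (i : 'cV[k]_w -> P) : Prop :=
  [/\ kcomb i, injective i, forall l u, i (sigma0 l *m u) = l *: i u
    & forall p, pi p = 0 <-> exists u, i u = p].

Lemma ker_presents (P V : lmodType L) (pi : {linear P -> V}) : fin_gen P ->
  exists w (sigma0 : L -> 'M[k]_w) (i : 'cV[k]_w -> P), presents_ker pi sigma0 i.
Proof.
move=> fP; have [||w [i [il ii ie]]] := @subspace_basis P (fun p => pi p = 0) fP.
- exact: linear0.
- by move=> l u v pu pv; rewrite linearP pu pv scaler0 addr0.
have [|sigma0 ia] := stable_rep il ii.
  move=> l u; have iu : pi (i u) = 0 by apply/ie; exists u.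
  by apply/ie; rewrite linearZ /= iu scaler0.
by exists w, sigma0, i.
Qed.

(** A k-linear section of [pi] completes the basis of the kernel to one of P. The action is block
    triangular there, since the kernel is stable and [pi] is L-linear. *)
Lemma ext_presents (P V : lmodType L) (pi : {linear P -> V}) w (sigma0 : L -> 'M[k]_w) i
    v (rho0 : L -> 'M[k]_v) (e : 'cV[k]_v -> V) :
  surjective pi -> presents_ker pi sigma0 i -> presents rho0 e ->
  exists beta0 (E : 'cV[k]_(w + v) -> P), presents (ext_rep0 sigma0 beta0 rho0) E.
Proof.
move=> pis [il ii ia ie] rho0e; have [el [f eK fK] ea] := rho0e.
have pii u : pi (i u) = 0 by apply/ie; exists u.
have [p pE] := choice (fun j => pis (e (delta_mx j 0))).
pose s (u : 'cV[k]_v) : P := \sum_j ((u j 0)%:A : L) *: p j.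
have sl : kcomb s.
  move=> c u u'; rewrite /s scaler_sumr -big_split; apply: eq_bigr => j _.
  by rewrite /= !mxE scalerA mulr_algl scalerA -scalerDl -scalerDl.
have sE u : pi (s u) = e u.
  rewrite {2}[u]cV_sum_delta (presents_sum rho0e) linear_sum; apply: eq_bigr => j _.
  by rewrite linearZ /= pE (presentsZ rho0e).
pose E (z : 'cV[k]_(w + v)) : P := i (usubmx z) + s (dsubmx z).
have El : kcomb E by move=> c z z'; rewrite /E !linearP il sl scalerDr addrACA.
have piE z : pi (E z) = e (dsubmx z) by rewrite linearD pii sE add0r.
have E_inj : injective E.
  move=> z z' EE; rewrite -[z]vsubmxK -[z']vsubmxK.
  have dE : dsubmx z = dsubmx z' by apply: (can_inj eK); rewrite -!piE EE.
  by move: EE; rewrite /E dE => /addIr/ii ->.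
have E_surj : surjective E.
  move=> q; have /ie[u uE] : pi (q - s (f (pi q))) = 0.
    by rewrite linearB /= sE fK subrr.
  by exists (col_mx u (f (pi q))); rewrite /E col_mxKu col_mxKd uE subrK.
have [|tau tauE] := stable_rep El E_inj; first by move=> l z; exact: E_surj.
exists (fun l => ursubmx (tau l)), E.
suff <- : tau = ext_rep0 sigma0 (fun l => ursubmx (tau l)) rho0.
  by split=> //; exact: inj_surj_bij.
apply/funext => l; rewrite /ext_rep0 -[LHS]submxK.
have dE (u : 'cV[k]_w) (u' : 'cV[k]_v) : dlsubmx (tau l) *m u + drsubmx (tau l) *m u' = rho0 l *m u'.
  apply: (can_inj eK); rewrite ea -[u' in RHS](col_mxKd u u') -piE -linearZ -tauE piE.
  by rewrite -{3}[tau l]submxK mul_block_col col_mxKd.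
have uE (u : 'cV[k]_w) : ulsubmx (tau l) *m u = sigma0 l *m u.
  apply: ii; have := tauE l (col_mx u 0); rewrite -{1}[tau l]submxK mul_block_col !mulmx0 !addr0.
  have := dE u 0; rewrite !mulmx0 addr0 => ->.
  by rewrite /E !col_mxKu !col_mxKd (kcomb0 sl) !addr0 ia.
congr block_mx; apply: mulmx_ext => u; first exact: uE.
  by have := dE u 0; rewrite !mulmx0 addr0 mul0mx.
by have := dE 0 u; rewrite mulmx0 add0r.
Qed.

Lemma presents_prod (V W : lmodType L) m n (rho0 : L -> 'M[k]_m) e (sigma0 : L -> 'M[k]_n) e' :
  @presents k L V m rho0 e -> @presents k L W n sigma0 e' ->
  presents (V := (V * W)%type) (fun l => block_mx (rho0 l) 0 0 (sigma0 l))
    (fun z => (e (usubmx z), e' (dsubmx z))).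
Proof.
move=> [el [f eK fK] ea] [el' [f' eK' fK'] ea']; split.
- by move=> c u v; rewrite !linearP el el'.
- exists (fun p => col_mx (f p.1) (f' p.2)) => [z|[u v]] /=.
    by rewrite eK eK' vsubmxK.
  by rewrite col_mxKu col_mxKd fK fK'.
- move=> l u; rewrite -[u]vsubmxK mul_block_col !mul0mx addr0 add0r.
  by rewrite !col_mxKu !col_mxKd ea ea'.
Qed.

(** * Modules with the same deformations *)

Section Stability.

Context (d : nat) (x y : 'I_d -> L) (b : L -> L -> k).
Hypothesis xyb : dual_bases x y b.
Hypothesis b_linear : forall u, scalar (b^~ u).

Lemma linked_exact (P V : lmodType L) (pi : {linear P -> V}) w (sigma0 : L -> 'M[k]_w) i
    v (rho0 : L -> 'M[k]_v) (e : 'cV[k]_v -> V) :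
  surjective pi -> presents_ker pi sigma0 i -> presents rho0 e ->
  traced x y (id : P -> P) -> linked rho0 sigma0.
Proof.
move=> pis hs hr tP; have [beta0 [E hE]] := ext_presents pis hs hr.
apply: (linked_ext xyb (beta0 := beta0)); first exact: presents_is_rep hE.
exact: traced_trace_projective hE tP.
Qed.

Lemma linked_prod (V P : lmodType L) v (rho0 : L -> 'M[k]_v) (e : 'cV[k]_v -> V)
    n (tau0 : L -> 'M[k]_n) (e' : 'cV[k]_n -> (V * P)%type) :
  fin_gen V -> fin_gen P -> projective P -> presents rho0 e -> presents tau0 e' ->
  linked rho0 tau0.
Proof.
move=> fV fP pP hr ht; have [r [q qs]] := fin_gen_cover fV.
have fF : fin_gen 'rV[L]_r.
  exists [seq delta_mx 0 j : 'rV[L]_r | j <- enum 'I_r] => u.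
  have sz : size [seq delta_mx 0 j : 'rV[L]_r | j <- enum 'I_r] = r.
    by rewrite size_map size_enum_ord.
  exists (fun i => u 0 (cast_ord sz i)).
  rewrite {1}[u]row_sum_delta (reindex (cast_ord sz)) /=; last first.
    by exists (cast_ord (esym sz)) => i _; rewrite ?cast_ordK ?cast_ordKV.
  apply: eq_bigr => i _; have ir : (i < r)%N := ltn_ord (cast_ord sz i).
  rewrite (nth_map (cast_ord sz i)) ?size_enum_ord //.
  by congr (_ *: delta_mx _ _); apply: val_inj; rewrite /= nth_enum_ord.
have [w [sigma0 [i hi]]] := ker_presents q fF.
have tF := free_traced xyb b_linear r.
apply: linked_trans (linked_exact qs hi hr tF) _; apply: linked_sym.
pose qP (z : 'rV[L]_r * P) : V * P := (q z.1, z.2).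
have qPl : linear qP by move=> l z z'; rewrite /qP linearP.
pose mqP := GRing.isLinear.Build _ _ _ _ qP qPl.
pose lqP := HB.pack_for {linear ('rV[L]_r * P)%type -> (V * P)%type} qP mqP.
have hi' : presents_ker lqP sigma0 (fun u => (i u, 0)).
  have [il ii ia ie] := hi; split.
  - by move=> c u u'; rewrite il; congr pair; rewrite /= scaler0 addr0.
  - by move=> u u' [/ii].
  - by move=> l u; rewrite ia; congr pair; rewrite /= scaler0.
  - move=> [z p]; split=> [[/ie[u <-] /= ->]|[u [<- <-]]]; first by exists u.
    by congr pair; apply/ie; exists u.
apply: (linked_exact (pi := lqP) _ hi' ht).
  by move=> [u p]; have [z <-] := qs u; exists (z, p).
by apply: traced_prod => //; exact: projective_traced xyb b_linear _ _ _.
Qed.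

End Stability.

End Presentations.

Lemma projective_cover_fin_gen (R : nzRingType) (P V : lmodType R) (pi : {linear P -> V}) :
  projective_cover pi -> fin_gen V -> fin_gen P.
Proof.
move=> [_ pis small] [g hg]; have [s sE] := choice pis.
exists (map s g).
have szE : size (map s g) = size g := size_map s g.
apply: small => [|l p q [c ->] [c' ->]|p].
- by exists (fun=> 0); rewrite big1 // => i _; rewrite scale0r.
- exists (fun i => l * c i + c' i); rewrite scaler_sumr -big_split.
  by apply: eq_bigr => i _; rewrite scalerA scalerDl.
have [c cE] := hg (pi p); pose p' := \sum_(i < size (map s g)) c (cast_ord szE i) *: (map s g)`_i.
exists p', (p - p'); split; [by exists (fun i => c (cast_ord szE i)) | | by rewrite addrC subrK].
apply/eqP; rewrite linearB subr_eq0 cE /p' linear_sum (reindex (cast_ord szE)) /=; last first.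
  by exists (cast_ord (esym szE)) => i _; rewrite ?cast_ordK ?cast_ordKV.
apply/eqP/eq_bigr => i _; rewrite linearZ /= (nth_map 0) ?sE // -szE.
by [].
Qed.

Theorem theorem1p1 (k : fieldType) (L : falgType k) (V : lmodType L)
    (hL : frobenius L) (hV : fin_gen V) (hEnd : stable_end_is_k V)
    (R : cobj k) (hR : versal_deformation_ring V R) :
  [/\ represents_deformations V R,
      forall P : lmodType L, fin_gen P -> projective P ->
        forall R' : cobj k, versal_deformation_ring (V * P)%type R' ->
          cobj_iso R R'
    & forall W : lmodType L, first_syzygy W V ->
        forall R' : cobj k, versal_deformation_ring W R' ->
          cobj_iso R R'].
Proof.
have [d [x [y [b [xyb b_linear]]]]] := frobenius_dual_bases hL.
have [n [rho0 [e rho0e]]] := fin_gen_presents hV.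
have sc := stable_end_stably_scalar xyb b_linear rho0e hV hEnd.
have [rhoU /(versal_universal xyb sc) uU] := versal_mx rho0e hR.
(* Only [rho0] is known to be stably scalar, so R' is made versal, then universal, for [rho0] and
   compared with R there. *)
have transfer (W : lmodType L) m (sigma0 : L -> 'M[k]_m) e' (R' : cobj k) :
    presents (V := W) sigma0 e' -> linked rho0 sigma0 ->
    versal_deformation_ring W R' -> cobj_iso R R'.
  move=> sigma0e lk hR'; have [sigmaU vs] := versal_mx sigma0e hR'.
  have [rhoU' /(versal_universal xyb sc) uU'] := versal_linked lk vs.
  exact: universal_iso uU uU'.
split; first exact: (universal_represents rho0e uU).
  move=> P fP pP R'; have [p [pi0 [e' pi0e]]] := fin_gen_presents fP.
  have te := presents_prod rho0e pi0e.
  exact: transfer te (linked_prod xyb b_linear hV fP pP rho0e te).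
move=> W [P [pi [i [cov ii ie]]]] R'.
have fP := projective_cover_fin_gen cov hV; have [pP pis _] := cov.
have [w [sigma0 [j hj]]] := ker_presents pi fP; have [jl ji ja je] := hj.
(* Both [i] and [j] parametrize the kernel of [pi]; the map [g], which is [j] followed by the
   inverse of [i], makes [sigma0] a matrix form of W. *)
have [g gE] := choice (fun u => proj1 (ie _) (proj2 (je (j u)) (ex_intro _ u erefl))).
apply: (transfer _ _ sigma0 g); last first.
  by apply: (linked_exact xyb pis hj rho0e); exact: projective_traced xyb b_linear _ _ _.
split.
- by move=> c u u'; apply: ii; rewrite linearP !gE jl.
- apply: inj_surj_bij => [u u' E|v]; first by apply: ji; rewrite -!gE E.
  have /ie/je[u uE] : exists v', i v' = i v by exists v.
  by exists u; apply: ii; rewrite gE uE.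
- by move=> l u; apply: ii; rewrite linearZ !gE ja.
Qed.
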